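(* Consider the Rössler System $$\dot x=-y-z,\qquad \dot y=x+ay,\qquad \dot z=bx-cz+xz,$$ with parameters $(a,b,c)=(\alpha(\varepsilon),\ \omega^2-1+\beta(\varepsilon),\ \gamma(\varepsilon))$, where $\omega>0$, $\omega\notin\{1,\sqrt2\}$, and $$\alpha(\varepsilon)=\sum_{i=1}^5\varepsilon^i\alpha_i+\mathcal O(\varepsilon^6),\quad \beta(\varepsilon)=\sum_{i=1}^5\varepsilon^i\beta_i+\mathcal O(\varepsilon^6),\quad \gamma(\varepsilon)=\sum_{i=1}^5\varepsilon^i\gamma_i+\mathcal O(\varepsilon^6),$$ with $\varepsilon,\alpha_i,\beta_i,\gamma_i\in\mathbb R$ for $i=1,\dots,5$ and $\gamma_1\neq0$. Define $$\lambda_1=\gamma_1(\omega^2-2),\qquad \lambda_2=\gamma_1(1-\omega^2),$$ $$\delta=\frac{\beta_1\gamma_2+\beta_2\gamma_1+\gamma_1^3(\omega^4-3\omega^2+2)+\gamma_3(\omega^2-1)-\alpha_3}{\gamma_1(1-\omega^2)}.$$ Suppose that $\alpha_1=\gamma_1(\omega^2-1)$, $\alpha_2=\beta_1\gamma_1+\gamma_2(\omega^2-1)$, and $\delta>0$. Then, for $|\varepsilon|\neq0$ sufficiently small, the Rössler System has a periodic solution $\varphi(t,\varepsilon)$ satisfying $\varphi(t,\varepsilon)\to(0,0,0)$ when $\varepsilon\to0$. Moreover, for $\varepsilon>0$ (sufficiently small), such a periodic solution is asymptotically stable if $\lambda_1<0$ and $\lambda_2<0$, and unstable if $\lambda_1>0$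 or $\lambda_2>0$.
   Context: The functions $\alpha(\varepsilon),\beta(\varepsilon),\gamma(\varepsilon)$ are sufficiently smooth near $\varepsilon=0$. For $\varepsilon=0$ the origin is a zero-Hopf equilibrium, i.e. the Jacobian matrix there has eigenvalues $0$ and $\pm i\omega$. ''Periodic solution'' means a nonconstant periodic solution; asymptotic stability/instability refers to the corresponding periodic orbit of the flow in $\mathbb R^3$. *)

(* Defs.v *)
From Stdlib Require Import Reals.
From Coquelicot Require Import Coquelicot.
Open Scope R_scope.

(** [R * R * R] carries the product norm of normed modules, which is the Euclidean one. *)
Notation R3 := (R * R * R)%type.

Definition rossler (a b c : R) (p : R3) : R3 :=
  let '(x, y, z) := p in (- y - z, x + a * y, b * x - c * z + x * z).

(** The derivative is two-sided also at an endpoint of [I].  On [0, T) this is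
    no restriction: the values of [u] at negative times are otherwise free, so a
    one-sided solution extends (e.g. affinely) to a function satisfying this. *)
Definition solves_on (F : R3 -> R3) (I : R -> Prop) (u : R -> R3) : Prop :=
  forall t : R, I t -> is_derive u t (F (u t)).

Definition periodic_solution (F : R3 -> R3) (u : R -> R3) : Prop :=
  solves_on F (fun _ => True) u /\
  (exists T : R, 0 < T /\ forall t : R, u (t + T) = u t) /\
  (exists t s : R, u t <> u s).

(** Equivalently, the distance from [p] to the orbit of [gamma] is less than [r]. *)
Definition near_orbit (gamma : R -> R3) (r : R) (p : R3) : Prop :=
  exists s : R, norm (minus p (gamma s)) < r.

(** Quantifying over solutions on bounded intervals [0, T) makes the definition
    independent of an a priori global existence of the flow; a solution on
    [0, +oo) is covered through its restrictions. *)
Definition orbitally_stable (F : R3 -> R3) (gamma : R -> R3) : Prop :=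
  forall eta : R, 0 < eta ->
  exists kappa : R, 0 < kappa /\
    forall (T : R) (u : R -> R3),
      solves_on F (fun t => 0 <= t < T) u ->
      near_orbit gamma kappa (u 0) ->
      forall t : R, 0 <= t < T -> near_orbit gamma eta (u t).

Definition orbitally_attracting (F : R3 -> R3) (gamma : R -> R3) : Prop :=
  exists kappa : R, 0 < kappa /\
    forall p : R3, near_orbit gamma kappa p ->
      (exists u : R -> R3, u 0 = p /\ solves_on F (fun t => 0 <= t) u) /\
      (forall u : R -> R3, u 0 = p -> solves_on F (fun t => 0 <= t) u ->
         forall eta : R, 0 < eta ->
         Rbar_locally p_infty (fun t => near_orbit gamma eta (u t))).

Definition asymptotically_stable (F : R3 -> R3) (gamma : R -> R3) : Prop :=
  orbitally_stable F gamma /\ orbitally_attracting F gamma.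

Definition unstable (F : R3 -> R3) (gamma : R -> R3) : Prop :=
  ~ orbitally_stable F gamma.

(** Class C^n near 0: continuity of the derivatives of order below [n] follows
    from the existence of the next one. *)
Definition smooth_near_0 (n : nat) (f : R -> R) : Prop :=
  locally 0 (fun e => (forall k : nat, (k <= n)%nat -> ex_derive_n f k e) /\
                      continuous (Derive_n f n) e).

(** The remainder is O(e^6); there is no constant term, and [coef] is used only
    at the indices 1, ..., 5. *)
Definition expansion5 (f : R -> R) (coef : nat -> R) : Prop :=
  exists C : R,
    locally 0 (fun e =>
      Rabs (f e - sum_n_m (fun i => e ^ i * coef i) 1 5) <= C * Rabs e ^ 6).

Definition lambda1 (omega : R) (ga : nat -> R) : R := ga 1%nat * (omega ^ 2 - 2).

Definition lambda2 (omega : R) (ga : nat -> R) : R := ga 1%nat * (1 - omega ^ 2).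

Definition delta (omega : R) (al be ga : nat -> R) : R :=
  (be 1%nat * ga 2%nat + be 2%nat * ga 1%nat
   + ga 1%nat ^ 3 * (omega ^ 4 - 3 * omega ^ 2 + 2)
   + ga 3%nat * (omega ^ 2 - 1) - al 3%nat)
  / (ga 1%nat * (1 - omega ^ 2)).

(* Main.v *)
Require Import Defs.
From Stdlib Require Import ZArith Reals Lra Lia Psatz ClassicalEpsilon List.
From Coquelicot Require Import Coquelicot.
Open Scope R_scope.

(** Scaling [(x, y, z) = e (X, Y, Z)] with [Z = b (Y + e p)] turns the system into
    an [e]-perturbation of a rotation in [(X, Y)] with a conserved third
    coordinate.  In polar coordinates, two near-identity functions of the state
    make the averaged dynamics visible to the order that matters:
    [h] (half the squared radius) has rate [e^3 (c1 h^2 + c0 h) + O(e^4)] and the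
    third coordinate [Q] has rate [e lambda1 Q + O(e^2)].  The condition
    [delta > 0] is the existence of a positive zero of [c1 h^2 + c0 h], at which
    the derivative is a positive multiple of [lambda2].  Parametrized by the angle,
    the solutions are those of a [2 PI]-periodic planar field; the fixed point of
    its return map is found as that of a contraction of Newton type, which works
    for all signs of the two rates.  For [e > 0] the quadratic form
    [+- (dh)^2 +- e (dQ)^2] of the separation from the periodic orbit, with the
    signs of the two rates, grows along solutions; this gives stability when both
    signs are negative and instability otherwise. *)

(** * Ordinary differential equations *)

(** The conditions on [alpha_1] and [alpha_2] make [a - b * c] of order [e ^ 3]; otherwise a linear
    term would enter the rate of [h] at a lower order and outweigh the quadratic one. The obstacle
    is the gap between the two rates: the error of order [e ^ 2] in the equation of [Q] is larger
    than the whole rate of [h]. Each equation is therefore measured against its own rate: [h] is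
    corrected up to order three and [Q] only to order one, the Newton step divides each jump over a
    turn by its own rate, and this is also why [(dQ)^2] carries the weight [e]. The corrected
    functions never serve as coordinates: solutions stay in polar coordinates, where the field is
    explicit, and only the derivatives of these functions along solutions and their closeness to the
    identity are used, so no transformation has to be inverted. The planar field is clamped outside
    a small box, which makes its solutions global; statements about the true system are recovered as
    long as solutions stay in the box. In the estimates [m] bounds the rates from below, [K] is a
    common upper bound, and [z] is the unit of smallness. *)

Lemma Rabs_bounds (x : R) : - Rabs x <= x <= Rabs x.
Proof. apply Rabs_le_between, Rle_refl. Qed.

(* Linear consequences of [- |x| <= x <= |x|] for the absolute values at hand. *)
Ltac abs_lra :=
  repeat first [apply Rabs_le; split | apply Rabs_def1];
  repeat match goal with
  | |- context [Rabs ?x] =>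
    match goal with _ : - Rabs x <= x <= Rabs x |- _ => fail 1 | _ => pose proof (Rabs_bounds x) end
  | _ : context [Rabs ?x] |- _ =>
    match goal with _ : - Rabs x <= x <= Rabs x |- _ => fail 1 | _ => pose proof (Rabs_bounds x) end
  end; lra.

Ltac nonneg := repeat first [lra | assumption | apply Rabs_pos | apply pow2_ge_0
  | apply Rmult_le_pos | apply pow_le | apply Rplus_le_le_0_compat].

Lemma exp_le_exp (x y : R) : x <= y -> exp x <= exp y.
Proof. intros [H | ->]; [left; now apply exp_increasing | apply Rle_refl]. Qed.

Lemma Rabs_diff_triang (a b c : R) : Rabs (a - c) <= Rabs (a - b) + Rabs (b - c).
Proof. abs_lra. Qed.

Lemma MVT_is_derive (f df : R -> R) (a b : R) :
  a <= b -> (forall t, a <= t <= b -> is_derive f t (df t)) ->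
  exists c, a <= c <= b /\ f b - f a = df c * (b - a).
Proof.
intros Hab H.
destruct (MVT_gen f a b df) as [c [Hc E]].
- intros t Ht; rewrite Rmin_left, Rmax_right in Ht by lra; apply H; lra.
- intros t Ht; rewrite Rmin_left, Rmax_right in Ht by lra.
  apply continuity_pt_filterlim, (@ex_derive_continuous R_AbsRing).
  exists (df t); apply H; lra.
- rewrite Rmin_left, Rmax_right in Hc by lra; now exists c.
Qed.

Lemma derive_nonpos_le (f df : R -> R) (a b : R) :
  a <= b -> (forall t, a <= t <= b -> is_derive f t (df t)) ->
  (forall t, a <= t <= b -> df t <= 0) -> f b <= f a.
Proof.
intros Hab H H'; destruct (MVT_is_derive f df a b Hab H) as [c [Hc E]].
specialize (H' c Hc); nra.
Qed.

Lemma derive_bounded_le (f df : R -> R) (a b K : R) :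
  a <= b -> (forall t, a <= t <= b -> is_derive f t (df t)) ->
  (forall t, a <= t <= b -> Rabs (df t) <= K) -> Rabs (f b - f a) <= K * (b - a).
Proof.
intros Hab H H'; destruct (MVT_is_derive f df a b Hab H) as [c [Hc E]].
rewrite E, Rabs_mult, (Rabs_right (b - a)) by lra.
apply Rmult_le_compat_r; [lra | now apply H'].
Qed.

Lemma is_derive_shift (x : R -> R) (c t l : R) :
  is_derive x (t + c) l -> is_derive (fun u => x (u + c)) t l.
Proof.
intros H; evar_last.
- apply (is_derive_comp x (fun u => u + c)); [exact H | auto_derive; [easy | reflexivity]].
- apply Rmult_1_l.
Qed.

(** The product of [f] with [exp (- c * t)] is nonincreasing. Neither [f] nor [c] has a prescribed
    sign: a negative [c] gives decay, and [- U] in place of [f] gives exponential growth of [U]. The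
    derivative is asked for pointwise, so callers need not name it as a function. *)
Lemma gronwall (f : R -> R) (c a b : R) : a <= b ->
  (forall t, a <= t <= b -> exists l, is_derive f t l /\ l <= c * f t) -> f b <= f a * exp (c * (b - a)).
Proof.
intros Hab H0.
assert (H : forall t, a <= t <= b -> is_derive f t (Derive f t) /\ Derive f t <= c * f t).
{ intros t Ht; destruct (H0 t Ht) as [l [I J]]; now rewrite (is_derive_unique f t l I). }
assert (E : f b * exp (- c * b) <= f a * exp (- c * a)).
{ apply (derive_nonpos_le (fun t => f t * exp (- c * t))
           (fun t => (Derive f t - c * f t) * exp (- c * t))); [lra | |].
  - intros t Ht; evar_last.
    + apply (is_derive_mult f (fun t => exp (- c * t)) t (Derive f t) (- c * exp (- c * t))).
      * now apply H.
      * auto_derive; [easy | ring].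
      * intros; apply Rmult_comm.
    + cbv [plus mult]; simpl; ring.
  - intros t Ht; pose proof (exp_pos (- c * t)); destruct (H t Ht); nra. }
replace (f b) with (f b * exp (- c * b) * exp (c * b)).
2: { rewrite Rmult_assoc, <- exp_plus; replace (- c * b + c * b) with 0 by ring.
     rewrite exp_0; ring. }
replace (exp (c * (b - a))) with (exp (- c * a) * exp (c * b)).
2: { rewrite <- exp_plus; f_equal; ring. }
rewrite <- Rmult_assoc; apply Rmult_le_compat_r; [left; apply exp_pos | exact E].
Qed.

Lemma pow_half_small (A eps : R) : 0 < eps -> exists n, A * (/ 2) ^ n < eps.
Proof.
intros He; pose proof (Rabs_pos A); pose proof (Rle_abs A).
destruct (pow_lt_1_zero (/ 2)) with (y := eps / (Rabs A + 1)) as [N HN].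
- rewrite Rabs_right; lra.
- apply Rdiv_lt_0_compat; lra.
- exists N; specialize (HN N (le_n N)).
  assert (0 < (/ 2) ^ N) by (apply pow_lt; lra).
  rewrite Rabs_right in HN by lra.
  apply (Rmult_lt_compat_l (Rabs A + 1)) in HN; [|lra].
  replace ((Rabs A + 1) * (eps / (Rabs A + 1))) with eps in HN by (field; lra). nra.
Qed.

Lemma geometric_limit (u : nat -> R) (A : R) :
  (forall n, Rabs (u (S n) - u n) <= A * (/ 2) ^ n) ->
  exists l, forall n, Rabs (u n - l) <= 2 * A * (/ 2) ^ n.
Proof.
intros H.
assert (A0 : 0 <= A) by (specialize (H O); simpl in H; abs_lra).
(* The subtracted tail makes the induction on [m] close: each new term is exactly the decrease of
   the tail. *)
assert (B : forall n m, Rabs (u (n + m)%nat - u n) <= 2 * A * (/ 2) ^ n - 2 * A * (/ 2) ^ (n + m)).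
{ intros n m; induction m as [|m IH].
  - rewrite Nat.add_0_r, Rminus_eq_0, Rabs_R0; lra.
  - rewrite Nat.add_succ_r; specialize (H (n + m)%nat); simpl; abs_lra. }
assert (B' : forall n m, (n <= m)%nat -> Rabs (u m - u n) <= 2 * A * (/ 2) ^ n).
{ intros n m Hm; specialize (B n (m - n)%nat).
  replace (n + (m - n))%nat with m in B by lia.
  assert (0 <= A * (/ 2) ^ m) by nonneg; lra. }
destruct (Rcomplete.R_complete u) as [l Hl].
- intros eps He; destruct (pow_half_small (2 * A) (eps / 2)) as [N HN]; [lra|].
  exists N; intros n m Hn Hm; unfold Rdist.
  pose proof (B' N n Hn); pose proof (B' N m Hm); abs_lra.
- exists l; intros n; apply Rnot_lt_le; intros Hlt.
  destruct (Hl (Rabs (u n - l) - 2 * A * (/ 2) ^ n)) as [N HN]; [lra|].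
  specialize (HN (Nat.max n N) (Nat.le_max_r _ _)); unfold Rdist in HN.
  pose proof (B' n (Nat.max n N) (Nat.le_max_l _ _)) as Hn.
  assert (Rabs (u n - l) < Rabs (u n - l)); [|lra].
  apply Rabs_def1; abs_lra.
Qed.

(** Turns explicit rates of convergence into equalities and inequalities for the limits, without
    limit theorems. *)
Lemma le_of_le_pow_half (a A : R) : (forall n, a <= A * (/ 2) ^ n) -> a <= 0.
Proof.
intros H; apply Rnot_lt_le; intros Ha.
destruct (pow_half_small A a Ha) as [n Hn]; specialize (H n); lra.
Qed.

(** The last hypothesis keeps the iteration from the origin inside the ball: half of the radius is
    spent on the image of the center, the other half on the contraction. *)
Lemma contraction_fixed_point_l1 (N1 N2 : R -> R -> R) (rho : R) :
  0 <= rho ->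
  (forall x y x' y', Rabs x + Rabs y <= rho -> Rabs x' + Rabs y' <= rho ->
     Rabs (N1 x y - N1 x' y') + Rabs (N2 x y - N2 x' y')
       <= / 2 * (Rabs (x - x') + Rabs (y - y'))) ->
  Rabs (N1 0 0) + Rabs (N2 0 0) <= / 2 * rho ->
  exists x y, Rabs x + Rabs y <= rho /\ N1 x y = x /\ N2 x y = y.
Proof.
intros Hr Hc H0.
assert (T : forall a b, Rabs a <= Rabs (a - b) + Rabs b) by (intros; abs_lra).
assert (Z : Rabs 0 + Rabs 0 <= rho) by (rewrite Rabs_R0; lra).
assert (Hin : forall x y, Rabs x + Rabs y <= rho -> Rabs (N1 x y) + Rabs (N2 x y) <= rho).
{ intros x y Hxy; specialize (Hc x y 0 0 Hxy Z); rewrite !Rminus_0_r in Hc.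
  pose proof (T (N1 x y) (N1 0 0)); pose proof (T (N2 x y) (N2 0 0)); lra. }
set (it := fix it (n : nat) := match n with
  | O => (0, 0) | S n => (N1 (fst (it n)) (snd (it n)), N2 (fst (it n)) (snd (it n))) end).
assert (I : forall n, Rabs (fst (it n)) + Rabs (snd (it n)) <= rho).
{ induction n as [|n IH]; [exact Z | apply Hin, IH]. }
assert (D : forall n, Rabs (fst (it (S n)) - fst (it n)) + Rabs (snd (it (S n)) - snd (it n))
   <= rho * (/ 2) ^ n).
{ induction n as [|n IH].
  - simpl; rewrite !Rminus_0_r; lra.
  - specialize (Hc _ _ _ _ (I (S n)) (I n)); simpl in *; lra. }
destruct (geometric_limit (fun n => fst (it n)) rho) as [x Hx].
{ intros n; specialize (D n); pose proof (Rabs_pos (snd (it (S n)) - snd (it n))); lra. }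
destruct (geometric_limit (fun n => snd (it n)) rho) as [y Hy].
{ intros n; specialize (D n); pose proof (Rabs_pos (fst (it (S n)) - fst (it n))); lra. }
assert (Bxy : Rabs x + Rabs y <= rho).
{ apply Rminus_le, (le_of_le_pow_half _ (4 * rho)); intros n.
  specialize (I n); specialize (Hx n); specialize (Hy n); rewrite Rabs_minus_sym in Hx, Hy.
  pose proof (T x (fst (it n))); pose proof (T y (snd (it n))); lra. }
assert (Hfix : Rabs (N1 x y - x) + Rabs (N2 x y - y) <= 0).
{ apply (le_of_le_pow_half _ (4 * rho)); intros n.
  specialize (Hc _ _ _ _ Bxy (I n)).
  pose proof (Hx (S n)) as Hx1; pose proof (Hy (S n)) as Hy1; simpl in Hx1, Hy1.
  specialize (Hx n); specialize (Hy n).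
  pose proof (Rabs_diff_triang (N1 x y) (N1 (fst (it n)) (snd (it n))) x).
  pose proof (Rabs_diff_triang (N2 x y) (N2 (fst (it n)) (snd (it n))) y).
  rewrite (Rabs_minus_sym x), (Rabs_minus_sym y) in Hc; lra. }
exists x, y; split; [exact Bxy|].
pose proof (Rabs_pos (N1 x y - x)); pose proof (Rabs_pos (N2 x y - y)).
split; apply Rminus_diag_uniq; apply Rabs_eq_0; lra.
Qed.

(** Continuous induction. At the supremum of the times up to which the strict bound holds,
    continuity gives the weak bound, the hypothesis restores strictness, and continuity carries it a
    little further. This is how solutions are kept in the box where the estimates hold. *)
Lemma self_improving_bound (n : R -> R) (a c : R) :
  (forall t, continuous n t) -> n a < c ->
  (forall t, a <= t -> (forall s, a <= s <= t -> n s <= c) -> n t < c) ->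
  forall t, a <= t -> n t < c.
Proof.
intros Hn Ha H.
intros t1 Ht1; apply Rnot_le_lt; intros Hbad.
set (S := fun t => a <= t <= t1 /\ forall s, a <= s <= t -> n s < c).
destruct (completeness S) as [m [Hub Hlub]].
- exists t1; intros t [Ht _]; lra.
- exists a; split; [lra | intros s Hs; replace s with a by lra; exact Ha].
- assert (a <= m) by (apply Hub; split; [lra | intros s Hs; replace s with a by lra; exact Ha]).
  assert (m <= t1) by (apply Hlub; intros t [Ht _]; lra).
  assert (Hb : forall s, a <= s < m -> n s < c).
  { intros s Hs; apply Rnot_le_lt; intros Hns.
    assert (m <= s); [|lra].
    apply Hlub; intros t [Ht Ht']; apply Rnot_lt_le; intros Hst.
    specialize (Ht' s ltac:(lra)); lra. }
  assert (Hm' : n m <= c).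
  { destruct (Req_dec a m) as [<- | Ham]; [lra|].
    apply Rnot_lt_le; intros Hlt.
    destruct (proj1 (filterlim_locally n (n m)) (Hn m) (mkposreal _ (proj2 (Rlt_0_minus _ _) Hlt))) as [d Hd].
    pose proof (cond_pos d).
    set (u := Rmax a (m - d / 2)).
    assert (a <= u < m) by (unfold u; split; [apply Rmax_l | apply Rmax_lub_lt; lra]).
    assert (m - d / 2 <= u) by apply Rmax_r.
    assert (Bu : ball m d u).
    { change (Rabs (u - m) < d); rewrite Rabs_left; lra. }
    specialize (Hd u Bu); change (Rabs (n u - n m) < n m - c) in Hd.
    apply Rabs_def2 in Hd; specialize (Hb u ltac:(lra)); lra. }
  assert (Hm : n m < c).
  { apply H; [lra | intros s Hs].
    destruct (Req_dec s m) as [-> | ]; [exact Hm' | left; apply Hb; lra]. }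
  destruct (proj1 (filterlim_locally n (n m)) (Hn m) (mkposreal _ (proj2 (Rlt_0_minus _ _) Hm))) as [d Hd].
  destruct (Rle_lt_or_eq_dec m t1) as [Hlt | ->]; [assumption | | lra].
  assert (Hs : S (Rmin t1 (m + d / 2))).
  { pose proof (cond_pos d); split.
    - split; [apply Rmin_glb; lra | apply Rmin_l].
    - intros s Hs; destruct (Rlt_le_dec s m) as [Hsm | Hsm]; [apply Hb; lra|].
      assert (s <= m + d / 2) by (eapply Rle_trans; [apply Hs | apply Rmin_r]).
      assert (B : ball m d s).
      { change (Rabs (s - m) < d); rewrite Rabs_right; lra. }
      specialize (Hd s B); change (Rabs (n s - n m) < c - n m) in Hd.
      apply Rabs_def2 in Hd; lra. }
  specialize (Hub _ Hs); revert Hub; pose proof (cond_pos d).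
  unfold Rmin; destruct (Rle_dec t1 (m + d / 2)); lra.
Qed.

Lemma periodic_IZR (f : R -> R) (T : R) :
  (forall t, f (t + T) = f t) -> forall (k : Z) t, f (t + IZR k * T) = f t.
Proof.
intros P.
assert (PN : forall (n : nat) t, f (t + INR n * T) = f t).
{ induction n as [|n IH]; intros t.
  - simpl; f_equal; ring.
  - rewrite S_INR; replace (t + (INR n + 1) * T) with (t + INR n * T + T) by ring.
    now rewrite P. }
intros k t; destruct (Z_le_dec 0 k) as [Hk | Hk].
- rewrite <- (PN (Z.to_nat k) t), INR_IZR_INZ, Z2Nat.id by easy; reflexivity.
- rewrite <- (PN (Z.to_nat (- k)) (t + IZR k * T)), INR_IZR_INZ, Z2Nat.id by lia.
  rewrite opp_IZR; f_equal; ring.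
Qed.

Lemma archimedean_period (T t : R) : 0 < T -> exists k : Z, 0 <= t - IZR k * T <= T.
Proof.
intros HT; destruct (archimed (t / T)) as [a1 a2].
exists (up (t / T) - 1)%Z; rewrite minus_IZR; set (v := t / T) in *.
replace t with (v * T) by (unfold v; field; lra); nra.
Qed.

Lemma continuous_of_lipschitz (h : R -> R) (B : R) :
  (forall t t', Rabs (h t - h t') <= B * Rabs (t - t')) -> forall t, continuous h t.
Proof.
intros H t; apply filterlim_locally; intros [eps He].
assert (HB : 0 < eps / (Rabs B + 1)) by (pose proof (Rabs_pos B); apply Rdiv_lt_0_compat; lra).
exists (mkposreal _ HB); intros s Hs; change (Rabs (s - t) < eps / (Rabs B + 1)) in Hs.
change (Rabs (h s - h t) < eps); eapply Rle_lt_trans; [apply H|].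
pose proof (Rabs_pos B); pose proof (Rle_abs B); pose proof (Rabs_pos (s - t)).
apply (Rmult_lt_compat_l (Rabs B + 1)) in Hs; [|lra].
replace ((Rabs B + 1) * (eps / (Rabs B + 1))) with eps in Hs by (field; lra). nra.
Qed.

(** Lipschitz in time as well, so that one constant yields continuity of the field along continuous
    curves. *)
Definition lipschitz3 (f : R -> R -> R -> R) (L : R) : Prop :=
  forall t x y t' x' y', Rabs (f t x y - f t' x' y')
    <= L * (Rabs (t - t') + Rabs (x - x') + Rabs (y - y')).

Lemma continuous_lipschitz3 (f : R -> R -> R -> R) (L : R) (x y : R -> R) (t : R) :
  lipschitz3 f L -> continuous x t -> continuous y t ->
  continuous (fun s => f s (x s) (y s)) t.
Proof.
intros Hf Hx Hy; apply filterlim_locally; intros [eps He].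
assert (HB : 0 < eps / (3 * (Rabs L + 1))) by (pose proof (Rabs_pos L); apply Rdiv_lt_0_compat; lra).
pose proof (proj1 (filterlim_locally x (x t)) Hx (mkposreal _ HB)) as Lx.
pose proof (proj1 (filterlim_locally y (y t)) Hy (mkposreal _ HB)) as Ly.
assert (Lt : locally t (fun s => Rabs (s - t) < eps / (3 * (Rabs L + 1)))).
{ exists (mkposreal _ HB); intros s Hs; exact Hs. }
generalize (filter_and _ _ Lx (filter_and _ _ Ly Lt)); apply filter_imp.
intros s [Sx [Sy St]]; change (Rabs (x s - x t) < eps / (3 * (Rabs L + 1))) in Sx.
change (Rabs (y s - y t) < eps / (3 * (Rabs L + 1))) in Sy.
change (Rabs (f s (x s) (y s) - f t (x t) (y t)) < eps).
eapply Rle_lt_trans; [apply Hf|].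
set (d := eps / (3 * (Rabs L + 1))) in *.
assert (E : eps = (Rabs L + 1) * (3 * d)) by (unfold d; field; pose proof (Rabs_pos L); lra).
pose proof (Rabs_pos L); pose proof (Rle_abs L).
pose proof (Rabs_pos (s - t)); pose proof (Rabs_pos (x s - x t)); pose proof (Rabs_pos (y s - y t)).
rewrite E; nra.
Qed.

Lemma continuous_ex_RInt (h : R -> R) (a b : R) : (forall t, continuous h t) -> ex_RInt h a b.
Proof. intros H; apply (@ex_RInt_continuous R_CompleteNormedModule); auto. Qed.

Lemma RInt_lipschitz_bound (h : R -> R) (B a b : R) :
  (forall t, continuous h t) -> (forall t, Rabs (h t) <= B) ->
  Rabs (RInt h a b) <= B * Rabs (b - a).
Proof.
intros Hc HB.
pose proof (fun u v => continuous_ex_RInt h u v Hc) as E.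
assert (K : forall u v, u <= v -> Rabs (RInt h u v) <= B * Rabs (v - u)).
{ intros u v Huv; rewrite (Rabs_right (v - u)) by lra; rewrite Rmult_comm.
  apply (@norm_RInt_le_const R_NormedModule h u v _ B Huv).
  - intros; apply HB.
  - now apply (@RInt_correct R_CompleteNormedModule). }
destruct (Rle_dec a b) as [H | H]; [now apply K|].
rewrite <- (@opp_RInt_swap R_CompleteNormedModule h b a) by apply E.
change (Rabs (- RInt h b a) <= B * Rabs (b - a)).
rewrite Rabs_Ropp, Rabs_minus_sym; apply K; lra.
Qed.

(** In the norm weighted by [exp (- k * Rabs t)], integration gains a factor [1 / k]; for large [k]
    the Picard operator is then a contraction on the whole line at once. Negative times are reduced
    to positive ones by reflection. *)
Lemma RInt_exp_bound (h : R -> R) (c k t : R) :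
  0 < k -> 0 <= c -> (forall s, continuous h s) -> (forall s, Rabs (h s) <= c * exp (k * Rabs s)) ->
  Rabs (RInt h 0 t) <= c / k * exp (k * Rabs t).
Proof.
intros Hk Hc0.
assert (P : forall (h : R -> R) t, 0 <= t -> (forall s, continuous h s) ->
  (forall s, Rabs (h s) <= c * exp (k * Rabs s)) -> Rabs (RInt h 0 t) <= c / k * exp (k * Rabs t)).
{ clear h t; intros h t H Hc HB.
  assert (I : is_RInt (fun s => c * exp (k * s)) 0 t (c / k * exp (k * t) - c / k * exp (k * 0))).
  { apply (is_RInt_derive (fun s => c / k * exp (k * s))).
    - intros s _; auto_derive; [easy | field; lra].
    - intros s _; apply (@ex_derive_continuous R_AbsRing); auto_derive; easy. }
  rewrite (Rabs_right t) by lra; eapply Rle_trans.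
  - apply (@norm_RInt_le R_NormedModule h (fun s => c * exp (k * s)) 0 t _ _ H); [| |exact I].
    + intros s Hs; change (Rabs (h s) <= c * exp (k * s)).
      rewrite <- (Rabs_right s) at 2 by lra; apply HB.
    + now apply (@RInt_correct R_CompleteNormedModule), continuous_ex_RInt.
  - rewrite Rmult_0_r, exp_0; assert (0 <= c / k) by (apply Rdiv_le_0_compat; lra); lra. }
intros Hc HB; destruct (Rle_dec 0 t) as [H | H]; [now apply P|].
assert (E : RInt (fun s => - h (- s)) 0 (- t) = RInt h 0 t).
{ apply (@is_RInt_unique R_CompleteNormedModule), (@is_RInt_comp_opp R_NormedModule).
  rewrite Ropp_0, Ropp_involutive.
  now apply (@RInt_correct R_CompleteNormedModule), continuous_ex_RInt. }
rewrite <- E, <- (Rabs_Ropp t); apply P; [lra | |].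
- intros s; apply (@continuous_opp R_UniformSpace R_AbsRing R_NormedModule), (continuous_comp Ropp h); [|apply Hc].
  apply (@continuous_opp R_UniformSpace R_AbsRing R_NormedModule), continuous_id.
- intros s; change (Rabs (- h (- s)) <= c * exp (k * Rabs s)); rewrite Rabs_Ropp, <- (Rabs_Ropp s); apply HB.
Qed.

(** * Global existence by Picard iteration in an exponentially weighted norm *)

Section Picard.
Variables (f g : R -> R -> R -> R) (L B x0 y0 : R).
Hypotheses (HL : 1 <= L) (Hf : lipschitz3 f L) (Hg : lipschitz3 g L).
Hypotheses (Bf : forall t x y, Rabs (f t x y) <= B) (Bg : forall t x y, Rabs (g t x y) <= B).

Fixpoint picard (n : nat) : (R -> R) * (R -> R) := match n with
  | O => (fun _ => x0, fun _ => y0)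
  | S n => (fun t => x0 + RInt (fun s => f s (fst (picard n) s) (snd (picard n) s)) 0 t,
            fun t => y0 + RInt (fun s => g s (fst (picard n) s) (snd (picard n) s)) 0 t) end.

Lemma primitive_lipschitz (h : R -> R) (c : R) :
  (forall t, continuous h t) -> (forall t, Rabs (h t) <= B) ->
  forall t t', Rabs ((c + RInt h 0 t) - (c + RInt h 0 t')) <= B * Rabs (t - t').
Proof.
intros Hc HB t t'.
pose proof (fun u v => continuous_ex_RInt h u v Hc) as E.
replace (c + RInt h 0 t - (c + RInt h 0 t')) with (RInt h t' t); [now apply RInt_lipschitz_bound|].
pose proof (@RInt_Chasles R_CompleteNormedModule h 0 t' t (E _ _) (E _ _)) as H.
change (RInt h 0 t' + RInt h t' t = RInt h 0 t) in H; lra.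
Qed.

Lemma picard_lipschitz n t t' :
  Rabs (fst (picard n) t - fst (picard n) t') <= B * Rabs (t - t') /\
  Rabs (snd (picard n) t - snd (picard n) t') <= B * Rabs (t - t').
Proof.
assert (B0 : 0 <= B) by (eapply Rle_trans; [apply Rabs_pos | apply (Bf 0 0 0)]).
revert t t'; induction n as [|n IH]; intros t t'.
- simpl; rewrite !Rminus_eq_0, Rabs_R0; pose proof (Rabs_pos (t - t')); split; nra.
- assert (Cx : forall t, continuous (fst (picard n)) t) by (apply (continuous_of_lipschitz _ B); apply IH).
  assert (Cy : forall t, continuous (snd (picard n)) t) by (apply (continuous_of_lipschitz _ B); apply IH).
  simpl; split; apply primitive_lipschitz; auto; intros s; apply (continuous_lipschitz3 _ L); auto.
Qed.

Lemma picard_continuous n t : continuous (fst (picard n)) t /\ continuous (snd (picard n)) t.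
Proof. split; apply (continuous_of_lipschitz _ B); intros; apply picard_lipschitz. Qed.

(** With the weight [k = 4 * L] each of the two integrals contributes a quarter, so one Picard step
    halves the weighted distance. *)
Lemma picard_diff_bound (x y x' y' : R -> R) (c : R) :
  0 <= c ->
  (forall t, continuous x t) -> (forall t, continuous y t) ->
  (forall t, continuous x' t) -> (forall t, continuous y' t) ->
  (forall t, Rabs (x t - x' t) + Rabs (y t - y' t) <= c * exp (4 * L * Rabs t)) ->
  forall t,
  Rabs (RInt (fun s => f s (x s) (y s)) 0 t - RInt (fun s => f s (x' s) (y' s)) 0 t) +
  Rabs (RInt (fun s => g s (x s) (y s)) 0 t - RInt (fun s => g s (x' s) (y' s)) 0 t)
  <= / 2 * c * exp (4 * L * Rabs t).
Proof.
intros Hc Cx Cy Cx' Cy' H t.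
assert (K : forall h, lipschitz3 h L ->
  Rabs (RInt (fun s => h s (x s) (y s)) 0 t - RInt (fun s => h s (x' s) (y' s)) 0 t)
  <= / 4 * c * exp (4 * L * Rabs t)).
{ intros h Hh.
  assert (C1 : forall s, continuous (fun s => h s (x s) (y s)) s) by (intros; apply (continuous_lipschitz3 _ L); auto).
  assert (C2 : forall s, continuous (fun s => h s (x' s) (y' s)) s) by (intros; apply (continuous_lipschitz3 _ L); auto).
  assert (Eq : RInt (fun s => h s (x s) (y s)) 0 t - RInt (fun s => h s (x' s) (y' s)) 0 t
    = RInt (fun s => h s (x s) (y s) - h s (x' s) (y' s)) 0 t).
  { symmetry; apply (@RInt_minus R_CompleteNormedModule);
    apply continuous_ex_RInt; auto. }
  rewrite Eq.
  replace (/ 4 * c) with (L * c / (4 * L)) by (field; lra).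
  apply RInt_exp_bound; [lra | nra | |].
  - intros s; apply (@continuous_minus _ R_AbsRing R_NormedModule); auto.
  - intros s; eapply Rle_trans; [apply Hh|].
    rewrite Rminus_eq_0, Rabs_R0, Rmult_assoc.
    apply Rmult_le_compat_l; [lra|]; specialize (H s); lra. }
pose proof (K f Hf); pose proof (K g Hg); lra.
Qed.

Lemma picard_step n t :
  Rabs (fst (picard (S n)) t - fst (picard n) t) + Rabs (snd (picard (S n)) t - snd (picard n) t)
  <= 2 * B * (/ 2) ^ n * exp (4 * L * Rabs t).
Proof.
assert (B0 : 0 <= B) by (eapply Rle_trans; [apply Rabs_pos | apply (Bf 0 0 0)]).
revert t; induction n as [|n IH]; intros t.
- assert (K : forall h, lipschitz3 h L -> (forall t x y, Rabs (h t x y) <= B) ->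
    Rabs (RInt (fun s => h s x0 y0) 0 t) <= B * exp (4 * L * Rabs t)).
  { intros h Hh Bh; eapply Rle_trans.
    - apply (RInt_lipschitz_bound _ B); [|intros; apply Bh].
      intros s; apply (continuous_lipschitz3 h L (fun _ => x0) (fun _ => y0)); auto; apply continuous_const.
    - apply Rmult_le_compat_l; [lra|]; rewrite Rminus_0_r.
      pose proof (Rabs_pos t); pose proof (exp_ineq1_le (4 * L * Rabs t)); nra. }
  simpl.
  assert (Z : forall a b : R, a + b - a = b) by (intros; ring); rewrite !Z.
  pose proof (K f Hf Bf); pose proof (K g Hg Bg); lra.
- assert (P : 0 <= 2 * B * (/ 2) ^ n).
  { apply Rmult_le_pos; [lra | left; apply pow_lt; lra]. }
  pose proof (picard_diff_bound _ _ _ _ _ P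
    (fun s => proj1 (picard_continuous (S n) s)) (fun s => proj2 (picard_continuous (S n) s))
    (fun s => proj1 (picard_continuous n s)) (fun s => proj2 (picard_continuous n s)) IH t) as H.
  set (S' := S n) in *; simpl.
  assert (Z : forall a b c : R, a + b - (a + c) = b - c) by (intros; ring); rewrite !Z.
  eapply Rle_trans; [exact H|]; right; simpl; field.
Qed.

(** All iterates share the Lipschitz constant [B], which passes to pointwise limits; this gives
    continuity of the limit. [pr] stands for either component. *)
Lemma picard_component (pr : (R -> R) * (R -> R) -> R -> R) :
  (forall n t, Rabs (pr (picard (S n)) t - pr (picard n) t) <= 2 * B * (/ 2) ^ n * exp (4 * L * Rabs t)) ->
  (forall n t t', Rabs (pr (picard n) t - pr (picard n) t') <= B * Rabs (t - t')) ->
  exists x : R -> R,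
    (forall t n, Rabs (pr (picard n) t - x t) <= 2 * (2 * B * exp (4 * L * Rabs t)) * (/ 2) ^ n) /\
    (forall t, continuous x t).
Proof.
intros Hstep Hlip.
assert (Ex : forall t, exists l, forall n, Rabs (pr (picard n) t - l)
   <= 2 * (2 * B * exp (4 * L * Rabs t)) * (/ 2) ^ n).
{ intros t; apply (geometric_limit (fun n => pr (picard n) t)); intros n; specialize (Hstep n t); lra. }
set (x := fun t => proj1_sig (constructive_indefinite_description _ (Ex t))).
assert (Hx : forall t n, Rabs (pr (picard n) t - x t) <= 2 * (2 * B * exp (4 * L * Rabs t)) * (/ 2) ^ n).
{ intros t; exact (proj2_sig (constructive_indefinite_description _ (Ex t))). }
exists x; split; [exact Hx|]; apply (continuous_of_lipschitz _ B); clearbody x; intros t t'.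
apply Rminus_le, (le_of_le_pow_half _ (4 * B * exp (4 * L * Rabs t) + 4 * B * exp (4 * L * Rabs t'))).
intros n; pose proof (Hx t n); pose proof (Hx t' n); specialize (Hlip n t t').
rewrite (Rabs_minus_sym (pr (picard n) t) (x t)) in *.
pose proof (Rabs_diff_triang (x t) (pr (picard n) t) (x t')).
pose proof (Rabs_diff_triang (pr (picard n) t) (pr (picard n) t') (x t')); lra.
Qed.

Lemma picard_limit : exists x y : R -> R, x 0 = x0 /\ y 0 = y0 /\
  (forall t, is_derive x t (f t (x t) (y t))) /\ (forall t, is_derive y t (g t (x t) (y t))).
Proof.
assert (B0 : 0 <= B) by (eapply Rle_trans; [apply Rabs_pos | apply (Bf 0 0 0)]).
destruct (picard_component fst) as [x [Hx Cx]].
{ intros n t; pose proof (picard_step n t); pose proof (Rabs_pos (snd (picard (S n)) t - snd (picard n) t)); lra. }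
{ intros; apply picard_lipschitz. }
destruct (picard_component snd) as [y [Hy Cy]].
{ intros n t; pose proof (picard_step n t); pose proof (Rabs_pos (fst (picard (S n)) t - fst (picard n) t)); lra. }
{ intros; apply picard_lipschitz. }
assert (D : forall t n,
  Rabs (RInt (fun s => f s (fst (picard n) s) (snd (picard n) s)) 0 t - RInt (fun s => f s (x s) (y s)) 0 t) +
  Rabs (RInt (fun s => g s (fst (picard n) s) (snd (picard n) s)) 0 t - RInt (fun s => g s (x s) (y s)) 0 t)
  <= 4 * B * (/ 2) ^ n * exp (4 * L * Rabs t)).
{ intros t n; replace (4 * B * (/ 2) ^ n) with (/ 2 * (8 * B * (/ 2) ^ n)) by field.
  apply picard_diff_bound; auto; try (intros; apply picard_continuous); [nonneg|].
  intros s; specialize (Hx s n); specialize (Hy s n); lra. }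
(* [u + w n] plays the iterate [S n]: it converges both to [u + v] and to [l]. *)
assert (Id : forall (u v l : R) (w : nat -> R) t, (forall n, Rabs (w n - v) <= 4 * B * (/ 2) ^ n * exp (4 * L * Rabs t)) ->
  (forall n, Rabs (u + w n - l) <= 2 * (2 * B * exp (4 * L * Rabs t)) * (/ 2) ^ S n) -> u + v = l).
{ intros u v l w t H1 H2; apply Rminus_diag_uniq, Rabs_eq_0, Rle_antisym; [|apply Rabs_pos].
  apply (le_of_le_pow_half _ (6 * B * exp (4 * L * Rabs t))); intros n.
  specialize (H1 n); specialize (H2 n); simpl in H2; abs_lra. }
assert (Ix : forall t, x0 + RInt (fun s => f s (x s) (y s)) 0 t = x t).
{ intros t; eapply (Id _ _ _ (fun n => RInt (fun s => f s (fst (picard n) s) (snd (picard n) s)) 0 t) t);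
  [|intros n; apply (Hx t (S n))].
  intros n; specialize (D t n); abs_lra. }
assert (Iy : forall t, y0 + RInt (fun s => g s (x s) (y s)) 0 t = y t).
{ intros t; eapply (Id _ _ _ (fun n => RInt (fun s => g s (fst (picard n) s) (snd (picard n) s)) 0 t) t);
  [|intros n; apply (Hy t (S n))].
  intros n; specialize (D t n); abs_lra. }
assert (Dv : forall h c, lipschitz3 h L -> forall t,
  is_derive (fun t => c + RInt (fun s => h s (x s) (y s)) 0 t) t (h t (x t) (y t))).
{ intros h c Hh t.
  assert (C : forall s, continuous (fun s => h s (x s) (y s)) s) by (intros; apply (continuous_lipschitz3 _ L); auto).
  evar_last.
  - apply (@is_derive_plus R_AbsRing R_NormedModule); [apply is_derive_const|].
    apply (@is_derive_RInt R_NormedModule (fun s => h s (x s) (y s)) _ 0); [|apply C].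
    apply filter_forall; intros u; apply (@RInt_correct R_CompleteNormedModule).
    apply continuous_ex_RInt; auto.
  - apply plus_zero_l. }
exists x, y; split; [|split; [|split]].
- rewrite <- Ix, RInt_point; apply Rplus_0_r.
- rewrite <- Iy, RInt_point; apply Rplus_0_r.
- intros t; eapply is_derive_ext; [intros s; apply Ix | now apply Dv].
- intros t; eapply is_derive_ext; [intros s; apply Iy | now apply Dv].
Qed.

End Picard.

Lemma cauchy_lipschitz (f g : R -> R -> R -> R) (L B : R) :
  lipschitz3 f L -> lipschitz3 g L ->
  (forall t x y, Rabs (f t x y) <= B) -> (forall t x y, Rabs (g t x y) <= B) ->
  forall t0 x0 y0, exists x y : R -> R, x t0 = x0 /\ y t0 = y0 /\
  (forall t, is_derive x t (f t (x t) (y t))) /\ (forall t, is_derive y t (g t (x t) (y t))).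
Proof.
intros Hf Hg Bf Bg t0 x0 y0.
assert (M : forall h, lipschitz3 h L -> lipschitz3 (fun t => h (t + t0)) (Rmax 1 L)).
{ intros h Hh t x y t' x' y'; eapply Rle_trans; [apply Hh|].
  replace (t + t0 - (t' + t0)) with (t - t') by ring.
  apply Rmult_le_compat_r; [|apply Rmax_r].
  nonneg. }
destruct (picard_limit (fun t => f (t + t0)) (fun t => g (t + t0)) (Rmax 1 L) B x0 y0
  (Rmax_l _ _) (M _ Hf) (M _ Hg)) as [x [y [Hx [Hy [Dx Dy]]]]]; auto.
exists (fun t => x (t + - t0)), (fun t => y (t + - t0)).
assert (Z : forall t : R, t + - t0 + t0 = t) by (intros; ring).
rewrite Rplus_opp_r; split; [|split; [|split]]; auto; intros t; apply is_derive_shift.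
- rewrite <- (Z t) at 2; apply Dx.
- rewrite <- (Z t) at 2; apply Dy.
Qed.

(** * A periodic orbit of a slow-fast system *)

Definition field_solution (g1 g2 : R -> R -> R -> R) (x y : R -> R) : Prop :=
  forall t, is_derive x t (g1 t (x t) (y t)) /\ is_derive y t (g2 t (x t) (y t)).

Lemma derive_continuous (x : R -> R) (t l : R) : is_derive x t l -> continuous x t.
Proof. intros H; apply (@ex_derive_continuous R_AbsRing); now exists l. Qed.

Lemma continuous_l1_dist (x x' y y' : R -> R) (t : R) :
  continuous x t -> continuous x' t -> continuous y t -> continuous y' t ->
  continuous (fun t => Rabs (x t - x' t) + Rabs (y t - y' t)) t.
Proof.
assert (P : forall u v : R -> R, continuous u t -> continuous v t ->
  continuous (fun t => Rabs (u t - v t)) t).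
{ intros u v Hu Hv.
  apply (continuous_comp (fun t => u t - v t) Rabs); [|apply continuous_Rabs].
  now apply (@continuous_minus R_UniformSpace R_AbsRing R_NormedModule u v). }
intros Hx Hx' Hy Hy'.
apply (@continuous_plus R_UniformSpace R_AbsRing R_NormedModule
  (fun t => Rabs (x t - x' t)) (fun t => Rabs (y t - y' t))); now apply P.
Qed.

Lemma Derive_eta (x : R -> R) (t l : R) : is_derive x t l -> Derive (fun u : R => x u) t = l.
Proof. exact (is_derive_unique x t l). Qed.

Lemma is_derive_weighted_sq_dist (x x' y y' : R -> R) (p q t dx dx' dy dy' : R) :
  is_derive x t dx -> is_derive x' t dx' -> is_derive y t dy -> is_derive y' t dy' ->
  is_derive (fun t => p * (x t - x' t) ^ 2 + q * (y t - y' t) ^ 2) t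
    (2 * p * (x t - x' t) * (dx - dx') + 2 * q * (y t - y' t) * (dy - dy')).
Proof.
intros A A' B B'; auto_derive.
- repeat split; eexists; eassumption.
- rewrite (Derive_eta _ _ _ A), (Derive_eta _ _ _ A'), (Derive_eta _ _ _ B), (Derive_eta _ _ _ B'); ring.
Qed.

(** The 4 comes from [2 * k * (p + q) ^ 2 <= 4 * k * (p ^ 2 + q ^ 2)]. The unit weights keep the
    shape of the weighted form, whose derivative is already computed. *)
Lemma separation_derive (g1 g2 : R -> R -> R -> R) (x y x' y' : R -> R) (k t : R) :
  0 <= k -> field_solution g1 g2 x y -> field_solution g1 g2 x' y' ->
  Rabs (g1 t (x t) (y t) - g1 t (x' t) (y' t)) <= k * (Rabs (x t - x' t) + Rabs (y t - y' t)) ->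
  Rabs (g2 t (x t) (y t) - g2 t (x' t) (y' t)) <= k * (Rabs (x t - x' t) + Rabs (y t - y' t)) ->
  exists dE, is_derive (fun t => 1 * (x t - x' t) ^ 2 + 1 * (y t - y' t) ^ 2) t dE /\
    Rabs dE <= 4 * k * (1 * (x t - x' t) ^ 2 + 1 * (y t - y' t) ^ 2).
Proof.
intros Hk S S' A B; eexists; split.
{ exact (is_derive_weighted_sq_dist x x' y y' 1 1 t _ _ _ _
    (proj1 (S t)) (proj1 (S' t)) (proj2 (S t)) (proj2 (S' t))). }
eapply Rle_trans; [apply Rabs_triang|]; rewrite !Rabs_mult, (Rabs_right 2), Rabs_R1 by lra.
rewrite <- (pow2_abs (x t - x' t)), <- (pow2_abs (y t - y' t)).
set (p := Rabs (x t - x' t)) in *; set (q := Rabs (y t - y' t)) in *.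
assert (Hp : 0 <= p) by apply Rabs_pos; assert (Hq : 0 <= q) by apply Rabs_pos.
apply (Rmult_le_compat_l p) in A; [|exact Hp]; apply (Rmult_le_compat_l q) in B; [|exact Hq].
assert (0 <= k * (p - q) ^ 2) by nonneg.
lra.
Qed.

(** Gronwall forwards from [t0], and for earlier times Gronwall for the time-reversed squared
    distance. *)
Lemma field_solution_unique (g1 g2 : R -> R -> R -> R) (L : R) (x y x' y' : R -> R) (t0 : R) :
  lipschitz3 g1 L -> lipschitz3 g2 L ->
  field_solution g1 g2 x y -> field_solution g1 g2 x' y' ->
  x t0 = x' t0 -> y t0 = y' t0 -> forall t, x t = x' t /\ y t = y' t.
Proof.
intros H1 H2 S S' Ex Ey t.
set (E := fun t => 1 * (x t - x' t) ^ 2 + 1 * (y t - y' t) ^ 2).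
assert (L0 : forall g u, lipschitz3 g L -> Rabs (g u (x u) (y u) - g u (x' u) (y' u))
  <= Rabs L * (Rabs (x u - x' u) + Rabs (y u - y' u))).
{ intros g u Hg; eapply Rle_trans; [apply Hg|]; rewrite Rminus_eq_0, Rabs_R0, Rplus_0_l.
  apply Rmult_le_compat_r; [nonneg | apply Rle_abs]. }
pose proof (fun u => separation_derive g1 g2 x y x' y' (Rabs L) u (Rabs_pos L) S S' (L0 _ u H1) (L0 _ u H2)) as DE.
assert (E0 : E t0 = 0) by (unfold E; rewrite Ex, Ey; ring).
assert (Et : E t <= 0).
{ destruct (Rle_dec t0 t) as [Hle | Hgt].
  - rewrite <- (Rmult_0_l (exp (4 * Rabs L * (t - t0)))), <- E0; apply gronwall; [exact Hle|].
    intros u _; destruct (DE u) as [l [I J]]; exists l; split; [exact I | fold (E u) in J; abs_lra].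
  - assert (G : E (- - t) <= E (- - t0) * exp (4 * Rabs L * (- t - - t0))).
    { apply (gronwall (fun u => E (- u))); [lra|].
      intros u _; destruct (DE (- u)) as [l [I J]]; exists (- (1) * l); split.
      - apply (is_derive_comp E Ropp); [exact I | auto_derive; [easy | reflexivity]].
      - fold (E (- u)) in J; abs_lra. }
    rewrite !Ropp_involutive, E0, Rmult_0_l in G; exact G. }
unfold E in Et; pose proof (pow2_ge_0 (x t - x' t)); pose proof (pow2_ge_0 (y t - y' t)).
split; apply Rminus_diag_uniq; nra.
Qed.

Lemma PI_bounds : 3 < PI < 3.4.
Proof.
split.
- pose proof PI2_3_2; lra.
- destruct (PI_ineq 2) as [_ H]; unfold tg_alt, PI_tg in H; simpl in H; lra.
Qed.

(* [x] is the slowest coordinate (rate [e ^ 3 * mu]) and [y] the faster one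
   (rate [e * La]); both are only approximate, [W1] and [W2] are the
   coordinates in which the two rates are visible, with derivatives [D1], [D2]. *)
Record slow_fast (m K z s e mu La : R) (g1 g2 W1 W2 D1 D2 : R -> R -> R -> R) : Prop := {
  sf_e : 0 < Rabs e <= z * s;
  sf_s : 0 < s <= 1;
  sf_mu : m <= Rabs mu <= K;
  sf_La : m <= Rabs La <= K;
  sf_lip : exists L, lipschitz3 g1 L /\ lipschitz3 g2 L;
  sf_bound1 : forall t x y, Rabs (g1 t x y) <= K * Rabs e;
  sf_bound2 : forall t x y, Rabs (g2 t x y) <= K * Rabs e;
  sf_lip1 : forall t x y x' y',
    Rabs (g1 t x y - g1 t x' y') <= K * Rabs e * (Rabs (x - x') + Rabs (y - y'));
  sf_lip2 : forall t x y x' y',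
    Rabs (g2 t x y - g2 t x' y') <= K * Rabs e * (Rabs (x - x') + Rabs (y - y'));
  sf_per : forall t x y, g1 (t + 2 * PI) x y = g1 t x y /\ g2 (t + 2 * PI) x y = g2 t x y
    /\ W1 (t + 2 * PI) x y = W1 t x y /\ W2 (t + 2 * PI) x y = W2 t x y;
  sf_W1 : forall t x y x' y', Rabs x <= s -> Rabs y <= s -> Rabs x' <= s -> Rabs y' <= s ->
    Rabs (W1 t x y - W1 t x' y' - (x - x')) <= z * (Rabs (x - x') + Rabs (y - y'));
  sf_W2 : forall t x y x' y', Rabs x <= s -> Rabs y <= s -> Rabs x' <= s -> Rabs y' <= s ->
    Rabs (W2 t x y - W2 t x' y' - (y - y')) <= z * (Rabs (x - x') + Rabs (y - y'));
  sf_W1y : forall t x y y', Rabs x <= s -> Rabs y <= s -> Rabs y' <= s ->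
    Rabs (W1 t x y - W1 t x y') <= K * Rabs e * Rabs (y - y');
  sf_D : forall x y t, is_derive x t (g1 t (x t) (y t)) -> is_derive y t (g2 t (x t) (y t)) ->
    Rabs (x t) <= s -> Rabs (y t) <= s ->
    is_derive (fun t => W1 t (x t) (y t)) t (D1 t (x t) (y t)) /\
    is_derive (fun t => W2 t (x t) (y t)) t (D2 t (x t) (y t));
  sf_D1 : forall t x y x' y', Rabs x <= s -> Rabs y <= s -> Rabs x' <= s -> Rabs y' <= s ->
    Rabs (D1 t x y - D1 t x' y' - e ^ 3 * mu * (W1 t x y - W1 t x' y'))
      <= z * Rabs e ^ 3 * (Rabs (x - x') + Rabs (y - y'));
  sf_D2 : forall t x y x' y', Rabs x <= s -> Rabs y <= s -> Rabs x' <= s -> Rabs y' <= s ->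
    Rabs (D2 t x y - D2 t x' y' - e * La * (W2 t x y - W2 t x' y'))
      <= K * Rabs e ^ 2 * (Rabs (x - x') + Rabs (y - y'));
  sf_c1 : forall t, Rabs (D1 t 0 0) <= z * s * Rabs e ^ 3;
  sf_c2 : forall t, Rabs (D2 t 0 0) <= K * Rabs e ^ 2 }.

(** * Estimates over one turn and the return map *)

Section Core.
Variables (m K z s e mu La : R) (g1 g2 W1 W2 D1 D2 : R -> R -> R -> R).
Hypotheses (Hm : 0 < m <= 1) (HK : 1 <= K) (Hz : z = m ^ 2 / (1000 * K ^ 2)).
Hypothesis (SF : slow_fast m K z s e mu La g1 g2 W1 W2 D1 D2).

Local Notation by_SF f := (f _ _ _ _ _ _ _ _ _ _ _ _ _ SF) (only parsing).

(** [z * K ^ 2 / m] has to be small in the return estimate and [z * K ^ 2 / m ^ 2] in the growth of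
    the quadratic form, hence the squares in [z]; the factor 1000 leaves room for all numerical
    constants. *)
Lemma z_bounds : 0 < z /\ 1000 * K ^ 2 * z = m ^ 2.
Proof.
assert (0 < K ^ 2) by nra; assert (0 < m ^ 2) by nra.
split; rewrite Hz; [apply Rdiv_lt_0_compat; lra | field; lra].
Qed.

Lemma z_bounds' : 0 < z /\ 1000 * K ^ 2 * z <= m /\ 1000 * K ^ 2 * z <= 1 /\ 1000 * K * z <= 1 /\ 1000 * z <= 1.
Proof.
destruct z_bounds as [H1 H2]; assert (m ^ 2 <= m) by nra; assert (1000 * K ^ 2 * z <= 1) by nra.
assert (K * z <= K ^ 2 * z) by (apply Rmult_le_compat_r; nra).
assert (z <= K * z) by nra. repeat split; nra.
Qed.

Lemma e_bounds : 0 < Rabs e /\ Rabs e <= z * s /\ Rabs e <= z /\ Rabs e <= 1.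
Proof.
pose proof z_bounds'; pose proof (by_SF sf_e); pose proof (by_SF sf_s).
repeat split; nra.
Qed.

Lemma solution_exists t0 x0 y0 : exists x y, x t0 = x0 /\ y t0 = y0 /\ field_solution g1 g2 x y.
Proof.
destruct (by_SF sf_lip) as [L [H1 H2]].
destruct (cauchy_lipschitz g1 g2 L (K * Rabs e) H1 H2
  (by_SF sf_bound1) (by_SF sf_bound2) t0 x0 y0)
  as [x [y [Ex [Ey [Dx Dy]]]]].
exists x, y; split; [exact Ex | split; [exact Ey | intros t; split; auto]].
Qed.

(** The 7 bounds the length [2 * PI] of a turn. *)
Lemma solution_drift x y t : field_solution g1 g2 x y -> 0 <= t <= 2 * PI ->
  Rabs (x t - x 0) <= 7 * K * Rabs e /\ Rabs (y t - y 0) <= 7 * K * Rabs e.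
Proof.
intros S Ht; pose proof PI_bounds.
assert (P : 0 <= K * Rabs e) by nonneg.
assert (B : forall h dh : R -> R, (forall u, is_derive h u (dh u)) -> (forall u, Rabs (dh u) <= K * Rabs e) ->
  Rabs (h t - h 0) <= 7 * K * Rabs e).
{ intros h dh D Bh; eapply Rle_trans; [apply (derive_bounded_le h dh 0 t (K * Rabs e)); auto; lra | nra]. }
split; eapply B; intros; try apply S; [apply (by_SF sf_bound1) | apply (by_SF sf_bound2)].
Qed.

(** Gronwall for the squared Euclidean distance: it grows over one turn by a factor of at most
    [exp 1 <= 3]. Returning to the l1 norm costs [sqrt 2], and [sqrt 6 < 3]. *)
Lemma solution_spread x y x' y' t :
  field_solution g1 g2 x y -> field_solution g1 g2 x' y' -> 0 <= t <= 2 * PI ->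
  Rabs (x t - x' t) + Rabs (y t - y' t) <= 3 * (Rabs (x 0 - x' 0) + Rabs (y 0 - y' 0)).
Proof.
intros S S' Ht; pose proof PI_bounds; pose proof z_bounds'; pose proof e_bounds.
set (E := fun t => 1 * (x t - x' t) ^ 2 + 1 * (y t - y' t) ^ 2).
assert (HKe : 0 <= K * Rabs e) by nonneg.
pose proof (fun u => separation_derive g1 g2 x y x' y' (K * Rabs e) u HKe S S'
  (by_SF sf_lip1 _ _ _ _ _) (by_SF sf_lip2 _ _ _ _ _)) as DE.
assert (G : E t <= E 0 * exp (4 * (K * Rabs e) * (t - 0))).
{ apply gronwall; [lra|]; intros u _; destruct (DE u) as [l [I J]]; exists l; split; [exact I|].
  eapply Rle_trans; [apply Rle_abs | exact J]. }
assert (X : exp (4 * (K * Rabs e) * (t - 0)) <= 3).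
{ eapply Rle_trans; [|apply exp_le_3].
  assert (4 * (K * Rabs e) * (t - 0) <= 1).
  { assert (K * Rabs e <= K * z) by (apply Rmult_le_compat_l; lra). nra. }
  now apply exp_le_exp. }
assert (E0 : 0 <= E 0) by (unfold E; pose proof (pow2_ge_0 (x 0 - x' 0)); pose proof (pow2_ge_0 (y 0 - y' 0)); lra).
assert (G' : E t <= 3 * E 0) by nra.
unfold E in G'.
rewrite <- (pow2_abs (x t - x' t)), <- (pow2_abs (y t - y' t)),
  <- (pow2_abs (x 0 - x' 0)), <- (pow2_abs (y 0 - y' 0)) in G'.
pose proof (Rabs_pos (x t - x' t)); pose proof (Rabs_pos (y t - y' t)).
pose proof (Rabs_pos (x 0 - x' 0)); pose proof (Rabs_pos (y 0 - y' 0)).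
set (p := Rabs (x t - x' t)) in *; set (q := Rabs (y t - y' t)) in *.
set (p0 := Rabs (x 0 - x' 0)) in *; set (q0 := Rabs (y 0 - y' 0)) in *.
apply Rnot_lt_le; intros Hlt.
assert (0 <= (p - q) ^ 2) by apply pow2_ge_0.
nra.
Qed.

(** The 21 is the spread factor 3 times the bound 7 for the length of a turn. *)
Lemma solution_spread_drift x y x' y' t :
  field_solution g1 g2 x y -> field_solution g1 g2 x' y' -> 0 <= t <= 2 * PI ->
  Rabs (x t - x' t - (x 0 - x' 0)) <= 21 * K * Rabs e * (Rabs (x 0 - x' 0) + Rabs (y 0 - y' 0)) /\
  Rabs (y t - y' t - (y 0 - y' 0)) <= 21 * K * Rabs e * (Rabs (x 0 - x' 0) + Rabs (y 0 - y' 0)).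
Proof.
intros S S' Ht; pose proof PI_bounds.
set (n0 := Rabs (x 0 - x' 0) + Rabs (y 0 - y' 0)).
assert (N0 : 0 <= n0) by (apply Rplus_le_le_0_compat; apply Rabs_pos).
assert (P : 0 <= K * Rabs e) by nonneg.
assert (Q : 3 * (K * Rabs e) * n0 * (t - 0) <= 21 * K * Rabs e * n0).
{ assert (0 <= K * Rabs e * n0) by nonneg; nra. }
assert (B : forall u, 0 <= u <= t -> K * Rabs e * (Rabs (x u - x' u) + Rabs (y u - y' u))
    <= 3 * (K * Rabs e) * n0).
{ intros u Hu; pose proof (solution_spread x y x' y' u S S' ltac:(lra)); fold n0 in H0; nra. }
split; (eapply Rle_trans; [|exact Q]).
- apply (derive_bounded_le (fun t => x t - x' t) (fun t => g1 t (x t) (y t) - g1 t (x' t) (y' t)));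
  [lra | intros u Hu; apply (@is_derive_minus R_AbsRing R_NormedModule); [apply S | apply S'] |].
  intros u Hu; eapply Rle_trans; [apply (by_SF sf_lip1) | now apply B].
- apply (derive_bounded_le (fun t => y t - y' t) (fun t => g2 t (x t) (y t) - g2 t (x' t) (y' t)));
  [lra | intros u Hu; apply (@is_derive_minus R_AbsRing R_NormedModule); [apply S | apply S'] |].
  intros u Hu; eapply Rle_trans; [apply (by_SF sf_lip2) | now apply B].
Qed.

Lemma solution_in_box x y t : field_solution g1 g2 x y -> Rabs (x 0) + Rabs (y 0) <= s / 4 ->
  0 <= t <= 2 * PI -> Rabs (x t) <= s / 2 /\ Rabs (y t) <= s / 2.
Proof.
intros S H0 Ht; destruct (solution_drift x y t S Ht) as [A B].
pose proof e_bounds; pose proof z_bounds'; pose proof (by_SF sf_s).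
assert (7 * K * Rabs e <= s / 4) by nra.
split; abs_lra.
Qed.

(** Serves both coordinates: [pr] is the one that [W] perturbs, [c] its rate and [q] the order of
    that rate, [Rabs e ^ 3] or [Rabs e]. The errors in the derivative are small relative to [q], so
    dividing the jump over a turn by [2 * PI * c] is harmless and the quotient is Lipschitz-close to
    [pr]. Subtracting it from [pr] is a Newton step with the approximate Jacobian [2 * PI * c],
    whatever the sign of [c]. *)
Lemma return_estimate (W D : R -> R -> R -> R) (pr : R -> R -> R) (c q : R) :
  0 < q -> m * q <= Rabs c <= K * q ->
  (forall x y x' y', Rabs (pr x y - pr x' y') <= Rabs (x - x') + Rabs (y - y')) ->
  (forall t x y x' y', Rabs x <= s -> Rabs y <= s -> Rabs x' <= s -> Rabs y' <= s ->
    Rabs (W t x y - W t x' y' - (pr x y - pr x' y')) <= z * (Rabs (x - x') + Rabs (y - y'))) ->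
  (forall t x y x' y', Rabs x <= s -> Rabs y <= s -> Rabs x' <= s -> Rabs y' <= s ->
    Rabs (D t x y - D t x' y' - c * (W t x y - W t x' y'))
      <= K * z * q * (Rabs (x - x') + Rabs (y - y'))) ->
  (forall t, Rabs (D t 0 0) <= K * z * s * q) ->
  (forall x y x' y' t, field_solution g1 g2 x y -> field_solution g1 g2 x' y' -> 0 <= t <= 2 * PI ->
    Rabs (pr (x t) (y t) - pr (x' t) (y' t) - (pr (x 0) (y 0) - pr (x' 0) (y' 0)))
      <= 21 * K * Rabs e * (Rabs (x 0 - x' 0) + Rabs (y 0 - y' 0))) ->
  (forall x y t, field_solution g1 g2 x y -> Rabs (x t) <= s -> Rabs (y t) <= s ->
    is_derive (fun t => W t (x t) (y t)) t (D t (x t) (y t))) ->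
  (forall x y x' y', field_solution g1 g2 x y -> field_solution g1 g2 x' y' ->
    Rabs (x 0) + Rabs (y 0) <= s / 4 -> Rabs (x' 0) + Rabs (y' 0) <= s / 4 ->
    Rabs (pr (x 0) (y 0) - pr (x' 0) (y' 0)
      - (W (2 * PI) (x (2 * PI)) (y (2 * PI)) - W 0 (x 0) (y 0)
         - (W (2 * PI) (x' (2 * PI)) (y' (2 * PI)) - W 0 (x' 0) (y' 0))) / (2 * PI * c))
    <= / 4 * (Rabs (x 0 - x' 0) + Rabs (y 0 - y' 0))) /\
  (forall x y, field_solution g1 g2 x y -> x 0 = 0 -> y 0 = 0 ->
    Rabs ((W (2 * PI) (x (2 * PI)) (y (2 * PI)) - W 0 (x 0) (y 0)) / (2 * PI * c)) <= s / 16).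
Proof.
intros Hq Hc Hpr HW HD H0 Hdr Hder.
pose proof PI_bounds as HPI; pose proof e_bounds as He; pose proof z_bounds' as Zb.
pose proof (by_SF sf_s) as Hs.
assert (Hc0 : 0 < Rabs c) by nra.
assert (Hc1 : c <> 0) by (intros ->; rewrite Rabs_R0 in Hc0; lra).
split.
- intros x y x' y' S S' B B'.
  set (n0 := Rabs (x 0 - x' 0) + Rabs (y 0 - y' 0)).
  assert (N0 : 0 <= n0) by (apply Rplus_le_le_0_compat; apply Rabs_pos).
  set (V := fun t => W t (x t) (y t) - W t (x' t) (y' t)).
  (* 25 = 3 + 21 + 1: the near-identity error at [t], the drift, and the near-identity error at
     0. *)
  assert (BV : forall t, 0 <= t <= 2 * PI -> Rabs (V t - V 0) <= 25 * K * z * n0).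
  { intros t Ht; unfold V.
    destruct (solution_in_box x y t S B Ht), (solution_in_box x' y' t S' B' Ht).
    destruct (solution_in_box x y 0 S B ltac:(lra)), (solution_in_box x' y' 0 S' B' ltac:(lra)).
    pose proof (HW t (x t) (y t) (x' t) (y' t) ltac:(lra) ltac:(lra) ltac:(lra) ltac:(lra)) as P.
    pose proof (HW 0 (x 0) (y 0) (x' 0) (y' 0) ltac:(lra) ltac:(lra) ltac:(lra) ltac:(lra)) as P0.
    pose proof (Hdr x y x' y' t S S' Ht) as Q.
    pose proof (solution_spread x y x' y' t S S' Ht) as N; fold n0 in N, P0, Q.
    assert (z * (Rabs (x t - x' t) + Rabs (y t - y' t)) <= 3 * z * n0) by nra.
    assert (21 * K * Rabs e * n0 <= 21 * (K * z) * n0).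
    { apply Rmult_le_compat_r; [exact N0 | nra]. }
    assert (z * n0 <= K * z * n0) by (apply Rmult_le_compat_r; nra).
    abs_lra. }
  assert (BS : Rabs (V (2 * PI) - V 0 - 2 * PI * c * V 0) <= 196 * K ^ 2 * z * q * n0).
  (* [V] moves at a rate close to [c * V] and stays close to [V 0], so that subtracting the linear
     prediction leaves a small derivative. *)
  { set (k := fun t => V t - V 0 - c * t * V 0).
    replace (V (2 * PI) - V 0 - 2 * PI * c * V 0) with (k (2 * PI) - k 0) by (unfold k; ring).
    eapply Rle_trans.
    - apply (derive_bounded_le k
        (fun t => D t (x t) (y t) - D t (x' t) (y' t) - c * V 0) 0 (2 * PI) (28 * K ^ 2 * z * q * n0)); [lra | |].
      + intros t Ht.
        destruct (solution_in_box x y t S B Ht), (solution_in_box x' y' t S' B' Ht).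
        assert (I : is_derive V t (D t (x t) (y t) - D t (x' t) (y' t))).
        { apply (@is_derive_minus R_AbsRing R_NormedModule); apply Hder; auto; lra. }
        unfold k; auto_derive; [eexists; exact I|].
        rewrite (Derive_eta _ _ _ I); ring.
      + intros t Ht.
        destruct (solution_in_box x y t S B Ht), (solution_in_box x' y' t S' B' Ht).
        pose proof (HD t (x t) (y t) (x' t) (y' t) ltac:(lra) ltac:(lra) ltac:(lra) ltac:(lra)) as P.
        fold (V t) in P.
        pose proof (BV t Ht) as Q.
        pose proof (solution_spread x y x' y' t S S' Ht) as N; fold n0 in N.
        match type of P with Rabs ?a <= _ =>
        match goal with |- Rabs ?g <= _ => replace g with (a + c * (V t - V 0)) by ring;
          pose proof (Rabs_triang a (c * (V t - V 0))) as T end end.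
        rewrite Rabs_mult in T.
        assert (Rabs c * Rabs (V t - V 0) <= K * q * (25 * K * z * n0)).
        { apply Rmult_le_compat; try apply Rabs_pos; lra. }
        assert (K * z * q * (Rabs (x t - x' t) + Rabs (y t - y' t)) <= K * z * q * (3 * n0)).
        { apply Rmult_le_compat_l; [|exact N]. repeat apply Rmult_le_pos; lra. }
        assert (K * (z * q * n0) <= K ^ 2 * (z * q * n0)).
        { apply Rmult_le_compat_r; [repeat apply Rmult_le_pos; lra | nra]. }
        lra.
    - assert (0 <= K ^ 2 * z * q * n0) by (repeat apply Rmult_le_pos; nra).
      nra. }
  assert (PW : Rabs (V 0 - (pr (x 0) (y 0) - pr (x' 0) (y' 0))) <= z * n0).
  { destruct (solution_in_box x y 0 S B ltac:(lra)), (solution_in_box x' y' 0 S' B' ltac:(lra)).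
    apply HW; lra. }
  replace (W (2 * PI) (x (2 * PI)) (y (2 * PI)) - W 0 (x 0) (y 0)
     - (W (2 * PI) (x' (2 * PI)) (y' (2 * PI)) - W 0 (x' 0) (y' 0))) with (V (2 * PI) - V 0)
    by (unfold V; ring).
  set (p := pr (x 0) (y 0) - pr (x' 0) (y' 0)) in *.
  replace (p - (V (2 * PI) - V 0) / (2 * PI * c))
    with (- (V 0 - p) - (V (2 * PI) - V 0 - 2 * PI * c * V 0) / (2 * PI * c)) by (field; split; lra).
  eapply Rle_trans; [apply Rabs_triang|].
  rewrite !Rabs_Ropp; unfold Rdiv at 1; rewrite Rabs_mult, Rabs_inv, !Rabs_mult.
  rewrite (Rabs_right 2), (Rabs_right PI) by lra.
  (* Uses [196 <= 240 = 40 * 6] and [2 * PI * Rabs c >= 6 * (m * q)]. *)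
  assert (I : Rabs (V (2 * PI) - V 0 - 2 * PI * c * V 0) * / (2 * PI * Rabs c) <= 40 / m * (K ^ 2 * z) * n0).
  { apply (Rmult_le_reg_r (2 * PI * Rabs c)); [nra|].
    rewrite Rmult_assoc, Rinv_l, Rmult_1_r by nra.
    eapply Rle_trans; [exact BS|].
    assert (E : 40 / m * (K ^ 2 * z) * n0 * (6 * (m * q)) = 240 * K ^ 2 * z * q * n0) by (field; lra).
    assert (0 <= K ^ 2 * z * q * n0) by (repeat apply Rmult_le_pos; nra).
    assert (F : 40 / m * (K ^ 2 * z) * n0 * (6 * (m * q)) <= 40 / m * (K ^ 2 * z) * n0 * (2 * PI * Rabs c)).
    { apply Rmult_le_compat_l.
      - repeat apply Rmult_le_pos; try lra; try nra; left; apply Rinv_0_lt_compat; lra.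
      - nra. }
    lra. }
  assert (J : 40 / m * (K ^ 2 * z) <= / 20).
  { apply (Rmult_le_reg_r m); [lra|].
    replace (40 / m * (K ^ 2 * z) * m) with (40 * (K ^ 2 * z)) by (field; lra). lra. }
  assert (40 / m * (K ^ 2 * z) * n0 <= / 20 * n0) by (apply Rmult_le_compat_r; lra).
  assert (z * n0 <= / 20 * n0) by (apply Rmult_le_compat_r; lra).
  lra.
- intros x y S Ex Ey.
  assert (B : Rabs (x 0) + Rabs (y 0) <= s / 4) by (rewrite Ex, Ey, Rabs_R0; lra).
  assert (BS : Rabs (W (2 * PI) (x (2 * PI)) (y (2 * PI)) - W 0 (x 0) (y 0)) <= 43 * K ^ 2 * z * s * q * (2 * PI)).
  { replace (2 * PI) with (2 * PI - 0) at 4 by ring.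
    apply (derive_bounded_le (fun t => W t (x t) (y t)) (fun t => D t (x t) (y t)) 0 (2 * PI)); [lra | |].
    - intros t Ht; destruct (solution_in_box x y t S B Ht); apply Hder; auto; lra.
    - intros t Ht; destruct (solution_in_box x y t S B Ht).
      destruct (solution_drift x y t S Ht) as [dx dy]; rewrite Ex, Ey in *.
      assert (Z : Rabs 0 <= s) by (rewrite Rabs_R0; lra).
      pose proof (HD t (x t) (y t) 0 0 ltac:(lra) ltac:(lra) Z Z) as P.
      pose proof (HW t (x t) (y t) 0 0 ltac:(lra) ltac:(lra) Z Z) as Q.
      pose proof (Hpr (x t) (y t) 0 0) as Q'.
      specialize (H0 t).
      set (n := Rabs (x t - 0) + Rabs (y t - 0)) in *.
      assert (Bn : n <= 14 * K * z * s).
      { unfold n; assert (K * Rabs e <= K * (z * s)) by (apply Rmult_le_compat_l; lra); lra. }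
      assert (N0 : 0 <= n) by (apply Rplus_le_le_0_compat; apply Rabs_pos).
      set (w := W t (x t) (y t) - W t 0 0) in *.
      assert (Bw : Rabs w <= 28 * K * z * s).
      { assert (z * n <= 1 * n) by (apply Rmult_le_compat_r; lra). clear P dx dy; abs_lra. }
      match type of P with Rabs ?a <= _ =>
        replace (D t (x t) (y t)) with (a + c * w + D t 0 0) by ring;
        pose proof (Rabs_triang (a + c * w) (D t 0 0)); pose proof (Rabs_triang a (c * w)) as T end.
      rewrite Rabs_mult in T.
      assert (Rabs c * Rabs w <= K * q * (28 * K * z * s)).
      { apply Rmult_le_compat; try apply Rabs_pos; lra. }
      assert (K * z * q * n <= K * z * q * (14 * K * z * s)).
      { apply Rmult_le_compat_l; [|exact Bn]. repeat apply Rmult_le_pos; lra. }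
      assert (0 <= K * (z * s * q)) by nonneg.
      assert (K * (z * s * q) <= K ^ 2 * (z * s * q)).
      { apply Rmult_le_compat_r; [repeat apply Rmult_le_pos; lra | nra]. }
      assert (z * (K ^ 2 * (z * s * q)) <= 1 * (K ^ 2 * (z * s * q))).
      { apply Rmult_le_compat_r; lra. }
      lra. }
  unfold Rdiv at 1; rewrite Rabs_mult, Rabs_inv, !Rabs_mult.
  rewrite (Rabs_right 2), (Rabs_right PI) by lra.
  apply (Rmult_le_reg_r (2 * PI * Rabs c)); [nra|].
  rewrite Rmult_assoc, Rinv_l, Rmult_1_r by nra.
  eapply Rle_trans; [exact BS|].
  assert (43 * K ^ 2 * z * s * q <= s / 16 * (m * q)).
  { replace (43 * K ^ 2 * z * s * q) with (43 * (K ^ 2 * z) * (s * q)) by ring.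
    replace (s / 16 * (m * q)) with (m / 16 * (s * q)) by field.
    apply Rmult_le_compat_r; [nra | lra]. }
  assert (s / 16 * (m * q) <= s / 16 * Rabs c) by (apply Rmult_le_compat_l; lra).
  nra.
Qed.

(** A fixed point of the Newton map makes the jumps of [W1] and [W2] over one turn vanish; as both
    are near the identity, the orbit closes. *)
Lemma periodic_orbit_exists : exists x y,
  field_solution g1 g2 x y /\ (forall t, x (t + 2 * PI) = x t /\ y (t + 2 * PI) = y t) /\
  (forall t, Rabs (x t) <= s / 2 /\ Rabs (y t) <= s / 2).
Proof.
pose proof PI_bounds as HPI; pose proof e_bounds as He; pose proof z_bounds' as Zb.
pose proof (by_SF sf_s) as Hs.
assert (FL : forall p : R * R, exists xy : (R -> R) * (R -> R),
  fst xy 0 = fst p /\ snd xy 0 = snd p /\ field_solution g1 g2 (fst xy) (snd xy)).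
{ intros p; destruct (solution_exists 0 (fst p) (snd p)) as [x [y H]]; now exists (x, y). }
(* Solutions are chosen as a function of the initial point, so that the jumps become functions on
   the plane. *)
set (fl := fun x0 y0 => proj1_sig (constructive_indefinite_description _ (FL (x0, y0)))).
assert (Hfl : forall x0 y0, fst (fl x0 y0) 0 = x0 /\ snd (fl x0 y0) 0 = y0 /\
  field_solution g1 g2 (fst (fl x0 y0)) (snd (fl x0 y0))).
{ intros x0 y0; exact (proj2_sig (constructive_indefinite_description _ (FL (x0, y0)))). }
clearbody fl.
destruct (return_estimate W1 D1 (fun x _ => x) (e ^ 3 * mu) (Rabs e ^ 3)) as [A1 A2].
{ apply pow_lt; lra. }
{ rewrite Rabs_mult, <- RPow_abs; pose proof (by_SF sf_mu).
  assert (0 < Rabs e ^ 3) by (apply pow_lt; lra); nra. }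
{ intros x y x' y'; pose proof (Rabs_pos (y - y')); lra. }
{ apply (by_SF sf_W1). }
{ intros; eapply Rle_trans; [now apply (by_SF sf_D1)|].
  apply Rmult_le_compat_r; [apply Rplus_le_le_0_compat; apply Rabs_pos|].
  apply Rmult_le_compat_r; [left; apply pow_lt; lra | nra]. }
{ intros t; eapply Rle_trans; [apply (by_SF sf_c1)|].
  apply Rmult_le_compat_r; [left; apply pow_lt; lra | nra]. }
{ intros; now apply (solution_spread_drift x y x' y'). }
{ intros x y t S Bx By; apply (by_SF sf_D); auto; apply S. }
destruct (return_estimate W2 D2 (fun _ y => y) (e * La) (Rabs e)) as [B1 B2].
{ lra. }
{ rewrite Rabs_mult; pose proof (by_SF sf_La); nra. }
{ intros x y x' y'; pose proof (Rabs_pos (x - x')); lra. }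
{ apply (by_SF sf_W2). }
{ intros; eapply Rle_trans; [now apply (by_SF sf_D2)|].
  apply Rmult_le_compat_r; [apply Rplus_le_le_0_compat; apply Rabs_pos|].
  replace (K * Rabs e ^ 2) with (K * Rabs e * Rabs e) by ring.
  apply Rmult_le_compat_r; [lra | apply Rmult_le_compat_l; lra]. }
{ intros t; eapply Rle_trans; [apply (by_SF sf_c2)|].
  replace (K * Rabs e ^ 2) with (K * Rabs e * Rabs e) by ring.
  apply Rmult_le_compat_r; [lra|]; rewrite Rmult_assoc; apply Rmult_le_compat_l; lra. }
{ intros; now apply (solution_spread_drift x y x' y'). }
{ intros x y t S Bx By; apply (by_SF sf_D); auto; apply S. }
set (jump := fun (W : R -> R -> R -> R) x0 y0 =>
  W (2 * PI) (fst (fl x0 y0) (2 * PI)) (snd (fl x0 y0) (2 * PI)) - W 0 x0 y0).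
destruct (contraction_fixed_point_l1
  (fun x0 y0 => x0 - jump W1 x0 y0 / (2 * PI * (e ^ 3 * mu)))
  (fun x0 y0 => y0 - jump W2 x0 y0 / (2 * PI * (e * La))) (s / 4)) as [x0 [y0 [B0 [E1 E2]]]].
- lra.
- intros x y x' y' B B'.
  destruct (Hfl x y) as [Fx [Fy S]], (Hfl x' y') as [Fx' [Fy' S']].
  specialize (A1 _ _ _ _ S S'); specialize (B1 _ _ _ _ S S').
  rewrite Fx, Fy, Fx', Fy' in A1, B1; specialize (A1 B B'); specialize (B1 B B').
  cbv beta in *; fold (jump W1 x y) (jump W1 x' y') in A1; fold (jump W2 x y) (jump W2 x' y') in B1.
  replace (x - jump W1 x y / (2 * PI * (e ^ 3 * mu)) - (x' - jump W1 x' y' / (2 * PI * (e ^ 3 * mu))))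
    with (x - x' - (jump W1 x y - jump W1 x' y') / (2 * PI * (e ^ 3 * mu))) by (unfold Rdiv; ring).
  replace (y - jump W2 x y / (2 * PI * (e * La)) - (y' - jump W2 x' y' / (2 * PI * (e * La))))
    with (y - y' - (jump W2 x y - jump W2 x' y') / (2 * PI * (e * La))) by (unfold Rdiv; ring).
  lra.
- destruct (Hfl 0 0) as [Fx [Fy S]].
  specialize (A2 _ _ S Fx Fy); specialize (B2 _ _ S Fx Fy); rewrite Fx, Fy in A2, B2.
  fold (jump W1 0 0) in A2; fold (jump W2 0 0) in B2.
  unfold Rminus; rewrite !Rplus_0_l, !Rabs_Ropp; lra.
- destruct (Hfl x0 y0) as [Fx [Fy S]].
  set (x := fst (fl x0 y0)) in *; set (y := snd (fl x0 y0)) in *.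
  assert (nz : forall c, c <> 0 -> 2 * PI * c <> 0).
  { intros c Hc; apply Rmult_integral_contrapositive_currified; lra. }
  assert (J0 : forall u v c, c <> 0 -> u - v / (2 * PI * c) = u -> v = 0).
  { intros u v c Hc E; assert (F : v / (2 * PI * c) = 0) by lra.
    replace v with (v / (2 * PI * c) * (2 * PI * c)) by (field; split; lra).
    rewrite F; ring. }
  assert (He0 : e <> 0) by (intros E; rewrite E, Rabs_R0 in He; lra).
  assert (Hmu : mu <> 0).
  { intros E; pose proof (by_SF sf_mu) as P; rewrite E, Rabs_R0 in P; lra. }
  assert (HLa : La <> 0).
  { intros E; pose proof (by_SF sf_La) as P; rewrite E, Rabs_R0 in P; lra. }
  apply J0 in E1; [|apply Rmult_integral_contrapositive_currified; [now apply pow_nonzero | easy]].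
  apply J0 in E2; [|now apply Rmult_integral_contrapositive_currified].
  unfold jump in E1, E2; fold x y in E1, E2.
  assert (B0' : Rabs (x 0) + Rabs (y 0) <= s / 4) by (rewrite Fx, Fy; exact B0).
  destruct (by_SF sf_per 0 (x (2 * PI)) (y (2 * PI))) as [_ [_ [P1 P2]]].
  rewrite Rplus_0_l in P1, P2; rewrite P1 in E1; rewrite P2 in E2.
  rewrite <- Fx, <- Fy in E1, E2.
  destruct (solution_in_box x y (2 * PI) S B0' ltac:(lra)) as [Bx By].
  destruct (solution_in_box x y 0 S B0' ltac:(lra)) as [Bx0 By0].
  (* Since [W1] and [W2] agree at the two endpoints, the l1 distance of the endpoints is at most
     [2 * z] times itself, hence zero. *)
  pose proof (by_SF sf_W1 0 (x (2 * PI)) (y (2 * PI)) (x 0) (y 0)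
    ltac:(lra) ltac:(lra) ltac:(lra) ltac:(lra)) as Q1.
  pose proof (by_SF sf_W2 0 (x (2 * PI)) (y (2 * PI)) (x 0) (y 0)
    ltac:(lra) ltac:(lra) ltac:(lra) ltac:(lra)) as Q2.
  rewrite E1 in Q1; rewrite E2 in Q2.
  rewrite Rminus_0_l, Rabs_Ropp in Q1, Q2.
  pose proof (Rabs_pos (x (2 * PI) - x 0)); pose proof (Rabs_pos (y (2 * PI) - y 0)).
  assert (Px : x (2 * PI) = x 0) by (apply Rminus_diag_uniq, Rabs_eq_0; nra).
  assert (Py : y (2 * PI) = y 0) by (apply Rminus_diag_uniq, Rabs_eq_0; nra).
  assert (Sh : field_solution g1 g2 (fun t => x (t + 2 * PI)) (fun t => y (t + 2 * PI))).
  { intros t; destruct (by_SF sf_per t (x (t + 2 * PI)) (y (t + 2 * PI)))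
      as [G1 [G2 _]]; rewrite <- G1, <- G2; split;
      apply is_derive_shift, S. }
  destruct (by_SF sf_lip) as [L [L1 L2]].
  assert (Per : forall t, x (t + 2 * PI) = x t /\ y (t + 2 * PI) = y t).
  { apply (field_solution_unique g1 g2 L _ _ x y 0); auto; now rewrite Rplus_0_l. }
  exists x, y; split; [exact S | split; [exact Per|]].
  intros t; destruct (archimedean_period (2 * PI) t ltac:(lra)) as [k Hk].
  assert (Ek : x t = x (t - IZR k * (2 * PI)) /\ y t = y (t - IZR k * (2 * PI))).
  { rewrite <- (periodic_IZR x (2 * PI) (fun u => proj1 (Per u)) k (t - IZR k * (2 * PI))).
    rewrite <- (periodic_IZR y (2 * PI) (fun u => proj2 (Per u)) k (t - IZR k * (2 * PI))).
    split; f_equal; ring. }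
  destruct Ek as [-> ->]; apply solution_in_box; auto; lra.
Qed.

(** * Separation of two solutions: attraction and repulsion *)

Lemma slow_coordinates_equivalent t x y x' y' :
  Rabs x <= s -> Rabs y <= s -> Rabs x' <= s -> Rabs y' <= s ->
  Rabs (x - x') + Rabs (y - y')
    <= 2 * (Rabs (W1 t x y - W1 t x' y') + Rabs (W2 t x y - W2 t x' y')) /\
  Rabs (W1 t x y - W1 t x' y') + Rabs (W2 t x y - W2 t x' y')
    <= 2 * (Rabs (x - x') + Rabs (y - y')).
Proof.
intros Bx By Bx' By'; pose proof z_bounds' as Zb.
pose proof (by_SF sf_W1 t x y x' y' Bx By Bx' By') as P1.
pose proof (by_SF sf_W2 t x y x' y' Bx By Bx' By') as P2.
set (n := Rabs (x - x') + Rabs (y - y')) in *.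
assert (0 <= n) by (apply Rplus_le_le_0_compat; apply Rabs_pos).
assert (z * n <= / 4 * n) by (apply Rmult_le_compat_r; lra).
set (a := W1 t x y - W1 t x' y') in *; set (b := W2 t x y - W2 t x' y') in *.
pose proof (Rabs_triang_inv a (x - x')); pose proof (Rabs_triang_inv b (y - y')).
pose proof (Rabs_triang_inv (x - x') a); pose proof (Rabs_triang_inv (y - y') b).
rewrite (Rabs_minus_sym (x - x') a), (Rabs_minus_sym (y - y') b) in *.
unfold n in *; lra.
Qed.

(** The signs turn every direction, contracting or expanding, into growth. The weight [e] balances
    the two equations: the gains have orders [e ^ 3] for [a ^ 2] and [e ^ 2] for [b ^ 2], so they
    control cross terms of order [e ^ (5 / 2)], while the weighted coupling from the second equation
    has order [e ^ 3]. With weight 1 gain and coupling would both have order [e ^ 2]. *)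
Lemma separation_growth (s1 s2 : R) x y x' y' t :
  0 < e -> s1 ^ 2 = 1 -> s2 ^ 2 = 1 -> s1 * mu = Rabs mu -> s2 * La = Rabs La ->
  field_solution g1 g2 x y -> field_solution g1 g2 x' y' ->
  Rabs (x t) <= s -> Rabs (y t) <= s -> Rabs (x' t) <= s -> Rabs (y' t) <= s ->
  exists dU,
  is_derive (fun t => s1 * (W1 t (x t) (y t) - W1 t (x' t) (y' t)) ^ 2
               + e * s2 * (W2 t (x t) (y t) - W2 t (x' t) (y' t)) ^ 2) t dU /\
  e ^ 3 * m * ((W1 t (x t) (y t) - W1 t (x' t) (y' t)) ^ 2
         + e * (W2 t (x t) (y t) - W2 t (x' t) (y' t)) ^ 2) <= dU.
Proof.
intros He Hs1 Hs2 Emu ELa S S' Bx By Bx' By'.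
pose proof e_bounds as Eb; pose proof z_bounds' as Zb; pose proof z_bounds as Zb2.
destruct (by_SF sf_D x y t (proj1 (S t)) (proj2 (S t)) Bx By) as [I1 I2].
destruct (by_SF sf_D x' y' t (proj1 (S' t)) (proj2 (S' t)) Bx' By') as [I1' I2'].
eexists; split; [apply is_derive_weighted_sq_dist; eassumption|].
destruct (slow_coordinates_equivalent t _ _ _ _ Bx By Bx' By') as [N _].
pose proof (by_SF sf_D1 t _ _ _ _ Bx By Bx' By') as P1.
pose proof (by_SF sf_D2 t _ _ _ _ Bx By Bx' By') as P2.
set (n := Rabs (x t - x' t) + Rabs (y t - y' t)) in *.
set (a := W1 t (x t) (y t) - W1 t (x' t) (y' t)) in *.
set (b := W2 t (x t) (y t) - W2 t (x' t) (y' t)) in *.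
set (d1 := D1 t (x t) (y t) - D1 t (x' t) (y' t)) in *.
set (d2 := D2 t (x t) (y t) - D2 t (x' t) (y' t)) in *.
rewrite (Rabs_right e) in * by lra.
pose proof (by_SF sf_mu) as Hmu; pose proof (by_SF sf_La) as HLa.
rewrite <- (pow2_abs a), <- (pow2_abs b).
assert (A1 : Rabs s1 = 1) by (rewrite <- (Rabs_right 1) by lra; apply Rsqr_eq_abs_0; unfold Rsqr; nra).
assert (A2 : Rabs s2 = 1) by (rewrite <- (Rabs_right 1) by lra; apply Rsqr_eq_abs_0; unfold Rsqr; nra).
set (r1 := d1 - e ^ 3 * mu * a) in *; set (r2 := d2 - e * La * b) in *.
assert (L1 : e ^ 3 * m * Rabs a ^ 2 - Rabs a * (z * e ^ 3 * n) <= s1 * a * d1).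
{ replace (s1 * a * d1) with (e ^ 3 * (s1 * mu) * a ^ 2 + s1 * a * r1) by (unfold r1; ring).
  rewrite Emu, <- (pow2_abs a).
  assert (Q : Rabs (s1 * a * r1) <= Rabs a * (z * e ^ 3 * n)).
  { rewrite !Rabs_mult, A1, Rmult_1_l; apply Rmult_le_compat_l; [apply Rabs_pos | exact P1]. }
  apply Rabs_le_between in Q.
  assert (e ^ 3 * m * Rabs a ^ 2 <= e ^ 3 * Rabs mu * Rabs a ^ 2).
  { apply Rmult_le_compat_r; [apply pow2_ge_0|]; apply Rmult_le_compat_l; [left; apply pow_lt; lra | lra]. }
  lra. }
assert (L2 : e * m * Rabs b ^ 2 - Rabs b * (K * e ^ 2 * n) <= s2 * b * d2).
{ replace (s2 * b * d2) with (e * (s2 * La) * b ^ 2 + s2 * b * r2) by (unfold r2; ring).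
  rewrite ELa, <- (pow2_abs b).
  assert (Q : Rabs (s2 * b * r2) <= Rabs b * (K * e ^ 2 * n)).
  { rewrite !Rabs_mult, A2, Rmult_1_l; apply Rmult_le_compat_l; [apply Rabs_pos | exact P2]. }
  apply Rabs_le_between in Q.
  assert (e * m * Rabs b ^ 2 <= e * Rabs La * Rabs b ^ 2).
  { apply Rmult_le_compat_r; [apply pow2_ge_0|]; apply Rmult_le_compat_l; lra. }
  lra. }
replace (2 * s1 * a * d1 + 2 * (e * s2) * b * d2) with (2 * (s1 * a * d1) + 2 * e * (s2 * b * d2)) by ring.
assert (L2' : e * (e * m * Rabs b ^ 2 - Rabs b * (K * e ^ 2 * n)) <= e * (s2 * b * d2)).
{ apply Rmult_le_compat_l; lra. }
assert (0 <= Rabs a) by apply Rabs_pos; assert (0 <= Rabs b) by apply Rabs_pos.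
set (p := Rabs a) in *; set (q := Rabs b) in *; clearbody p q.
assert (N1 : p * (z * e ^ 3 * n) <= p * (z * e ^ 3 * (2 * (p + q)))).
{ apply Rmult_le_compat_l; [easy|]; apply Rmult_le_compat_l; [|exact N].
  apply Rmult_le_pos; [lra | left; apply pow_lt; lra]. }
assert (N2 : e * (q * (K * e ^ 2 * n)) <= e * (q * (K * e ^ 2 * (2 * (p + q))))).
{ apply Rmult_le_compat_l; [lra|]; apply Rmult_le_compat_l; [easy|]; apply Rmult_le_compat_l; [|exact N].
  apply Rmult_le_pos; [lra | apply pow2_ge_0]. }
(* After division by [e ^ 2], a quadratic form in [p], [q] whose cross term
   [e * K * p * q] is dominated because [e * K ^ 2] is small against [m ^ 2]. *)
assert (F : 0 <= e ^ 2 * (e * m * p ^ 2 + (2 * m - e ^ 2 * m) * q ^ 2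
     - 4 * z * e * p * (p + q) - 4 * K * e * q * (p + q))).
{ apply Rmult_le_pos; [apply pow2_ge_0|].
  assert (e * K <= m / 1000).
  { assert (1000 * (K ^ 2 * z) <= m) by lra. assert (e * K <= z * K) by (apply Rmult_le_compat_r; lra).
    assert (z * K <= z * K ^ 2) by (apply Rmult_le_compat_l; nra). lra. }
  assert (e * K ^ 2 <= m ^ 2 / 1000).
  { assert (e * K ^ 2 <= z * K ^ 2) by (apply Rmult_le_compat_r; nra). lra. }
  assert (z <= m / 1000).
  { assert (z * 1 <= z * K ^ 2) by (apply Rmult_le_compat_l; nra). lra. }
  assert (e ^ 2 * m <= m).
  { assert (e ^ 2 <= 1) by nra. nra. }
  assert (C1 : 4 * z * e * p * (p + q) <= e * m / 100 * p ^ 2 + e * m / 100 * q ^ 2).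
  { assert (4 * z * (p * (p + q)) <= 4 * (m / 1000) * (p * (p + q))).
    { apply Rmult_le_compat_r; [nra | lra]. }
    assert (p * (p + q) <= 2 * p ^ 2 + q ^ 2) by (pose proof (pow2_ge_0 (p - q)); nra).
    assert (4 * z * (p * (p + q)) <= m / 100 * p ^ 2 + m / 100 * q ^ 2) by nra.
    nra. }
  assert (C2 : 4 * K * e * q ^ 2 <= m / 100 * q ^ 2) by nra.
  assert (C3 : 4 * K * e * (p * q) <= e * m / 2 * p ^ 2 + m / 100 * q ^ 2).
  { assert (0 <= e / 2 * (m * p - 4 * K * q) ^ 2) by nonneg.
    apply (Rmult_le_reg_l m); [lra|].
    assert (8 * (e * K ^ 2) * q ^ 2 <= 8 * (m ^ 2 / 1000) * q ^ 2).
    { apply Rmult_le_compat_r; [apply pow2_ge_0 | lra]. }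
    nra. }
  assert (e * m * q ^ 2 <= m * q ^ 2).
  { apply Rmult_le_compat_r; [apply pow2_ge_0 | nra]. }
  assert (e ^ 2 * m * q ^ 2 <= m * q ^ 2).
  { apply Rmult_le_compat_r; [apply pow2_ge_0 | lra]. }
  assert (0 <= e * m * p ^ 2) by (repeat apply Rmult_le_pos; try lra; apply pow2_ge_0).
  assert (0 <= m * q ^ 2) by (repeat apply Rmult_le_pos; try lra; apply pow2_ge_0).
  lra. }
lra.
Qed.

Lemma exp_half_sq k t : exp (- (k / 2) * t) ^ 2 = exp (- k * t).
Proof. simpl; rewrite Rmult_1_r, <- exp_plus; f_equal; field. Qed.

(** With both signs negative the form is minus a positive definite one, so its growth means decay of
    the latter at rate [e ^ 3 * m], halved for the distance. Comparing the form with the distance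
    costs [sqrt (32 / e)] because of the weight [e]; [32 / e] is a crude bound for it. *)
Lemma periodic_orbit_attracts (x' y' : R -> R) :
  0 < e -> mu < 0 -> La < 0 -> field_solution g1 g2 x' y' ->
  (forall t, Rabs (x' t) <= s / 2 /\ Rabs (y' t) <= s / 2) ->
  exists A k, 0 < A /\ 0 < k /\ forall x y t0, field_solution g1 g2 x y ->
    A * (Rabs (x t0 - x' t0) + Rabs (y t0 - y' t0)) < s / 2 ->
    forall t, t0 <= t -> Rabs (x t - x' t) + Rabs (y t - y' t)
      <= A * (Rabs (x t0 - x' t0) + Rabs (y t0 - y' t0)) * exp (- k * (t - t0)).
Proof.
intros He Hmu HLa S' B'.
pose proof e_bounds as Eb; pose proof (by_SF sf_s) as Hs.
rewrite (Rabs_right e) in Eb by lra.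
assert (P3 : 0 < e ^ 3) by (apply pow_lt; lra).
exists (32 / e), (e ^ 3 * m / 2).
assert (A0 : 32 <= 32 / e).
{ apply (Rmult_le_reg_r e); [lra|]; replace (32 / e * e) with 32 by (field; lra); lra. }
split; [lra | split; [nra|]].
intros x y t0 S Hn0.
set (n := fun t => Rabs (x t - x' t) + Rabs (y t - y' t)).
change (32 / e * n t0 < s / 2) in Hn0.
change (forall t, t0 <= t -> n t <= 32 / e * n t0 * exp (- (e ^ 3 * m / 2) * (t - t0))).
assert (Np : forall t, 0 <= n t) by (intros; apply Rplus_le_le_0_compat; apply Rabs_pos).
(* Conditional on the solution staying near the orbit up to time [t]; the bootstrap in [Hin]
   discharges this. *)
assert (K0 : forall t, t0 <= t -> (forall u, t0 <= u <= t -> n u <= s / 2) ->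
   n t <= 32 / e * n t0 * exp (- (e ^ 3 * m / 2) * (t - t0))).
{ intros t Ht Hbox.
  assert (Bx : forall u, t0 <= u <= t -> Rabs (x u) <= s /\ Rabs (y u) <= s).
  { intros u Hu; specialize (Hbox u Hu); unfold n in Hbox; destruct (B' u).
    split; abs_lra. }
  set (a := fun t => W1 t (x t) (y t) - W1 t (x' t) (y' t)).
  set (b := fun t => W2 t (x t) (y t) - W2 t (x' t) (y' t)).
  set (V := fun t => a t ^ 2 + e * b t ^ 2).
  assert (G : V t <= V t0 * exp (- (e ^ 3 * m) * (t - t0))).
  { apply gronwall; [exact Ht|]; intros u Hu; destruct (Bx u Hu) as [bx b_y], (B' u).
    destruct (separation_growth (-1) (-1) x y x' y' u) as [dU [I J]]; auto; try ring; try lra.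
    - rewrite Rabs_left by lra; ring.
    - rewrite Rabs_left by lra; ring.
    - exists (- dU); split.
      + apply (is_derive_ext (fun t => - (-1 * a t ^ 2 + e * -1 * b t ^ 2))); [intros v; unfold V; simpl; ring|].
        apply (@is_derive_opp R_AbsRing R_NormedModule); exact I.
      + fold (a u) (b u) in J; unfold V; lra. }
  unfold V in G; rewrite <- exp_half_sq in G.
  set (E := exp (- (e ^ 3 * m / 2) * (t - t0))) in *.
  assert (0 < E) by apply exp_pos.
  destruct (Bx t ltac:(lra)) as [b1 b2], (B' t) as [b3 b4], (Bx t0 ltac:(lra)) as [b5 b6], (B' t0) as [b7 b8].
  destruct (slow_coordinates_equivalent t (x t) (y t) (x' t) (y' t)) as [N1 _]; try lra.
  destruct (slow_coordinates_equivalent t0 (x t0) (y t0) (x' t0) (y' t0)) as [_ N2]; try lra.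
  fold (n t) (a t) (b t) in N1; fold (n t0) (a t0) (b t0) in N2.
  rewrite <- (pow2_abs (a t)), <- (pow2_abs (b t)), <- (pow2_abs (a t0)), <- (pow2_abs (b t0)) in G.
  pose proof (Rabs_pos (a t)); pose proof (Rabs_pos (b t)); pose proof (Rabs_pos (a t0)); pose proof (Rabs_pos (b t0)).
  set (p := Rabs (a t)) in *; set (q := Rabs (b t)) in *; set (p0 := Rabs (a t0)) in *; set (q0 := Rabs (b t0)) in *.
  assert (Q0 : p0 ^ 2 + e * q0 ^ 2 <= 4 * n t0 ^ 2).
  { assert (e * q0 ^ 2 <= 1 * q0 ^ 2) by (apply Rmult_le_compat_r; [apply pow2_ge_0 | lra]).
    assert ((p0 + q0) ^ 2 <= (2 * n t0) ^ 2) by (apply pow_incr; lra). nra. }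
  assert (Q1 : e * n t ^ 2 <= 8 * (p ^ 2 + e * q ^ 2)).
  { assert (n t ^ 2 <= (2 * (p + q)) ^ 2) by (apply pow_incr; split; [apply Np | lra]).
    assert (n t ^ 2 <= 8 * (p ^ 2 + q ^ 2)) by (pose proof (pow2_ge_0 (p - q)); nra).
    assert (e * n t ^ 2 <= e * (8 * (p ^ 2 + q ^ 2))) by (apply Rmult_le_compat_l; lra).
    assert (e * p ^ 2 <= 1 * p ^ 2) by (apply Rmult_le_compat_r; [apply pow2_ge_0 | lra]). lra. }
  assert (Q2 : e * n t ^ 2 <= 32 * n t0 ^ 2 * E ^ 2).
  { assert ((p0 ^ 2 + e * q0 ^ 2) * E ^ 2 <= 4 * n t0 ^ 2 * E ^ 2).
    { apply Rmult_le_compat_r; [apply pow2_ge_0 | exact Q0]. } lra. }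
  assert (Q3 : n t ^ 2 <= (32 / e * n t0 * E) ^ 2).
  { apply (Rmult_le_reg_l e); [lra|].
    replace (e * (32 / e * n t0 * E) ^ 2) with (32 / e * (32 * n t0 ^ 2 * E ^ 2)) by (field; lra).
    assert (0 <= 32 * n t0 ^ 2 * E ^ 2) by (repeat apply Rmult_le_pos; try lra; apply pow2_ge_0).
    nra. }
  apply Rsqr_incr_0; [unfold Rsqr; simpl in Q3; lra | apply Np |].
  repeat apply Rmult_le_pos; try lra; apply Np. }
assert (E1 : forall t, t0 <= t -> exp (- (e ^ 3 * m / 2) * (t - t0)) <= 1).
{ intros t Ht; rewrite <- exp_0; apply exp_le_exp.
  assert (0 <= e ^ 3 * m / 2 * (t - t0)) by (apply Rmult_le_pos; nra). lra. }
assert (Hin : forall t, t0 <= t -> n t < s / 2).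
{ apply self_improving_bound.
  - intros t; destruct (S t) as [I1 I2], (S' t) as [I1' I2'].
    now apply continuous_l1_dist; eapply derive_continuous; eassumption.
  - specialize (Np t0); nra.
  - intros t Ht Hb; eapply Rle_lt_trans; [now apply K0|].
    assert (0 <= 32 / e * n t0) by (apply Rmult_le_pos; [lra | apply Np]).
    specialize (E1 t Ht); nra. }
intros t Ht; apply K0; auto; intros u Hu; left; apply Hin; lra.
Qed.

(** The start is displaced from the periodic orbit along an expanding coordinate, where the form is
    positive. The form then outgrows the bound that the box would impose on it. *)
Lemma periodic_orbit_repels (x' y' : R -> R) :
  0 < e -> 0 < mu \/ 0 < La -> field_solution g1 g2 x' y' ->
  (forall t, Rabs (x' t) <= s / 2 /\ Rabs (y' t) <= s / 2) ->
  forall tau, 0 < tau -> exists x y, field_solution g1 g2 x y /\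
    Rabs (x 0 - x' 0) + Rabs (y 0 - y' 0) < tau /\
    ~ (forall t, 0 <= t -> Rabs (x t) <= s /\ Rabs (y t) <= s).
Proof.
intros He Hpos S' B' tau Htau.
pose proof e_bounds as Eb; pose proof (by_SF sf_s) as Hs.
pose proof z_bounds' as Zb.
rewrite (Rabs_right e) in Eb by lra.
assert (P3 : 0 < e ^ 3) by (apply pow_lt; lra).
assert (Sg : forall c, m <= Rabs c -> exists sg, sg ^ 2 = 1 /\ sg * c = Rabs c /\ (0 < c -> sg = 1)).
{ intros c Hc; destruct (Rle_dec 0 c).
  - exists 1; rewrite Rabs_right by lra; repeat split; try ring.
  - exists (-1); rewrite Rabs_left by lra; repeat split; try ring; lra. }
destruct (Sg mu) as [s1 [Hs1 [Es1 Ps1]]]; [apply (by_SF sf_mu)|].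
destruct (Sg La) as [s2 [Hs2 [Es2 Ps2]]]; [apply (by_SF sf_La)|].
assert (A1 : -1 <= s1 <= 1) by nra; assert (A2 : -1 <= s2 <= 1) by nra.
destruct (B' 0) as [B1 B2].
set (d := Rmin (tau / 2) (s / 2)).
assert (Hd : 0 < d) by (unfold d; apply Rmin_glb_lt; lra).
assert (Hd1 : d <= tau / 2) by apply Rmin_l; assert (Hd2 : d <= s / 2) by apply Rmin_r.
assert (Init : exists x0 y0, Rabs (x0 - x' 0) + Rabs (y0 - y' 0) = d /\
  0 < s1 * (W1 0 x0 y0 - W1 0 (x' 0) (y' 0)) ^ 2 + e * s2 * (W2 0 x0 y0 - W2 0 (x' 0) (y' 0)) ^ 2).
{ assert (Bd : forall u, Rabs u <= s / 2 -> Rabs (u + d) <= s).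
  { intros u Hu; pose proof (Rabs_triang u d); rewrite (Rabs_right d) in H by lra; lra. }
  destruct (Rlt_le_dec 0 mu) as [Hmu | Hmu].
  - exists (x' 0 + d), (y' 0).
    pose proof (by_SF sf_W1 0 (x' 0 + d) (y' 0) (x' 0) (y' 0)
      (Bd _ B1) ltac:(lra) ltac:(lra) ltac:(lra)) as P1.
    pose proof (by_SF sf_W2 0 (x' 0 + d) (y' 0) (x' 0) (y' 0)
      (Bd _ B1) ltac:(lra) ltac:(lra) ltac:(lra)) as P2.
    replace (x' 0 + d - x' 0) with d in * by ring.
    rewrite Rminus_eq_0, Rabs_R0, Rplus_0_r, (Rabs_right d) in * by lra.
    rewrite Rminus_0_r in P2; split; [reflexivity|].
    rewrite (Ps1 Hmu), Rmult_1_l.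
    set (a := W1 0 _ _ - _) in *; set (b := W2 0 _ _ - _) in *.
    apply Rabs_le_between in P1; apply Rabs_le_between in P2.
    assert (z * d <= d / 1000) by nra.
    assert (b ^ 2 <= (d / 1000) ^ 2) by (apply pow_maj_Rabs, Rabs_le_between; lra).
    assert ((d / 2) ^ 2 <= a ^ 2) by (apply pow_incr; lra).
    assert (- b ^ 2 <= e * s2 * b ^ 2).
    { assert (-1 <= e * s2) by nra. pose proof (pow2_ge_0 b); nra. }
    nra.
  - assert (HLa : 0 < La) by lra.
    exists (x' 0), (y' 0 + d).
    (* Here [a ^ 2] must be small against [e * d ^ 2], because the second square has weight [e]. The
       near-identity bound [z * d] for [a] is too weak; the weak dependence of [W1] on [y], of order
       [e], is what helps. *)
    pose proof (by_SF sf_W1y 0 (x' 0) (y' 0 + d) (y' 0)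
      ltac:(lra) (Bd _ B2) ltac:(lra)) as P1.
    pose proof (by_SF sf_W2 0 (x' 0) (y' 0 + d) (x' 0) (y' 0)
      ltac:(lra) (Bd _ B2) ltac:(lra) ltac:(lra)) as P2.
    replace (y' 0 + d - y' 0) with d in * by ring.
    rewrite Rminus_eq_0, Rabs_R0, Rplus_0_l, (Rabs_right d) in * by lra.
    rewrite (Rabs_right e) in P1 by lra.
    split; [reflexivity|].
    rewrite (Ps2 HLa), Rmult_1_r.
    set (a := W1 0 _ _ - _) in *; set (b := W2 0 _ _ - _) in *.
    apply Rabs_le_between in P2.
    assert (z * d <= d / 1000) by nra.
    assert ((d / 2) ^ 2 <= b ^ 2) by (apply pow_incr; lra).
    assert (a ^ 2 <= (K * e * d) ^ 2) by (apply pow_maj_Rabs; exact P1).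
    assert (K ^ 2 * e <= / 1000) by nra.
    assert ((K * e * d) ^ 2 <= e * d ^ 2 / 1000).
    { replace ((K * e * d) ^ 2) with (K ^ 2 * e * (e * d ^ 2)) by ring.
      assert (0 <= e * d ^ 2) by nonneg. nra. }
    assert (- a ^ 2 <= s1 * a ^ 2) by (pose proof (pow2_ge_0 a); nra).
    assert (e * (d / 2) ^ 2 <= e * b ^ 2) by (apply Rmult_le_compat_l; lra).
    assert (0 < e * d ^ 2) by (apply Rmult_lt_0_compat; [lra | apply pow_lt; lra]).
    nra. }
destruct Init as [x0 [y0 [D0 U0]]].
destruct (solution_exists 0 x0 y0) as [x [y [Ex [Ey S]]]].
exists x, y; rewrite Ex, Ey; split; [exact S | split; [lra|]].
intros Hin.
set (a := fun t => W1 t (x t) (y t) - W1 t (x' t) (y' t)).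
set (b := fun t => W2 t (x t) (y t) - W2 t (x' t) (y' t)).
set (U := fun t => s1 * a t ^ 2 + e * s2 * b t ^ 2).
set (k := e ^ 3 * m).
assert (Hk : 0 < k) by (unfold k; nra).
assert (UV : forall t, U t <= a t ^ 2 + e * b t ^ 2).
{ intros t; unfold U; pose proof (pow2_ge_0 (a t)); pose proof (pow2_ge_0 (b t)).
  assert (e * s2 <= e) by nra. nra. }
assert (U0' : 0 < U 0) by (unfold U, a, b; rewrite Ex, Ey; exact U0).
assert (Gr : forall t, 0 <= t -> U 0 * (1 + k * t) <= U t).
{ intros t Ht.
  assert (G' : - U t <= - U 0 * exp (k * (t - 0))).
  { apply (gronwall (fun u => - U u)); [exact Ht|]; intros u Hu; destruct (Hin u), (B' u); [lra|].
    destruct (separation_growth s1 s2 x y x' y' u) as [dU [I J]]; auto; try lra.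
    exists (- dU); split; [now apply (@is_derive_opp R_AbsRing R_NormedModule)|].
    fold (a u) (b u) k in J; specialize (UV u); nra. }
  rewrite Rminus_0_r in G'; pose proof (exp_ineq1_le (k * t)); nra. }
assert (Bd : forall t, 0 <= t -> U t <= 64).
{ intros t Ht; destruct (Hin t Ht), (B' t).
  destruct (slow_coordinates_equivalent t (x t) (y t) (x' t) (y' t)) as [_ N]; try lra.
  fold (a t) (b t) in N.
  pose proof (Rabs_diff_triang (x t) 0 (x' t)) as T1; pose proof (Rabs_diff_triang (y t) 0 (y' t)) as T2.
  rewrite Rminus_0_r, Rminus_0_l, Rabs_Ropp in T1, T2; assert (Bab : Rabs (a t) + Rabs (b t) <= 8) by lra.
  pose proof (Rabs_pos (a t)); pose proof (Rabs_pos (b t)).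
  eapply Rle_trans; [apply UV|].
  rewrite <- (pow2_abs (a t)), <- (pow2_abs (b t)).
  assert (e * Rabs (b t) ^ 2 <= 1 * Rabs (b t) ^ 2) by (apply Rmult_le_compat_r; [apply pow2_ge_0 | lra]).
  nra. }
(* At this time the linear lower bound exceeds 64 by [U 0]. *)
set (t := 64 / (k * U 0)).
assert (Ht : 0 <= t) by (unfold t; apply Rdiv_le_0_compat; nra).
specialize (Gr t Ht); specialize (Bd t Ht).
assert (E : U 0 * (1 + k * t) = U 0 + 64) by (unfold t; field; lra).
lra.
Qed.

End Core.

(** * Averaging of the scaled Rössler system *)

(* With [s = 1 + b], [c = e * C], [a = e * ((s - 1) * C + e ^ 2 * M)] and
   [x = e * X], [y = e * Y], [z = e * b * (Y + e * scaled_p C X Y P)],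
   the Rössler field becomes the following one; at [e = 0] it is a rotation in
   [(X, Y)] with frequency [sqrt s], and [P] is constant. *)
Definition scaled_p (C X Y P : R) : R := P + Y ^ 2 / 2 + C * X.
Definition scaled_X (s C e X Y P : R) : R := - s * Y - e * ((s - 1) * scaled_p C X Y P).
Definition scaled_Y (s C M e X Y : R) : R := X + e * ((s - 1) * C * Y) + e ^ 3 * (M * Y).
Definition drift_P (s C X Y P : R) : R :=
  (X + (s - 2) * C) * scaled_p C X Y P - (s - 1) * C * Y ^ 2.
Definition scaled_P (s C M e X Y P : R) : R :=
  e * drift_P s C X Y P - e ^ 2 * (M * Y) - e ^ 3 * (M * Y ^ 2).

Definition h0 (s X Y : R) : R := (X ^ 2 + s * Y ^ 2) / 2.

(* The corrections below solve the homological equations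
   [s * Y * dW/dX - X * dW/dY = g - mean of g] of the averaging procedure; the
   part of [W12] that depends on [h0] and [P] only is chosen so that the mean
   of the third-order term depends on [h0] alone. *)
Definition W11 (s C M X Y P : R) : R :=
  C * (s - 1) * X * Y + 1 / 6 * (s - 1) * Y ^ 3 + (s - 1) * Y * P.
Definition W11_X (s C M X Y P : R) : R :=
  C * (s - 1) * Y.
Definition W11_Y (s C M X Y P : R) : R :=
  C * (s - 1) * X + 1 / 2 * (s - 1) * Y ^ 2 + (s - 1) * P.
Definition W11_P (s C M X Y P : R) : R :=
  (s - 1) * Y.
Definition W12 (s C M X Y P : R) : R :=
  3 / 64 * (s - 1) / s ^ 2 * X ^ 4 + 3 / 32 * (s - 1) / s * X ^ 2 * Y ^ 2
  - 1 / 4 * (s - 1) / s ^ 2 * X ^ 2 * P + 1 / 4 * C ^ 2 * (s - 1) * (s - 2) / s * X ^ 2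
  - 1 / 2 * C * (s - 1) * X * Y ^ 2 + C * (s - 1) * (s - 2) / s * X * P - 5 / 64 * (s - 1) * Y ^ 4
  - 1 / 4 * (s - 1) * (2 * s + 1) / s * Y ^ 2 * P - 1 / 4 * C ^ 2 * (s - 1) * (s - 2) * Y ^ 2
  + 1 / 2 * (s - 1) * (s - 1) / s * P ^ 2.
Definition W12_X (s C M X Y P : R) : R :=
  3 / 16 * (s - 1) / s ^ 2 * X ^ 3 + 3 / 16 * (s - 1) / s * X * Y ^ 2
  - 1 / 2 * (s - 1) / s ^ 2 * X * P + 1 / 2 * C ^ 2 * (s - 1) * (s - 2) / s * X
  - 1 / 2 * C * (s - 1) * Y ^ 2 + C * (s - 1) * (s - 2) / s * P.
Definition W12_Y (s C M X Y P : R) : R :=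
  3 / 16 * (s - 1) / s * X ^ 2 * Y - C * (s - 1) * X * Y - 5 / 16 * (s - 1) * Y ^ 3
  - 1 / 2 * (s - 1) * (2 * s + 1) / s * Y * P - 1 / 2 * C ^ 2 * (s - 1) * (s - 2) * Y.
Definition W12_P (s C M X Y P : R) : R :=
  - 1 / 4 * (s - 1) / s ^ 2 * X ^ 2 + C * (s - 1) * (s - 2) / s * X
  - 1 / 4 * (s - 1) * (2 * s + 1) / s * Y ^ 2 + (s - 1) * (s - 1) / s * P.
Definition W13 (s C M X Y P : R) : R :=
  1 / 32 * C * (s - 1) * (6 * s - 1) / s ^ 2 * X ^ 3 * Y
  + 1 / 96 * (s - 1) * (3 * s + 1) / s ^ 2 * X ^ 2 * Y ^ 3
  + 1 / 16 * (s - 1) * (3 * s + 1) / s ^ 2 * X ^ 2 * Y * P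
  - 1 / 4 * C ^ 2 * (s - 1) * (s - 2) * (4 * s - 1) / s ^ 2 * X ^ 2 * Y
  + 3 / 32 * C * (s - 1) * (2 * s + 3) / s * X * Y ^ 3
  - 1 / 4 * C * (s - 1) * (8 * s - 11) / s * X * Y * P
  + (- 1 / 2 * C ^ 3 * (s - 1) * (s - 2) * (s - 2) / s + 1 / 2 * M / s) * X * Y
  + 1 / 480 * (s - 1) * (39 * s + 5) / s * Y ^ 5
  + 1 / 48 * (s - 1) * (9 * s ^ 2 + 7 * s + 4) / s ^ 2 * Y ^ 3 * P
  - 1 / 12 * C ^ 2 * (s - 1) * (s ^ 2 - 6 * s + 4) / s * Y ^ 3
  - 1 / 2 * (s - 1) * (s - 1) * (2 * s + 1) / s ^ 2 * Y * P ^ 2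
  - 1 / 2 * C ^ 2 * (s - 1) * (s - 2) * (s - 3) / s * Y * P.
Definition W13_X (s C M X Y P : R) : R :=
  3 / 32 * C * (s - 1) * (6 * s - 1) / s ^ 2 * X ^ 2 * Y
  + 1 / 48 * (s - 1) * (3 * s + 1) / s ^ 2 * X * Y ^ 3
  + 1 / 8 * (s - 1) * (3 * s + 1) / s ^ 2 * X * Y * P
  - 1 / 2 * C ^ 2 * (s - 1) * (s - 2) * (4 * s - 1) / s ^ 2 * X * Y
  + 3 / 32 * C * (s - 1) * (2 * s + 3) / s * Y ^ 3 - 1 / 4 * C * (s - 1) * (8 * s - 11) / s * Y * P
  + (- 1 / 2 * C ^ 3 * (s - 1) * (s - 2) * (s - 2) / s + 1 / 2 * M / s) * Y.
Definition W13_Y (s C M X Y P : R) : R :=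
  1 / 32 * C * (s - 1) * (6 * s - 1) / s ^ 2 * X ^ 3
  + 1 / 32 * (s - 1) * (3 * s + 1) / s ^ 2 * X ^ 2 * Y ^ 2
  + 1 / 16 * (s - 1) * (3 * s + 1) / s ^ 2 * X ^ 2 * P
  - 1 / 4 * C ^ 2 * (s - 1) * (s - 2) * (4 * s - 1) / s ^ 2 * X ^ 2
  + 9 / 32 * C * (s - 1) * (2 * s + 3) / s * X * Y ^ 2
  - 1 / 4 * C * (s - 1) * (8 * s - 11) / s * X * P
  + (- 1 / 2 * C ^ 3 * (s - 1) * (s - 2) * (s - 2) / s + 1 / 2 * M / s) * X
  + 1 / 96 * (s - 1) * (39 * s + 5) / s * Y ^ 4
  + 1 / 16 * (s - 1) * (9 * s ^ 2 + 7 * s + 4) / s ^ 2 * Y ^ 2 * P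
  - 1 / 4 * C ^ 2 * (s - 1) * (s ^ 2 - 6 * s + 4) / s * Y ^ 2
  - 1 / 2 * (s - 1) * (s - 1) * (2 * s + 1) / s ^ 2 * P ^ 2
  - 1 / 2 * C ^ 2 * (s - 1) * (s - 2) * (s - 3) / s * P.
Definition W13_P (s C M X Y P : R) : R :=
  1 / 16 * (s - 1) * (3 * s + 1) / s ^ 2 * X ^ 2 * Y
  - 1 / 4 * C * (s - 1) * (8 * s - 11) / s * X * Y
  + 1 / 48 * (s - 1) * (9 * s ^ 2 + 7 * s + 4) / s ^ 2 * Y ^ 3
  - (s - 1) * (s - 1) * (2 * s + 1) / s ^ 2 * Y * P
  - 1 / 2 * C ^ 2 * (s - 1) * (s - 2) * (s - 3) / s * Y.
Definition W21 (s C M X Y P : R) : R :=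
  - 1 / 4 * C * (s - 4) / (s - 2) * X * Y - 1 / 12 * (s - 3) / (s - 2) * Y ^ 3
  - 1 / 2 * (s - 3) / (s - 2) * Y * P - C ^ 2 * (s - 2) * Y.
Definition W21_X (s C M X Y P : R) : R :=
  - 1 / 4 * C * (s - 4) / (s - 2) * Y.
Definition W21_Y (s C M X Y P : R) : R :=
  - 1 / 4 * C * (s - 4) / (s - 2) * X - 1 / 4 * (s - 3) / (s - 2) * Y ^ 2
  - 1 / 2 * (s - 3) / (s - 2) * P - C ^ 2 * (s - 2).
Definition W21_P (s C M X Y P : R) : R :=
  - 1 / 2 * (s - 3) / (s - 2) * Y.

(** Derivatives along the parts of order [e], [e ^ 2] and [e ^ 3] of the scaled field, as functions
    of the gradient; the part of order zero is the rotation [(- s * Y, X, 0)]. *)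
Definition lie1 (s C X Y P gX gY gP : R) : R :=
  - (s - 1) * scaled_p C X Y P * gX + (s - 1) * C * Y * gY + drift_P s C X Y P * gP.
Definition lie2 (M Y gP : R) : R := - M * Y * gP.
Definition lie3 (M Y gY gP : R) : R := M * Y * gY - M * Y ^ 2 * gP.

(** At the limit parameters [- coef0 / coef1] equals [8 * omega ^ 2 * delta / 3], which is why
    [delta > 0] means a positive zero of the averaged equation. *)
Definition coef1 (s C : R) : R := - 3 * C * (s - 1) / (8 * s ^ 2).
Definition coef0 (s C M : R) : R := (M - C ^ 3 * (s - 1) * (s - 2)) / s.

Section Expansion.
Variables (s C M e X Y P : R).

Local Notation val f := (f s C M X Y P) (only parsing).

Definition slow1 : R :=
  h0 s X Y + e * val W11 + e ^ 2 * val W12 + e ^ 3 * val W13.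
(** The mean of [drift_P] over the rotation is [(s - 2) * C * P + C * h0 / 2], and the rate of [h0]
    has zero mean at order [e]. Adding this multiple of [h0] to [P] thus makes the leading rate
    proportional to the coordinate itself. *)
Definition slow2 : R :=
  P + h0 s X Y / (2 * (s - 2)) + e * val W21.

(** Exact remainders: the scaled field and the corrected functions are polynomials in [e], so the
    expansions terminate and no Taylor estimate is involved. *)
Definition rem1 : R :=
  lie1 s C X Y P (val W13_X) (val W13_Y) (val W13_P)
  + lie2 M Y (val W12_P) + lie3 M Y (val W11_Y) (val W11_P)
  + e * (lie2 M Y (val W13_P) + lie3 M Y (val W12_Y) (val W12_P))
  + e ^ 2 * lie3 M Y (val W13_Y) (val W13_P).
Definition rem2 : R :=
  lie1 s C X Y P (val W21_X) (val W21_Y) (val W21_P) - M * Y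
  + e * (lie2 M Y (val W21_P) + lie3 M Y (s * Y / (2 * (s - 2))) 1)
  + e ^ 2 * lie3 M Y (val W21_Y) (val W21_P).

(** [O1], [O2] and [O3] are the homological equations order by order; only the third leaves a
    mean. *)
Lemma slow1_expansion : s <> 0 ->
  (X + e * val W11_X + e ^ 2 * val W12_X + e ^ 3 * val W13_X) * scaled_X s C e X Y P
  + (s * Y + e * val W11_Y + e ^ 2 * val W12_Y + e ^ 3 * val W13_Y) * scaled_Y s C M e X Y
  + (e * val W11_P + e ^ 2 * val W12_P + e ^ 3 * val W13_P) * scaled_P s C M e X Y P
  = e ^ 3 * (coef1 s C * h0 s X Y ^ 2 + coef0 s C M * h0 s X Y) + e ^ 4 * rem1.
Proof.
intros Hs.
assert (O1 : - s * Y * val W11_X + X * val W11_Y + lie1 s C X Y P X (s * Y) 0 = 0).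
{ unfold W11_X, W11_Y, lie1, scaled_p; field. }
assert (O2 : - s * Y * val W12_X + X * val W12_Y
  + lie1 s C X Y P (val W11_X) (val W11_Y) (val W11_P) = 0).
{ unfold W12_X, W12_Y, W11_X, W11_Y, W11_P, lie1, scaled_p, drift_P, scaled_p; field; assumption. }
assert (O3 : - s * Y * val W13_X + X * val W13_Y
  + lie1 s C X Y P (val W12_X) (val W12_Y) (val W12_P)
  + lie2 M Y (val W11_P) + lie3 M Y (s * Y) 0
  = coef1 s C * h0 s X Y ^ 2 + coef0 s C M * h0 s X Y).
{ unfold W13_X, W13_Y, W12_X, W12_Y, W12_P, W11_P, lie1, lie2, lie3, drift_P, scaled_p, coef1, coef0, h0.
  field; assumption. }
rewrite <- O3; unfold rem1, scaled_X, scaled_Y, scaled_P.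
(* The left side equals this combination identically in [e], and [O1], [O2] remove the orders one
   and two. *)
match type of O1 with ?a = _ => match type of O2 with ?b = _ => match goal with |- _ = ?r =>
  transitivity (r + e * a + e ^ 2 * b); [unfold lie1, lie2, lie3; ring | rewrite O1, O2; ring] end end end.
Qed.

Lemma slow2_expansion : s <> 2 ->
  (X / (2 * (s - 2)) + e * val W21_X) * scaled_X s C e X Y P
  + (s * Y / (2 * (s - 2)) + e * val W21_Y) * scaled_Y s C M e X Y
  + (1 + e * val W21_P) * scaled_P s C M e X Y P
  = e * ((s - 2) * C * (P + h0 s X Y / (2 * (s - 2)))) + e ^ 2 * rem2.
Proof.
intros Hs; assert (s - 2 <> 0) by lra.
unfold rem2, scaled_X, scaled_Y, scaled_P, W21_X, W21_Y, W21_P, lie1, lie2, lie3, drift_P, scaled_p, h0.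
field; assumption.
Qed.

End Expansion.

(** * Derivatives of the corrected functions along a curve *)

Section Chain.
Variables (s C M e : R) (X Y P : R -> R) (t dX dY dP : R).
Hypotheses (DX : is_derive X t dX) (DY : is_derive Y t dY) (DP : is_derive P t dP).

Local Notation along f := (f s C M (X t) (Y t) (P t)) (only parsing).
Local Notation chain W W_X W_Y W_P := (is_derive (fun u => W s C M (X u) (Y u) (P u)) t
  (along W_X * dX + along W_Y * dY + along W_P * dP)) (only parsing).

Ltac chain_tac := auto_derive;
  [ repeat split; eexists; eassumption
  | rewrite (Derive_eta _ _ _ DX), (Derive_eta _ _ _ DY), (Derive_eta _ _ _ DP); field; try assumption ].

Lemma is_derive_W11 : s <> 0 -> chain W11 W11_X W11_Y W11_P.
Proof. intros Hs; unfold W11, W11_X, W11_Y, W11_P; chain_tac. Qed.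

Lemma is_derive_W12 : s <> 0 -> chain W12 W12_X W12_Y W12_P.
Proof. intros Hs; unfold W12, W12_X, W12_Y, W12_P; chain_tac. Qed.

Lemma is_derive_W13 : s <> 0 -> chain W13 W13_X W13_Y W13_P.
Proof. intros Hs; unfold W13, W13_X, W13_Y, W13_P; chain_tac. Qed.

Lemma is_derive_W21 : s - 2 <> 0 -> chain W21 W21_X W21_Y W21_P.
Proof. intros Hs; unfold W21, W21_X, W21_Y, W21_P; chain_tac. Qed.

Lemma is_derive_slow1 : s <> 0 -> is_derive (fun t => slow1 s C M e (X t) (Y t) (P t)) t
  ((X t + e * along W11_X + e ^ 2 * along W12_X
      + e ^ 3 * along W13_X) * dX
   + (s * Y t + e * along W11_Y + e ^ 2 * along W12_Y
      + e ^ 3 * along W13_Y) * dY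
   + (e * along W11_P + e ^ 2 * along W12_P
      + e ^ 3 * along W13_P) * dP).
Proof.
intros Hs; pose proof (is_derive_W11 Hs) as D1; pose proof (is_derive_W12 Hs) as D2; pose proof (is_derive_W13 Hs) as D3.
(* The corrections are replaced by arbitrary functions, so that their long polynomials are not
   differentiated again. *)
assert (G : forall f1 f2 f3 : R -> R, forall d1 d2 d3 : R,
  is_derive f1 t d1 -> is_derive f2 t d2 -> is_derive f3 t d3 ->
  is_derive (fun t => (X t ^ 2 + s * Y t ^ 2) / 2 + e * f1 t + e ^ 2 * f2 t + e ^ 3 * f3 t) t
    (X t * dX + s * Y t * dY + e * d1 + e ^ 2 * d2 + e ^ 3 * d3)).
{ intros f1 f2 f3 d1 d2 d3 I1 I2 I3; auto_derive.
  - repeat split; eexists; eassumption.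
  - rewrite (Derive_eta _ _ _ DX), (Derive_eta _ _ _ DY), (Derive_eta _ _ _ I1), (Derive_eta _ _ _ I2),
      (Derive_eta _ _ _ I3); field. }
evar_last; [exact (G _ _ _ _ _ _ D1 D2 D3) | simpl; ring].
Qed.

Lemma is_derive_slow2 : s - 2 <> 0 -> is_derive (fun t => slow2 s C M e (X t) (Y t) (P t)) t
  ((X t / (2 * (s - 2)) + e * along W21_X) * dX
   + (s * Y t / (2 * (s - 2)) + e * along W21_Y) * dY
   + (1 + e * along W21_P) * dP).
Proof.
intros Hs; pose proof (is_derive_W21 Hs) as D1.
assert (G : forall f : R -> R, forall d : R, is_derive f t d ->
  is_derive (fun t => P t + (X t ^ 2 + s * Y t ^ 2) / 2 / (2 * (s - 2)) + e * f t) t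
    (dP + (X t * dX + s * Y t * dY) / (2 * (s - 2)) + e * d)).
{ intros f d I; auto_derive.
  - repeat split; eexists; eassumption.
  - rewrite (Derive_eta _ _ _ DX), (Derive_eta _ _ _ DY), (Derive_eta _ _ _ DP), (Derive_eta _ _ _ I).
    field; assumption. }
evar_last; [exact (G _ _ D1) | unfold Rdiv; simpl; ring].
Qed.

End Chain.

(** * The scaled field in polar coordinates, with the angle as the independent variable *)

Section Polar.
Variables (rs w C M e : R).

Definition polar_X (th x : R) : R := w * (rs + x) * cos th.
Definition polar_Y (th x : R) : R := (rs + x) * sin th.
(** Solves [y = P + h0 / (2 * (s - 2))] for [P], where [h0 = w ^ 2 * r ^ 2 / 2]: the coordinate [y]
    is already the averaged one, and [slow2] differs from it by a term of order [e] only. *)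
Definition polar_P (x y : R) : R := y - w ^ 2 * (rs + x) ^ 2 / (4 * (w ^ 2 - 2)).
Definition polar_p (th x y : R) : R := scaled_p C (polar_X th x) (polar_Y th x) (polar_P x y).

(** In time, the angle moves with velocity [omega_of], the radius with [e * radial] and [y] with
    [e * vertical]; [polar_velocity] checks these against the scaled field. *)
Definition angular (th x y : R) : R :=
  ((w ^ 2 - 1) * C + e ^ 2 * M) * (cos th * sin th)
  + (w ^ 2 - 1) * polar_p th x y * sin th / (w * (rs + x)).
Definition omega_of (th x y : R) : R := w + e * angular th x y.
Definition radial (th x y : R) : R :=
  - (w ^ 2 - 1) * polar_p th x y * cos th / w
  + ((w ^ 2 - 1) * C + e ^ 2 * M) * ((rs + x) * sin th ^ 2).
Definition vertical (th x y : R) : R :=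
  drift_P (w ^ 2) C (polar_X th x) (polar_Y th x) (polar_P x y)
  - e * (M * polar_Y th x) - e ^ 2 * (M * polar_Y th x ^ 2)
  + w ^ 2 / (2 * (w ^ 2 - 2)) * ((rs + x) * radial th x y).

Lemma h0_polar th x : h0 (w ^ 2) (polar_X th x) (polar_Y th x) = w ^ 2 * (rs + x) ^ 2 / 2.
Proof.
unfold h0, polar_X, polar_Y.
replace ((w * (rs + x) * cos th) ^ 2 + w ^ 2 * ((rs + x) * sin th) ^ 2)
  with (w ^ 2 * (rs + x) ^ 2 * (Rsqr (sin th) + Rsqr (cos th))) by (unfold Rsqr; ring).
rewrite sin2_cos2; field.
Qed.

Lemma polar_velocity th x y : w <> 0 -> rs + x <> 0 ->
  w * (e * radial th x y) * cos th - w * (rs + x) * sin th * omega_of th x y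
    = scaled_X (w ^ 2) C e (polar_X th x) (polar_Y th x) (polar_P x y) /\
  e * radial th x y * sin th + (rs + x) * cos th * omega_of th x y
    = scaled_Y (w ^ 2) C M e (polar_X th x) (polar_Y th x) /\
  e * vertical th x y - w ^ 2 / (2 * (w ^ 2 - 2)) * ((rs + x) * (e * radial th x y))
    = scaled_P (w ^ 2) C M e (polar_X th x) (polar_Y th x) (polar_P x y).
Proof.
intros Hw Hr; pose proof (sin2_cos2 th) as Hcs; unfold Rsqr in Hcs.
unfold scaled_X, scaled_Y, scaled_P; fold (polar_p th x y).
split; [|split].
(* The sum of the squares of sine and cosine is inserted by hand; with it the identity is rational
   in the two as independent symbols. *)
- transitivity (- w ^ 2 * polar_Y th x - e * ((w ^ 2 - 1) * polar_p th x y) * (sin th * sin th + cos th * cos th)).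
  + unfold radial, omega_of, angular, polar_Y; field; split; assumption.
  + rewrite Hcs; ring.
- transitivity (polar_X th x + e * (((w ^ 2 - 1) * C + e ^ 2 * M) * polar_Y th x * (sin th * sin th + cos th * cos th))).
  + unfold radial, omega_of, angular, polar_X, polar_Y; field; split; assumption.
  + rewrite Hcs; ring.
- unfold vertical; ring.
Qed.

Definition slow1_polar (th x y : R) : R :=
  slow1 (w ^ 2) C M e (polar_X th x) (polar_Y th x) (polar_P x y).
Definition slow2_polar (th x y : R) : R :=
  slow2 (w ^ 2) C M e (polar_X th x) (polar_Y th x) (polar_P x y).

(* Along an orbit parametrized by the angle, a function of [(X, Y, P)] moves
   with its derivative along the scaled field divided by the angular velocity. *)
Lemma polar_curve (x y : R -> R) (t : R) :
  w <> 0 -> w ^ 2 <> 2 -> rs + x t <> 0 -> omega_of t (x t) (y t) <> 0 ->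
  is_derive x t (e * radial t (x t) (y t) / omega_of t (x t) (y t)) ->
  is_derive y t (e * vertical t (x t) (y t) / omega_of t (x t) (y t)) ->
  is_derive (fun t => polar_X t (x t)) t
    (scaled_X (w ^ 2) C e (polar_X t (x t)) (polar_Y t (x t)) (polar_P (x t) (y t)) / omega_of t (x t) (y t)) /\
  is_derive (fun t => polar_Y t (x t)) t
    (scaled_Y (w ^ 2) C M e (polar_X t (x t)) (polar_Y t (x t)) / omega_of t (x t) (y t)) /\
  is_derive (fun t => polar_P (x t) (y t)) t
    (scaled_P (w ^ 2) C M e (polar_X t (x t)) (polar_Y t (x t)) (polar_P (x t) (y t)) / omega_of t (x t) (y t)).
Proof.
intros Hw Hw2 Hr HO Dx Dy.
assert (Hw2' : w ^ 2 - 2 <> 0) by lra.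
destruct (polar_velocity t (x t) (y t) Hw Hr) as [E1 [E2 E3]]; rewrite <- E1, <- E2, <- E3.
set (O := omega_of t (x t) (y t)) in *; clearbody O.
set (A := radial t (x t) (y t)) in *; clearbody A.
set (V := vertical t (x t) (y t)) in *; clearbody V.
unfold polar_X, polar_Y, polar_P; split; [|split].
- auto_derive; [eexists; exact Dx | rewrite (Derive_eta _ _ _ Dx); field; assumption].
- auto_derive; [eexists; exact Dx | rewrite (Derive_eta _ _ _ Dx); field; assumption].
- auto_derive; [split; [eexists; exact Dy | split; [eexists; exact Dx | easy]] |].
  rewrite (Derive_eta _ _ _ Dx), (Derive_eta _ _ _ Dy); field.
  simpl in Hw2'; split; assumption.
Qed.

Lemma slow_polar_derive (x y : R -> R) (t : R) :
  w <> 0 -> w ^ 2 <> 2 -> rs + x t <> 0 -> omega_of t (x t) (y t) <> 0 ->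
  is_derive x t (e * radial t (x t) (y t) / omega_of t (x t) (y t)) ->
  is_derive y t (e * vertical t (x t) (y t) / omega_of t (x t) (y t)) ->
  is_derive (fun t => slow1_polar t (x t) (y t)) t
   ((e ^ 3 * (coef1 (w ^ 2) C * (w ^ 2 * (rs + x t) ^ 2 / 2) ^ 2 + coef0 (w ^ 2) C M * (w ^ 2 * (rs + x t) ^ 2 / 2))
     + e ^ 4 * rem1 (w ^ 2) C M e (polar_X t (x t)) (polar_Y t (x t)) (polar_P (x t) (y t)))
    / omega_of t (x t) (y t)) /\
  is_derive (fun t => slow2_polar t (x t) (y t)) t
   ((e * ((w ^ 2 - 2) * C * y t)
     + e ^ 2 * rem2 (w ^ 2) C M e (polar_X t (x t)) (polar_Y t (x t)) (polar_P (x t) (y t)))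
    / omega_of t (x t) (y t)).
Proof.
intros Hw Hw2 Hr HO Dx Dy.
destruct (polar_curve x y t Hw Hw2 Hr HO Dx Dy) as [DX [DY DP]].
assert (Hs : w ^ 2 <> 0) by now apply pow_nonzero.
assert (Hs2 : w ^ 2 - 2 <> 0) by lra.
assert (EP : y t = polar_P (x t) (y t) + h0 (w ^ 2) (polar_X t (x t)) (polar_Y t (x t)) / (2 * (w ^ 2 - 2))).
{ rewrite h0_polar; unfold polar_P; field; assumption. }
replace ((w ^ 2 - 2) * C * y t) with ((w ^ 2 - 2) * C * (polar_P (x t) (y t)
  + h0 (w ^ 2) (polar_X t (x t)) (polar_Y t (x t)) / (2 * (w ^ 2 - 2)))) by (now rewrite <- EP).
rewrite <- (h0_polar t (x t)).
rewrite <- slow1_expansion, <- slow2_expansion by assumption.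
unfold slow1_polar, slow2_polar.
set (s := w ^ 2) in *; clearbody s; clear EP.
set (O := omega_of t (x t) (y t)) in *; clearbody O.
set (X := fun t => polar_X t (x t)) in *; set (Y := fun t => polar_Y t (x t)) in *.
set (P := fun t => polar_P (x t) (y t)) in *.
change (polar_X t (x t)) with (X t) in *; change (polar_Y t (x t)) with (Y t) in *.
change (polar_P (x t) (y t)) with (P t) in *.
set (FX := scaled_X s C e (X t) (Y t) (P t)) in *; clearbody FX.
set (FY := scaled_Y s C M e (X t) (Y t)) in *; clearbody FY.
set (FP := scaled_P s C M e (X t) (Y t) (P t)) in *; clearbody FP.
split.
- evar_last.
  + apply (is_derive_slow1 s C M e X Y P t _ _ _ DX DY DP Hs).
  + unfold Rdiv; ring.
- evar_last.
  + apply (is_derive_slow2 s C M e X Y P t _ _ _ DX DY DP Hs2).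
  + unfold Rdiv; ring.
Qed.

End Polar.

(** * Expansions that are uniform in the small parameter *)

(** On the punctured neighbourhood, because the scaled parameters divide by powers of [e]. *)
Definition lim0 (c : R -> R) (l : R) : Prop := filterlim c (locally' 0) (locally l).

Lemma lim0_near (c : R -> R) (l eps : R) :
  lim0 c l -> 0 < eps -> locally' 0 (fun e => Rabs (c e - l) < eps).
Proof. intros H He; exact (proj1 (filterlim_locally c l) H (mkposreal eps He)). Qed.

Lemma near0 (d : R) : 0 < d -> locally' 0 (fun e => 0 < Rabs e < d).
Proof.
intros Hd; exists (mkposreal d Hd); intros e He Hne; split; [now apply Rabs_pos_lt|].
change (Rabs (e - 0) < d) in He; now rewrite Rminus_0_r in He.
Qed.

Lemma lim0_id : lim0 (fun e => e) 0.
Proof. intros P [d Hd]; exists d; intros e He _; exact (Hd e He). Qed.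

Lemma lim0_const l : lim0 (fun _ => l) l.
Proof. apply filterlim_const. Qed.

Lemma lim0_plus c c' l l' : lim0 c l -> lim0 c' l' -> lim0 (fun e => c e + c' e) (l + l').
Proof. intros H H'; apply (filterlim_comp_2 _ _ _ H H'), (@filterlim_plus R_AbsRing R_NormedModule). Qed.

Lemma lim0_mult c c' l l' : lim0 c l -> lim0 c' l' -> lim0 (fun e => c e * c' e) (l * l').
Proof. intros H H'; apply (filterlim_comp_2 _ _ _ H H'), (@filterlim_mult R_AbsRing). Qed.

Lemma lim0_comp (h : R -> R) c l : lim0 c l -> ex_derive h l -> lim0 (fun e => h (c e)) (h l).
Proof.
intros H Hh; apply (filterlim_comp _ _ _ c h _ (locally l)); [exact H|].
now apply (@ex_derive_continuous R_AbsRing).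
Qed.

Lemma lim0_opp c l : lim0 c l -> lim0 (fun e => - c e) (- l).
Proof. intros H; apply (lim0_comp Ropp); [exact H | auto_derive; easy]. Qed.

Lemma lim0_minus c c' l l' : lim0 c l -> lim0 c' l' -> lim0 (fun e => c e - c' e) (l - l').
Proof. intros H H'; apply lim0_plus; [exact H | now apply lim0_opp]. Qed.

Lemma lim0_pow c l n : lim0 c l -> lim0 (fun e => c e ^ n) (l ^ n).
Proof. intros H; apply (lim0_comp (fun u => u ^ n)); [exact H | auto_derive; easy]. Qed.

Lemma lim0_inv c l : lim0 c l -> l <> 0 -> lim0 (fun e => / c e) (/ l).
Proof. intros H Hl; apply (lim0_comp Rinv); [exact H | auto_derive; easy]. Qed.

Lemma lim0_div c c' l l' : lim0 c l -> lim0 c' l' -> l' <> 0 -> lim0 (fun e => c e / c' e) (l / l').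
Proof. intros H H' Hl; apply lim0_mult; [exact H | now apply lim0_inv]. Qed.

Section Tame.
Variable d : R.
Hypothesis Hd : d <= 1.

(* The remainders of the expansions are bounded and Lipschitz on the box,
   uniformly for small [e <> 0]. *)
Definition tame_at (K e : R) (f : R -> R -> R -> R -> R) : Prop := forall th x y th' x' y',
  Rabs x <= d -> Rabs y <= d -> Rabs x' <= d -> Rabs y' <= d ->
  Rabs (f e th x y) <= K /\
  Rabs (f e th x y - f e th' x' y') <= K * (Rabs (th - th') + Rabs (x - x') + Rabs (y - y')).

Definition tame (f : R -> R -> R -> R -> R) : Prop :=
  exists K, 0 <= K /\ locally' 0 (fun e => tame_at K e f).

Lemma l1_pos th th' x x' y y' : 0 <= Rabs (th - th') + Rabs (x - x') + Rabs (y - y').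
Proof. repeat apply Rplus_le_le_0_compat; apply Rabs_pos. Qed.

Lemma tame_lim0 c l : lim0 c l -> tame (fun e _ _ _ => c e).
Proof.
intros H; exists (Rabs l + 1); split; [pose proof (Rabs_pos l); lra|].
generalize (lim0_near c l 1 H Rlt_0_1); apply filter_imp; intros e He th x y th' x' y' _ _ _ _; split.
- abs_lra.
- rewrite Rminus_eq_0, Rabs_R0; apply Rmult_le_pos; [pose proof (Rabs_pos l); lra | apply l1_pos].
Qed.

Lemma tame_const c : tame (fun _ _ _ _ => c).
Proof. apply (tame_lim0 (fun _ => c) c), lim0_const. Qed.

Lemma tame_x : tame (fun _ _ x _ => x).
Proof.
exists 1; split; [lra|]; apply filter_forall; intros e th x y th' x' y' Hx _ _ _; split; [lra|].
pose proof (Rabs_pos (th - th')); pose proof (Rabs_pos (y - y')); lra.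
Qed.

Lemma tame_y : tame (fun _ _ _ y => y).
Proof.
exists 1; split; [lra|]; apply filter_forall; intros e th x y th' x' y' _ Hy _ _; split; [lra|].
pose proof (Rabs_pos (th - th')); pose proof (Rabs_pos (x - x')); lra.
Qed.

Lemma lipschitz_of_derive (h dh : R -> R) (K : R) :
  (forall t, is_derive h t (dh t)) -> (forall t, Rabs (dh t) <= K) ->
  forall t t', Rabs (h t - h t') <= K * Rabs (t - t').
Proof.
intros H HK t t'; destruct (Rle_dec t' t).
- rewrite (Rabs_right (t - t')) by lra; apply (derive_bounded_le h dh); auto.
- rewrite Rabs_minus_sym, (Rabs_minus_sym t), (Rabs_right (t' - t)) by lra.
  apply (derive_bounded_le h dh); auto; lra.
Qed.

Lemma tame_of_lipschitz (h : R -> R) : (forall t, Rabs (h t) <= 1) ->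
  (forall t t', Rabs (h t - h t') <= 1 * Rabs (t - t')) -> tame (fun _ th _ _ => h th).
Proof.
intros H1 H2; exists 1; split; [lra|]; apply filter_forall.
intros e th x y th' x' y' _ _ _ _; split; [apply H1|]; specialize (H2 th th').
pose proof (Rabs_pos (x - x')); pose proof (Rabs_pos (y - y')); lra.
Qed.

Lemma tame_cos : tame (fun _ th _ _ => cos th).
Proof.
apply tame_of_lipschitz; [intros; apply Rabs_le, COS_bound|].
apply (lipschitz_of_derive _ (fun t => - sin t)).
- intros t; apply is_derive_Reals, derivable_pt_lim_cos.
- intros t; rewrite Rabs_Ropp; apply Rabs_le, SIN_bound.
Qed.

Lemma tame_sin : tame (fun _ th _ _ => sin th).
Proof.
apply tame_of_lipschitz; [intros; apply Rabs_le, SIN_bound|].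
apply (lipschitz_of_derive _ cos).
- intros t; apply is_derive_Reals, derivable_pt_lim_sin.
- intros t; apply Rabs_le, COS_bound.
Qed.

Lemma tame_plus f g : tame f -> tame g -> tame (fun e th x y => f e th x y + g e th x y).
Proof.
intros [K1 [HK1 H1]] [K2 [HK2 H2]]; exists (K1 + K2); split; [lra|].
generalize (filter_and _ _ H1 H2); apply filter_imp; intros e [T1 T2] th x y th' x' y' Bx By Bx' By'.
destruct (T1 th x y th' x' y' Bx By Bx' By'), (T2 th x y th' x' y' Bx By Bx' By').
split; [abs_lra|].
replace (f e th x y + g e th x y - (f e th' x' y' + g e th' x' y'))
  with ((f e th x y - f e th' x' y') + (g e th x y - g e th' x' y')) by ring.
eapply Rle_trans; [apply Rabs_triang | lra].
Qed.

Lemma tame_opp f : tame f -> tame (fun e th x y => - f e th x y).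
Proof.
intros [K [HK H]]; exists K; split; [exact HK|].
revert H; apply filter_imp; intros e T th x y th' x' y' Bx By Bx' By'.
destruct (T th x y th' x' y' Bx By Bx' By') as [A B].
rewrite Rabs_Ropp; split; [exact A|].
replace (- f e th x y - - f e th' x' y') with (- (f e th x y - f e th' x' y')) by ring.
now rewrite Rabs_Ropp.
Qed.

Lemma tame_minus f g : tame f -> tame g -> tame (fun e th x y => f e th x y - g e th x y).
Proof. intros Hf Hg; apply (tame_plus f); [exact Hf | now apply tame_opp]. Qed.

Lemma tame_mult f g : tame f -> tame g -> tame (fun e th x y => f e th x y * g e th x y).
Proof.
intros [K1 [HK1 H1]] [K2 [HK2 H2]]; exists (2 * K1 * K2); split; [nonneg|].
generalize (filter_and _ _ H1 H2); apply filter_imp; intros e [T1 T2] th x y th' x' y' Bx By Bx' By'.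
destruct (T1 th x y th' x' y' Bx By Bx' By') as [A1 B1], (T2 th x y th' x' y' Bx By Bx' By') as [A2 B2].
destruct (T1 th' x' y' th x y Bx' By' Bx By) as [A1' _].
pose proof (l1_pos th th' x x' y y') as P.
set (n := Rabs (th - th') + Rabs (x - x') + Rabs (y - y')) in *.
assert (M : forall a b a' b', Rabs a <= a' -> Rabs b <= b' -> Rabs (a * b) <= a' * b').
{ intros; rewrite Rabs_mult; apply Rmult_le_compat; auto; apply Rabs_pos. }
split.
- apply Rle_trans with (K1 * K2); [now apply M|]. assert (0 <= K1 * K2) by nonneg; lra.
- replace (f e th x y * g e th x y - f e th' x' y' * g e th' x' y')
    with ((f e th x y - f e th' x' y') * g e th x y + f e th' x' y' * (g e th x y - g e th' x' y')) by ring.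
  eapply Rle_trans; [apply Rabs_triang|].
  pose proof (M _ _ _ _ B1 A2); pose proof (M _ _ _ _ A1' B2); lra.
Qed.

Lemma tame_pow f n : tame f -> tame (fun e th x y => f e th x y ^ n).
Proof.
intros Hf; induction n as [|n IH]; simpl; [apply tame_const | now apply (tame_mult f)].
Qed.

Lemma tame_inv f c : tame f -> 0 < c ->
  locally' 0 (fun e => forall th x y, Rabs x <= d -> Rabs y <= d -> c <= Rabs (f e th x y)) ->
  tame (fun e th x y => / f e th x y).
Proof.
clear Hd; intros [K1 [HK1 H1]] Hc H2.
assert (Pc : 0 < / c) by now apply Rinv_0_lt_compat.
assert (Q : 0 <= K1 * (/ c * / c)) by nonneg.
exists (/ c + K1 * (/ c * / c)); split; [lra|].
generalize (filter_and _ _ H1 H2); apply filter_imp; intros e [T1 T2] th x y th' x' y' Bx By Bx' By'.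
destruct (T1 th x y th' x' y' Bx By Bx' By') as [_ B1].
pose proof (T2 th x y Bx By) as C1; pose proof (T2 th' x' y' Bx' By') as C2.
set (u := f e th x y) in *; set (v := f e th' x' y') in *.
assert (Hu : u <> 0) by (intros E; rewrite E, Rabs_R0 in C1; lra).
assert (Hv : v <> 0) by (intros E; rewrite E, Rabs_R0 in C2; lra).
assert (I1 : / Rabs u <= / c) by (apply Rinv_le_contravar; lra).
assert (I2 : / Rabs v <= / c) by (apply Rinv_le_contravar; lra).
split; [rewrite Rabs_inv; lra|].
replace (/ u - / v) with (- (u - v) * (/ u * / v)) by (field; split; assumption).
rewrite !Rabs_mult, Rabs_Ropp, !Rabs_inv.
pose proof (l1_pos th th' x x' y y') as P.
set (n := Rabs (th - th') + Rabs (x - x') + Rabs (y - y')) in *.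
assert (0 < / Rabs u) by (apply Rinv_0_lt_compat; lra).
assert (0 < / Rabs v) by (apply Rinv_0_lt_compat; lra).
assert (Rabs (u - v) * (/ Rabs u * / Rabs v) <= (K1 * n) * (/ c * / c)).
{ apply Rmult_le_compat; [apply Rabs_pos | nonneg | exact B1 | apply Rmult_le_compat; lra]. }
assert (0 <= / c * n) by nonneg; lra.
Qed.

End Tame.

(** Lets a single constant serve all estimates of the slow-fast record. *)
Lemma tame_common (d : R) (l : list (R -> R -> R -> R -> R)) :
  (forall f, In f l -> tame d f) ->
  exists K, 1 <= K /\ locally' 0 (fun e => forall f, In f l -> tame_at d K e f).
Proof.
induction l as [|f l IH]; intros H.
- exists 1; split; [lra|]; now apply filter_forall.
- destruct IH as [K1 [HK1 H1]]; [intros g Hg; apply H; now right|].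
  destruct (H f (or_introl eq_refl)) as [K2 [HK2 H2]].
  exists (K1 + K2); split; [lra|].
  generalize (filter_and _ _ H1 H2); apply filter_imp; intros e [T1 T2] g Hg th x y th' x' y' Bx By Bx' By'.
  pose proof (l1_pos th th' x x' y y') as P.
  destruct Hg as [<- | Hg].
  + destruct (T2 th x y th' x' y' Bx By Bx' By'); split; nra.
  + destruct (T1 g Hg th x y th' x' y' Bx By Bx' By'); split; nra.
Qed.

(** The derivative is small at [x = 0] for small [e] and Lipschitz in [x] uniformly in [e], hence at
    most [zeta] on an interval whose size does not depend on [e]. So the box can be fixed before [e]
    is taken small. *)
Lemma small_lipschitz (d : R) (q dq : R -> R -> R) :
  0 < d <= 1 ->
  locally' 0 (fun e => forall x, is_derive (q e) x (dq e x)) ->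
  tame d (fun e _ x _ => dq e x) -> lim0 (fun e => dq e 0) 0 ->
  forall zeta, 0 < zeta -> exists sg, 0 < sg <= d /\
  locally' 0 (fun e => forall x x', Rabs x <= sg -> Rabs x' <= sg ->
    Rabs (q e x - q e x') <= zeta * Rabs (x - x')).
Proof.
intros Hd D [K [HK T]] L zeta Hz.
set (sg := Rmin d (zeta / (2 * (K + 1)))).
assert (P : 0 < zeta / (2 * (K + 1))) by (apply Rdiv_lt_0_compat; lra).
assert (Hsg : 0 < sg) by (unfold sg; apply Rmin_glb_lt; lra).
assert (Hsg1 : sg <= d) by apply Rmin_l; assert (Hsg2 : sg <= zeta / (2 * (K + 1))) by apply Rmin_r.
assert (Hsg3 : K * sg <= zeta / 2).
{ apply Rle_trans with ((K + 1) * (zeta / (2 * (K + 1)))); [apply Rmult_le_compat; lra | right; field; lra]. }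
exists sg; split; [lra|].
generalize (filter_and _ _ D (filter_and _ _ T (lim0_near _ _ (zeta / 2) L ltac:(lra)))).
apply filter_imp; intros e [De [Te Le]] x x' Hx Hx'; rewrite Rminus_0_r in Le.
assert (Z : Rabs 0 <= d) by (rewrite Rabs_R0; lra).
assert (B : forall x, Rabs x <= sg -> Rabs (dq e x) <= zeta).
{ intros u Hu; destruct (Te 0 u 0 0 0 0 ltac:(lra) Z Z Z) as [_ T'].
  rewrite !Rminus_eq_0, Rminus_0_r, Rabs_R0 in T'.
  assert (K * (0 + Rabs u + 0) <= zeta / 2).
  { eapply Rle_trans; [|exact Hsg3]; apply Rmult_le_compat_l; lra. }
  abs_lra. }
assert (M : forall x x', x' <= x -> Rabs x <= sg -> Rabs x' <= sg ->
  Rabs (q e x - q e x') <= zeta * (x - x')).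
{ intros u u' Hle Hu Hu'; apply (derive_bounded_le (q e) (dq e)); [lra | intros; apply De |].
  intros t Ht; apply B; abs_lra. }
destruct (Rle_dec x' x) as [H' | H'].
- rewrite (Rabs_right (x - x')) by lra; now apply M.
- rewrite Rabs_minus_sym, (Rabs_minus_sym x x'), (Rabs_right (x' - x)) by lra.
  apply M; auto; lra.
Qed.

(** Projection onto the box: composed with it, the planar field becomes bounded and Lipschitz
    everywhere and is unchanged inside. *)
Definition clamp (sg x : R) : R := Rmax (- sg) (Rmin sg x).

Lemma clamp_bound sg x : 0 <= sg -> Rabs (clamp sg x) <= sg.
Proof.
intros H; apply Rabs_le; unfold clamp; split; [apply Rmax_l | apply Rmax_lub; [lra | apply Rmin_l]].
Qed.

Lemma clamp_id sg x : Rabs x <= sg -> clamp sg x = x.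
Proof.
intros H; apply Rabs_le_between in H; unfold clamp.
rewrite Rmin_right, Rmax_right; lra.
Qed.

Lemma clamp_lipschitz sg x y : Rabs (clamp sg x - clamp sg y) <= Rabs (x - y).
Proof.
unfold clamp, Rmax, Rmin.
repeat destruct (Rle_dec _ _); unfold Rabs; repeat destruct (Rcase_abs _); lra.
Qed.

(** * The Rössler field satisfies the slow-fast estimates *)

Section Verification.
Variables (omega gam M0 del : R) (wf Cf Mf : R -> R).
Hypotheses (Homega : 0 < omega) (Homega1 : omega <> 1) (Homega2 : omega ^ 2 <> 2) (Hgam : gam <> 0) (Hdel : 0 < del).
Hypothesis HM0 : M0 - gam ^ 3 * (omega ^ 2 - 1) * (omega ^ 2 - 2) = - (del * (gam * (1 - omega ^ 2))).
Hypotheses (Lw : lim0 wf omega) (LC : lim0 Cf gam) (LM : lim0 Mf M0).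

(** At this radius [omega ^ 2 * r ^ 2 / 2] equals the zero [8 * omega ^ 2 * del / 3] of the averaged
    equation. *)
Definition radius : R := sqrt (16 * del / 3).
Definition box : R := Rmin (radius / 2) 1.

Lemma radius_pos : 0 < radius.
Proof. apply sqrt_lt_R0; lra. Qed.

Lemma radius_sq : radius ^ 2 = 16 * del / 3.
Proof. unfold radius; simpl; rewrite Rmult_1_r; apply sqrt_sqrt; lra. Qed.

Lemma box_bounds : 0 < box <= 1.
Proof.
pose proof radius_pos; unfold box; split; [apply Rmin_glb_lt; lra | apply Rmin_r].
Qed.

Lemma radius_box x : Rabs x <= box -> radius / 2 <= radius + x.
Proof.
intros H; assert (box <= radius / 2) by apply Rmin_l.
apply Rabs_le_between in H; lra.
Qed.

Lemma omega2_pos : 0 < omega ^ 2. Proof. now apply pow_lt. Qed.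
Lemma omega2_minus_2 : omega ^ 2 - 2 <> 0. Proof. intros H; apply Homega2; lra. Qed.
Lemma omega2_minus_1 : omega ^ 2 - 1 <> 0. Proof.
intros H; apply Homega1; apply Rminus_diag_uniq, (Rmult_eq_reg_r (omega + 1)); lra.
Qed.

Notation at_polar f := (fun e th x y =>
  f (wf e ^ 2) (Cf e) (Mf e) (polar_X radius (wf e) th x) (polar_Y radius th x) (polar_P radius (wf e) x y)).
Notation polar f := (fun e th x y => f radius (wf e) (Cf e) (Mf e) e th x y).

Ltac nz := pose proof omega2_pos; pose proof omega2_minus_2; pose proof omega2_minus_1; pose proof radius_pos;
  repeat first [ assumption | apply Rmult_integral_contrapositive_currified | apply pow_nonzero
               | lra ].

Ltac lim0_tac := repeat first
  [ exact Lw | exact LC | exact LM | exact lim0_id | apply lim0_const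
  | apply lim0_opp | apply lim0_minus | apply lim0_plus | apply lim0_pow
  | apply lim0_div | apply lim0_mult | apply lim0_inv ].

Ltac tame_step := first
  [ assumption | apply tame_const
  | exact (tame_lim0 box wf omega Lw) | exact (tame_lim0 box Cf gam LC) | exact (tame_lim0 box Mf M0 LM)
  | exact (tame_lim0 box _ _ lim0_id)
  | exact (tame_x box (proj2 box_bounds)) | exact (tame_y box (proj2 box_bounds)) | apply tame_cos | apply tame_sin
  | apply tame_plus | apply tame_minus | apply tame_opp | apply tame_pow | apply tame_mult
  | (eapply tame_lim0; lim0_tac; nz) ].

Lemma tame_inv_radius : tame box (fun e _ x _ => / (wf e * (radius + x))).
Proof.
apply (tame_inv box (fun e _ x _ => wf e * (radius + x)) (omega / 2 * (radius / 2))).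
- repeat tame_step.
- pose proof radius_pos; apply Rmult_lt_0_compat; lra.
- generalize (lim0_near _ _ (omega / 2) Lw ltac:(lra)); apply filter_imp; intros e H _ x _ Hx _.
  apply Rabs_def2 in H; pose proof (radius_box x Hx); pose proof radius_pos.
  rewrite Rabs_right by (apply Rle_ge, Rmult_le_pos; lra); apply Rmult_le_compat; lra.
Qed.

Lemma tame_angular : tame box (polar angular).
Proof.
pose proof tame_inv_radius; unfold angular, polar_p, scaled_p, polar_X, polar_Y, polar_P, Rdiv.
repeat tame_step.
Qed.

Lemma omega_of_lower : locally' 0 (fun e => 0 < wf e /\ wf e ^ 2 <> 2 /\ wf e ^ 2 <> 1 /\
  forall th x y, Rabs x <= box -> Rabs y <= box -> omega / 2 <= omega_of radius (wf e) (Cf e) (Mf e) e th x y).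
Proof.
destruct tame_angular as [K [HK T]].
(* One limit for two exclusions: as long as the product is nonzero, [wf e ^ 2] is neither 1 nor
   2. *)
assert (L1 : lim0 (fun e => (wf e ^ 2 - 2) * (wf e ^ 2 - 1)) ((omega ^ 2 - 2) * (omega ^ 2 - 1))).
{ apply (lim0_comp (fun u => (u ^ 2 - 2) * (u ^ 2 - 1))); [exact Lw | auto_derive; easy]. }
assert (Nz : (omega ^ 2 - 2) * (omega ^ 2 - 1) <> 0) by nz.
set (e4 := omega / (4 * (K + 1))).
assert (He4 : 0 < e4) by (apply Rdiv_lt_0_compat; lra).
assert (E4 : e4 * (K + 1) = omega / 4) by (unfold e4; field; lra).
assert (H4 : 0 < omega / 4) by lra.
generalize (filter_and _ _ (filter_and _ _ T (near0 e4 He4)) (filter_and _ _ (lim0_near _ _ _ Lw H4)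
  (lim0_near _ _ _ L1 (Rabs_pos_lt _ Nz)))).
apply filter_imp; intros e [[Te He] [B B3]]; apply Rabs_def2 in B.
assert (Nz3 : (wf e ^ 2 - 2) * (wf e ^ 2 - 1) <> 0).
{ intros E; rewrite E, Rminus_0_l, Rabs_Ropp in B3; lra. }
split; [lra|].
split; [intros E; apply Nz3; rewrite E; ring | split; [intros E; apply Nz3; rewrite E; ring|]].
intros th x y Hx Hy; destruct (Te th x y th x y Hx Hy Hx Hy) as [A _].
unfold omega_of; set (a := angular _ _ _ _ _ _ _ _) in *.
assert (Hea : Rabs (e * a) <= omega / 4).
{ rewrite Rabs_mult, <- E4; apply Rmult_le_compat; try apply Rabs_pos; lra. }
abs_lra.
Qed.

Lemma tame_inv_omega : tame box (fun e th x y => / omega_of radius (wf e) (Cf e) (Mf e) e th x y).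
Proof.
apply (tame_inv box (polar omega_of) (omega / 2)).
- pose proof tame_angular; unfold omega_of; repeat tame_step.
- lra.
- generalize omega_of_lower; apply filter_imp; intros e H th x y Hx Hy.
  eapply Rle_trans; [|apply Rle_abs]; now apply H.
Qed.

(** The derivative of the averaged equation at its positive zero, divided by [omega] because the
    angle replaces time. [rate2] keeps its dependence on [e]: its equation tolerates only an error
    of [K * e ^ 2], and the convergence to [rate2_limit] comes without a rate. For the first
    equation an error that is small against [e ^ 3] is admissible, so the limit can be used. *)
Definition rate1 : R := gam * (1 - omega ^ 2) * del / omega ^ 3.
Definition rate2 (e : R) : R := (wf e ^ 2 - 2) * Cf e / wf e.

Definition bend1 (e th x y : R) : R :=
  at_polar W11 e th x y + e * at_polar W12 e th x y + e ^ 2 * at_polar W13 e th x y.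
(** By [1 / omega_of = 1 / wf - e * angular / (wf * omega_of)], the leading term is divided by
    [wf e] alone, and what this neglects joins the remainder one order higher. *)
Definition error1 (e th x y : R) : R :=
  (rem1 (wf e ^ 2) (Cf e) (Mf e) e (polar_X radius (wf e) th x) (polar_Y radius th x) (polar_P radius (wf e) x y)
   - (coef1 (wf e ^ 2) (Cf e) * (wf e ^ 2 * (radius + x) ^ 2 / 2) ^ 2
      + coef0 (wf e ^ 2) (Cf e) (Mf e) * (wf e ^ 2 * (radius + x) ^ 2 / 2)) * polar angular e th x y / wf e)
  / polar omega_of e th x y.
Definition error2 (e th x y : R) : R :=
  (rem2 (wf e ^ 2) (Cf e) (Mf e) e (polar_X radius (wf e) th x) (polar_Y radius th x) (polar_P radius (wf e) x y)
   - (wf e ^ 2 - 2) * Cf e * y * polar angular e th x y / wf e)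
  / polar omega_of e th x y.

Lemma tame_coef1 : tame box (fun e _ _ _ => coef1 (wf e ^ 2) (Cf e)).
Proof. unfold coef1, Rdiv; repeat tame_step. Qed.

Lemma tame_coef0 : tame box (fun e _ _ _ => coef0 (wf e ^ 2) (Cf e) (Mf e)).
Proof. unfold coef0, Rdiv; repeat tame_step. Qed.

Lemma tame_inv_w : tame box (fun e _ _ _ => / wf e).
Proof. repeat tame_step. Qed.

Lemma tame_polar_XYP : tame box (fun e th x _ => polar_X radius (wf e) th x) /\
  tame box (fun _ th x _ => polar_Y radius th x) /\ tame box (fun e _ x y => polar_P radius (wf e) x y).
Proof. unfold polar_X, polar_Y, polar_P, Rdiv; repeat split; repeat tame_step. Qed.

Lemma tame_inv_s : tame box (fun e _ _ _ => / wf e ^ 2) /\ tame box (fun e _ _ _ => / (wf e ^ 2) ^ 2) /\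
  tame box (fun e _ _ _ => / (wf e ^ 2 - 2)) /\ tame box (fun e _ _ _ => / (2 * (wf e ^ 2 - 2))).
Proof. repeat split; eapply tame_lim0; lim0_tac; nz. Qed.

Ltac tame_poly := destruct tame_polar_XYP as [TX [TY TP]]; destruct tame_inv_s as [Ts1 [Ts2 [Ts3 Ts4]]];
  repeat tame_step.

Lemma tame_corrections : tame box (at_polar W11) /\ tame box (at_polar W12) /\ tame box (at_polar W13)
  /\ tame box (at_polar W21).
Proof. unfold W11, W12, W13, W21, Rdiv; repeat split; tame_poly. Qed.

Lemma tame_gradients : tame box (at_polar W11_Y) /\ tame box (at_polar W11_P) /\
  tame box (at_polar W12_X) /\ tame box (at_polar W12_Y) /\ tame box (at_polar W12_P) /\
  tame box (at_polar W13_X) /\ tame box (at_polar W13_Y) /\ tame box (at_polar W13_P) /\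
  tame box (at_polar W21_X) /\ tame box (at_polar W21_Y) /\ tame box (at_polar W21_P).
Proof.
unfold W11_Y, W11_P, W12_X, W12_Y, W12_P, W13_X, W13_Y, W13_P, W21_X, W21_Y, W21_P, Rdiv.
repeat split; tame_poly.
Qed.

Lemma tame_errors : tame box bend1 /\ tame box error1 /\ tame box error2.
Proof.
destruct tame_corrections as [T11 [T12 [T13 T21]]].
destruct tame_gradients as [G1 [G2 [G3 [G4 [G5 [G6 [G7 [G8 [G9 [G10 G11]]]]]]]]]].
pose proof tame_coef1; pose proof tame_coef0; pose proof tame_inv_w; pose proof tame_angular; pose proof tame_inv_omega.
unfold bend1, error1, error2, rem1, rem2, lie1, lie2, lie3, drift_P, scaled_p, Rdiv.
repeat split; tame_poly.
Qed.

Lemma tame_field : tame box (fun e th x y => polar radial e th x y / polar omega_of e th x y) /\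
  tame box (fun e th x y => polar vertical e th x y / polar omega_of e th x y) /\
  tame box (polar omega_of).
Proof.
pose proof tame_inv_w; pose proof tame_angular; pose proof tame_inv_omega.
assert (T : tame box (polar radial)).
{ unfold radial, polar_p, scaled_p, Rdiv; tame_poly. }
split; [|split].
- unfold Rdiv; tame_poly.
- unfold vertical, drift_P, scaled_p, Rdiv; tame_poly.
- unfold omega_of; tame_poly.
Qed.

Definition field1 (sg e th x y : R) : R :=
  e * polar radial e th (clamp sg x) (clamp sg y) / polar omega_of e th (clamp sg x) (clamp sg y).
Definition field2 (sg e th x y : R) : R :=
  e * polar vertical e th (clamp sg x) (clamp sg y) / polar omega_of e th (clamp sg x) (clamp sg y).
(** The derivative of [omega ^ 2 * r ^ 2 / 2] at [radius] is [omega ^ 2 * radius]; dividing by it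
    makes [level1] differ from [x], up to a constant, by little. *)
Definition level1 (e th x y : R) : R := polar slow1_polar e th x y / (omega ^ 2 * radius).
Definition level2 (e th x y : R) : R := polar slow2_polar e th x y.
Definition leading1 (e x : R) : R :=
  coef1 (wf e ^ 2) (Cf e) * (wf e ^ 2 * (radius + x) ^ 2 / 2) ^ 2
  + coef0 (wf e ^ 2) (Cf e) (Mf e) * (wf e ^ 2 * (radius + x) ^ 2 / 2).
Definition speed1 (e th x y : R) : R :=
  (e ^ 3 * (leading1 e x / wf e) + e ^ 4 * error1 e th x y) / (omega ^ 2 * radius).
Definition speed2 (e th x y : R) : R := e * rate2 e * y + e ^ 2 * error2 e th x y.

Lemma level1_eq e th x y :
  level1 e th x y = (wf e ^ 2 * (radius + x) ^ 2 / 2 + e * bend1 e th x y) / (omega ^ 2 * radius).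
Proof. unfold level1, slow1_polar, slow1; rewrite h0_polar; unfold bend1; f_equal; ring. Qed.

Lemma level2_eq e th x y : wf e ^ 2 <> 2 -> level2 e th x y = y + e * at_polar W21 e th x y.
Proof.
intros H; unfold level2, slow2_polar, slow2; rewrite h0_polar; unfold polar_P at 1.
field; intros E; apply H; lra.
Qed.

Lemma level_derive sg e (x y : R -> R) t :
  0 < sg <= box -> 0 < wf e -> wf e ^ 2 <> 2 -> 0 < polar omega_of e t (x t) (y t) ->
  Rabs (x t) <= sg -> Rabs (y t) <= sg ->
  is_derive x t (field1 sg e t (x t) (y t)) -> is_derive y t (field2 sg e t (x t) (y t)) ->
  is_derive (fun t => level1 e t (x t) (y t)) t (speed1 e t (x t) (y t)) /\
  is_derive (fun t => level2 e t (x t) (y t)) t (speed2 e t (x t) (y t)).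
Proof.
intros Hsg Hw Hw2 HO Bx By Dx Dy.
unfold field1, field2 in Dx, Dy; rewrite !clamp_id in Dx, Dy by assumption.
assert (Hr : radius + x t <> 0) by (pose proof radius_pos; pose proof (radius_box (x t) ltac:(lra)); lra).
destruct (slow_polar_derive radius (wf e) (Cf e) (Mf e) e x y t) as [I1 I2]; auto; try lra.
pose proof omega2_pos; pose proof radius_pos.
split.
- apply (is_derive_ext (fun t => / (omega ^ 2 * radius) * polar slow1_polar e t (x t) (y t))).
  { intros u; unfold level1, Rdiv; apply Rmult_comm. }
  evar_last; [apply is_derive_scal, I1|].
  unfold speed1, leading1, error1, omega_of in *; field; repeat split; lra.
- unfold level2; evar_last; [exact I2|].
  unfold speed2, error2, rate2, omega_of in *; field; split; lra.
Qed.

Lemma lim0_eq c l l' : lim0 c l -> l = l' -> lim0 c l'.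
Proof. now intros H <-. Qed.

Lemma lim0_leading1 : lim0 (fun e => leading1 e 0 / wf e / (omega ^ 2 * radius)) 0.
Proof.
eapply lim0_eq.
- unfold leading1, coef1, coef0; lim0_tac; nz.
- rewrite HM0, Rplus_0_r.
  replace (omega ^ 2 * radius ^ 2 / 2) with (8 * omega ^ 2 * del / 3) by (rewrite radius_sq; field).
  pose proof radius_pos; field; lra.
Qed.

(** [defect1] is the averaged rate minus [rate1] times [h0], and [defect2] the normalized [h0] minus
    [x]. The derivatives of both at [x = 0] tend to zero with [e], so their Lipschitz constants near
    there are small. *)
Definition defect1 (e x : R) : R :=
  (leading1 e x / wf e - rate1 * (wf e ^ 2 * (radius + x) ^ 2 / 2)) / (omega ^ 2 * radius).
Definition defect1' (e x : R) : R :=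
  ((2 * coef1 (wf e ^ 2) (Cf e) * (wf e ^ 2 * (radius + x) ^ 2 / 2) + coef0 (wf e ^ 2) (Cf e) (Mf e)) / wf e - rate1)
  * (wf e ^ 2 * (radius + x)) / (omega ^ 2 * radius).
Definition defect2 (e x : R) : R := wf e ^ 2 * (radius + x) ^ 2 / 2 / (omega ^ 2 * radius) - x.
Definition defect2' (e x : R) : R := wf e ^ 2 * (radius + x) / (omega ^ 2 * radius) - 1.

Lemma defect1_small zeta : 0 < zeta -> exists sg, 0 < sg <= box /\
  locally' 0 (fun e => forall x x', Rabs x <= sg -> Rabs x' <= sg ->
    Rabs (defect1 e x - defect1 e x') <= zeta * Rabs (x - x')).
Proof.
pose proof radius_pos; pose proof omega2_pos.
apply (small_lipschitz box defect1 defect1' box_bounds).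
- generalize omega_of_lower; apply filter_imp; intros e [Hw _] x; unfold defect1, defect1', leading1.
  generalize (coef1 (wf e ^ 2) (Cf e)) (coef0 (wf e ^ 2) (Cf e) (Mf e)); intros c1 c0.
  auto_derive; [easy|]; field; repeat split; lra.
- pose proof tame_coef1; pose proof tame_coef0; unfold defect1', Rdiv; repeat tame_step.
- unfold defect1', coef1, coef0; eapply lim0_eq.
  + lim0_tac; nz.
  + rewrite HM0, Rplus_0_r; unfold rate1.
    replace (omega ^ 2 * radius ^ 2 / 2) with (8 * omega ^ 2 * del / 3) by (rewrite radius_sq; field).
    field; lra.
Qed.

Lemma defect2_small zeta : 0 < zeta -> exists sg, 0 < sg <= box /\
  locally' 0 (fun e => forall x x', Rabs x <= sg -> Rabs x' <= sg ->
    Rabs (defect2 e x - defect2 e x') <= zeta * Rabs (x - x')).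
Proof.
pose proof radius_pos; pose proof omega2_pos.
apply (small_lipschitz box defect2 defect2' box_bounds).
- apply filter_forall; intros e x; unfold defect2, defect2'.
  auto_derive; [easy|]; field; lra.
- unfold defect2', Rdiv; repeat tame_step.
- unfold defect2'; eapply lim0_eq; [lim0_tac; nz|]; field; lra.
Qed.

Definition rate2_limit : R := (omega ^ 2 - 2) * gam / omega.

Lemma lim0_rate2 : lim0 rate2 rate2_limit.
Proof. unfold rate2; eapply lim0_eq; [lim0_tac; nz | reflexivity]. Qed.

Lemma rate1_neq0 : rate1 <> 0.
Proof.
pose proof omega2_minus_1; unfold rate1, Rdiv.
repeat apply Rmult_integral_contrapositive_currified; try lra.
now apply Rinv_neq_0_compat, pow_nonzero, Rgt_not_eq.
Qed.

Lemma rate2_limit_neq0 : rate2_limit <> 0.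
Proof.
pose proof omega2_minus_2; unfold rate2_limit, Rdiv.
repeat apply Rmult_integral_contrapositive_currified; try lra.
now apply Rinv_neq_0_compat, Rgt_not_eq.
Qed.

Lemma trig_period r th x y w C M e :
  polar_X r w (th + 2 * PI) x = polar_X r w th x /\
  polar_Y r (th + 2 * PI) x = polar_Y r th x /\
  radial r w C M e (th + 2 * PI) x y = radial r w C M e th x y /\
  vertical r w C M e (th + 2 * PI) x y = vertical r w C M e th x y /\
  omega_of r w C M e (th + 2 * PI) x y = omega_of r w C M e th x y.
Proof.
assert (Hc : cos (th + 2 * PI) = cos th) by (rewrite cos_plus, cos_2PI, sin_2PI; ring).
assert (Hs : sin (th + 2 * PI) = sin th) by (rewrite sin_plus, cos_2PI, sin_2PI; ring).
unfold vertical, omega_of, radial, angular, polar_p, polar_X, polar_Y; rewrite Hc, Hs.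
repeat split.
Qed.

Notation polar_Z := (fun e th x y =>
  (wf e ^ 2 - 1) * (polar_Y radius th x + e * polar_p radius (wf e) (Cf e) th x y)).

Lemma coordinates_tame : exists K, 1 <= K /\ locally' 0 (fun e =>
  tame_at box K e (fun e th x _ => polar_X radius (wf e) th x) /\
  tame_at box K e (fun _ th x _ => polar_Y radius th x) /\ tame_at box K e polar_Z).
Proof.
destruct tame_polar_XYP as [TX [TY TP]].
assert (TZ : tame box polar_Z) by (unfold polar_p, scaled_p, Rdiv; repeat tame_step).
destruct (tame_common box ((fun e th x _ => polar_X radius (wf e) th x)
  :: (fun _ th x _ => polar_Y radius th x) :: polar_Z :: nil)) as [K [HK HT]].
{ intros f Hf; simpl in Hf; repeat (destruct Hf as [<- | Hf]; [assumption|]); easy. }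
exists K; split; [exact HK|]; revert HT; apply filter_imp; intros e HT.
split; [|split]; apply HT; simpl; tauto.
Qed.

(** The constants are fixed in this order: [K0] by tameness, [m] and [K] with the help of the
    limiting rates, [z] by [m] and [K], the box [sg] by [z] through the two defects, and last the
    range of [e] by all of these. *)
Lemma rossler_slow_fast : exists m K z sg,
  0 < m <= 1 /\ 1 <= K /\ z = m ^ 2 / (1000 * K ^ 2) /\ 0 < sg <= box /\
  locally' 0 (fun e =>
    slow_fast m K z sg e rate1 (rate2 e) (field1 sg e) (field2 sg e)
      (level1 e) (level2 e) (speed1 e) (speed2 e) /\
    0 < wf e /\ wf e ^ 2 <> 2 /\ wf e ^ 2 <> 1 /\ 0 < rate2 e * rate2_limit /\
    (forall th x y, Rabs x <= box -> Rabs y <= box -> omega / 2 <= polar omega_of e th x y) /\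
    tame_at box K e (polar omega_of)).
Proof.
destruct tame_errors as [TB [TE1 TE2]]; destruct tame_field as [TG1 [TG2 TO]].
destruct tame_corrections as [_ [_ [_ T21]]].
set (G1 := fun e th x y => polar radial e th x y / polar omega_of e th x y) in *.
set (G2 := fun e th x y => polar vertical e th x y / polar omega_of e th x y) in *.
set (nu := omega ^ 2 * radius).
assert (Hnu : 0 < nu) by (unfold nu; pose proof radius_pos; pose proof omega2_pos; now apply Rmult_lt_0_compat).
(* The record compares speeds with rates times levels, so the corrections inside the levels enter
   the remainders. *)
set (F1 := fun e th x y => (error1 e th x y - rate1 * bend1 e th x y) / nu).
set (F2 := fun e th x y => error2 e th x y - rate2 e * at_polar W21 e th x y).
set (E1 := fun e th x y => error1 e th x y / nu).
set (B1 := fun e th x y => bend1 e th x y / nu).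
pose proof (tame_lim0 box _ _ lim0_rate2) as TR.
assert (TF1 : tame box F1) by (unfold F1, Rdiv; repeat tame_step).
assert (TF2 : tame box F2).
{ unfold F2; apply tame_minus; [exact TE2|]; apply (tame_mult box (fun e _ _ _ => rate2 e)); assumption. }
assert (TE1' : tame box E1) by (unfold E1, Rdiv; repeat tame_step).
assert (TB1 : tame box B1) by (unfold B1, Rdiv; repeat tame_step).
set (W21p := (at_polar W21) : R -> R -> R -> R -> R) in *.
destruct (tame_common box (G1 :: G2 :: F1 :: F2 :: E1 :: error2 :: B1 :: W21p :: (polar omega_of) :: nil))
  as [K0 [HK0 HT]].
{ intros f Hf; simpl in Hf.
  repeat (destruct Hf as [<- | Hf]; [assumption|]); easy. }
clear TG1 TG2 TF1 TF2 TE1 TE1' TE2 TB TB1 T21 TO TR.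
assert (R1 : 0 < Rabs rate1) by (apply Rabs_pos_lt, rate1_neq0).
assert (R2 : 0 < Rabs rate2_limit) by (apply Rabs_pos_lt, rate2_limit_neq0).
assert (R2' : 0 < Rabs rate2_limit / 2) by lra.
set (m := Rmin 1 (Rmin (Rabs rate1) (Rabs rate2_limit / 2))).
set (K := K0 + Rabs rate1 + 2 * Rabs rate2_limit).
assert (Hm : 0 < m <= 1).
{ unfold m; split; [repeat apply Rmin_glb_lt; lra | apply Rmin_l]. }
assert (Hm1 : m <= Rabs rate1) by (unfold m; eapply Rle_trans; [apply Rmin_r | apply Rmin_l]).
assert (Hm2 : m <= Rabs rate2_limit / 2) by (unfold m; eapply Rle_trans; [apply Rmin_r | apply Rmin_r]).
assert (HK : 1 <= K) by (unfold K; lra).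
assert (HKK : K0 <= K) by (unfold K; lra).
set (z := m ^ 2 / (1000 * K ^ 2)).
assert (Hz : 0 < z).
{ unfold z; apply Rdiv_lt_0_compat; [apply pow_lt; lra|].
  apply Rmult_lt_0_compat; [lra | apply pow_lt; lra]. }
destruct (defect1_small (z / 2) ltac:(lra)) as [sg1 [Hsg1 Q1]].
destruct (defect2_small (z / 2) ltac:(lra)) as [sg2 [Hsg2 Q2]].
set (sg := Rmin sg1 sg2).
assert (Hsg : 0 < sg) by (unfold sg; apply Rmin_glb_lt; lra).
assert (S1 : sg <= sg1) by apply Rmin_l; assert (S2 : sg <= sg2) by apply Rmin_r.
pose proof box_bounds as Hbox.
assert (Hzs : 0 < z * sg / 2) by (assert (0 < z * sg) by (now apply Rmult_lt_0_compat); lra).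
(* Below this bound, terms with an extra factor [e] use at most half of a budget [z] or [z * sg];
   the other half is left to the defects and to the leading term. *)
set (e7 := z * sg / 2 / K).
assert (He7 : 0 < e7) by (unfold e7; apply Rdiv_lt_0_compat; lra).
assert (E7 : e7 * K = z * sg / 2) by (unfold e7; field; lra).
exists m, K, z, sg; split; [exact Hm | split; [exact HK | split; [reflexivity | split; [lra|]]]].
generalize (filter_and _ _ (filter_and _ _ HT (near0 e7 He7)) (filter_and _ _ (filter_and _ _ Q1 Q2)
  (filter_and _ _ omega_of_lower (filter_and _ _ (lim0_near _ _ _ lim0_rate2 R2')
    (lim0_near _ _ (z * sg / 2) lim0_leading1 Hzs))))).
clear HT Q1 Q2; apply filter_imp; intros e [[HT [Hee He]] [[Q1 Q2] [[Hw [Hw2 [Hw1 HOm]]] [HR HL]]]].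
pose proof (HT G1 ltac:(simpl; tauto)) as BG1; pose proof (HT G2 ltac:(simpl; tauto)) as BG2.
pose proof (HT F1 ltac:(simpl; tauto)) as BF1; pose proof (HT F2 ltac:(simpl; tauto)) as BF2.
pose proof (HT E1 ltac:(simpl; tauto)) as BE1; pose proof (HT error2 ltac:(simpl; tauto)) as BE2.
pose proof (HT B1 ltac:(simpl; tauto)) as BB1; pose proof (HT W21p ltac:(simpl; tauto)) as BW.
pose proof (HT (polar omega_of) ltac:(simpl; tauto)) as BO; clear HT.
rewrite Rminus_0_r in HL.
assert (HeK : Rabs e * K <= z * sg / 2) by (rewrite <- E7; apply Rmult_le_compat_r; lra).
assert (HeK0 : Rabs e * K0 <= z * sg / 2).
{ eapply Rle_trans; [|exact HeK]; apply Rmult_le_compat_l; lra. }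
assert (HeK1 : Rabs e * K0 <= z / 2).
{ eapply Rle_trans; [exact HeK0|]. assert (z * sg <= z * 1) by (apply Rmult_le_compat_l; lra). lra. }
assert (HR' : Rabs rate2_limit / 2 <= Rabs (rate2 e) <= 2 * Rabs rate2_limit).
{ pose proof (Rabs_triang_inv (rate2 e) rate2_limit); pose proof (Rabs_triang_inv rate2_limit (rate2 e)).
  rewrite (Rabs_minus_sym rate2_limit) in *; lra. }
assert (Cl : forall x, Rabs (clamp sg x) <= box) by (intros x; eapply Rle_trans; [apply clamp_bound | ]; lra).
assert (P3 : 0 < Rabs e ^ 3) by now apply pow_lt.
assert (P4 : Rabs (e ^ 4) = Rabs e ^ 3 * Rabs e) by (rewrite <- RPow_abs; ring).
assert (N0 : forall x x' y y', 0 <= Rabs (x - x') + Rabs (y - y')).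
{ intros; apply Rplus_le_le_0_compat; apply Rabs_pos. }
assert (Wk : forall n, 0 <= n -> K0 * n <= K * n) by (intros; apply Rmult_le_compat_r; lra).
assert (Z0 : forall t t' : R, t = t' -> Rabs (t - t') = 0) by (intros t t' ->; now rewrite Rminus_eq_0, Rabs_R0).
split; [|split; [exact Hw | split; [exact Hw2 | split; [exact Hw1 | split; [|split; [exact HOm|]]]]]].
2: { clear - HR R2; unfold Rabs in *; repeat destruct (Rcase_abs _); nra. }
2: { intros th x y th' x' y' Bx By Bx' By'; destruct (BO th x y th' x' y' Bx By Bx' By') as [A B].
     split; [lra|]; eapply Rle_trans; [exact B | apply Wk, l1_pos]. }
assert (FE : forall G, tame_at box K0 e (fun _ => G) ->
  lipschitz3 (fun th x y => e * G th (clamp sg x) (clamp sg y)) (K * Rabs e) /\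
  (forall t x y, Rabs (e * G t (clamp sg x) (clamp sg y)) <= K * Rabs e)).
{ intros G HG; split.
  - intros t x y t' x' y'.
    replace (e * G t (clamp sg x) (clamp sg y) - e * G t' (clamp sg x') (clamp sg y'))
      with (e * (G t (clamp sg x) (clamp sg y) - G t' (clamp sg x') (clamp sg y'))) by ring.
    rewrite Rabs_mult, (Rmult_comm K), Rmult_assoc; apply Rmult_le_compat_l; [lra|].
    destruct (HG t (clamp sg x) (clamp sg y) t' (clamp sg x') (clamp sg y') (Cl _) (Cl _) (Cl _) (Cl _)) as [_ B].
    eapply Rle_trans; [exact B|]; eapply Rle_trans; [apply Wk, l1_pos|].
    apply Rmult_le_compat_l; [lra|].
    pose proof (clamp_lipschitz sg x x'); pose proof (clamp_lipschitz sg y y'); lra.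
  - intros t x y; rewrite Rabs_mult, (Rmult_comm K); apply Rmult_le_compat_l; [lra|].
    destruct (HG t (clamp sg x) (clamp sg y) t (clamp sg x) (clamp sg y) (Cl _) (Cl _) (Cl _) (Cl _)); lra. }
assert (EF1 : forall t x y, field1 sg e t x y = e * G1 e t (clamp sg x) (clamp sg y)).
{ intros; unfold field1, G1, Rdiv; ring. }
assert (EF2 : forall t x y, field2 sg e t x y = e * G2 e t (clamp sg x) (clamp sg y)).
{ intros; unfold field2, G2, Rdiv; ring. }
destruct (FE _ BG1) as [Lip1 Bd1]; destruct (FE _ BG2) as [Lip2 Bd2].
assert (Lip1' : lipschitz3 (field1 sg e) (K * Rabs e)).
{ intros t x y t' x' y'; rewrite !EF1; apply Lip1. }
assert (Lip2' : lipschitz3 (field2 sg e) (K * Rabs e)).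
{ intros t x y t' x' y'; rewrite !EF2; apply Lip2. }
split.
- split; [exact Hee|]. assert (Rabs e * 1 <= Rabs e * K) by (apply Rmult_le_compat_l; lra). lra.
- lra.
- split; [exact Hm1 | unfold K; lra].
- split; [lra | unfold K; lra].
- exists (K * Rabs e); split; assumption.
- intros; rewrite EF1; apply Bd1.
- intros; rewrite EF2; apply Bd2.
- intros t x y x' y'; eapply Rle_trans; [apply Lip1'|]; rewrite (Z0 t t eq_refl); lra.
- intros t x y x' y'; eapply Rle_trans; [apply Lip2'|]; rewrite (Z0 t t eq_refl); lra.
- intros t x y.
  destruct (trig_period radius t x y (wf e) (Cf e) (Mf e) e) as [PX [PY _]].
  destruct (trig_period radius t (clamp sg x) (clamp sg y) (wf e) (Cf e) (Mf e) e) as [_ [_ [Pr [Pv Po]]]].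
  unfold field1, field2, level1, level2, slow1_polar, slow2_polar.
  rewrite PX, PY, Pr, Pv, Po; repeat split.
- intros t x y x' y' Bx By Bx' By'.
  destruct (BB1 t x y t x' y' ltac:(lra) ltac:(lra) ltac:(lra) ltac:(lra)) as [_ B].
  specialize (Q2 x x' ltac:(lra) ltac:(lra)).
  rewrite (Z0 t t eq_refl), Rplus_0_l in B.
  replace (level1 e t x y - level1 e t x' y' - (x - x'))
    with (defect2 e x - defect2 e x' + e * (B1 e t x y - B1 e t x' y'))
    by (rewrite !level1_eq; unfold defect2, B1; fold nu; field; lra).
  eapply Rle_trans; [apply Rabs_triang|]; rewrite Rabs_mult.
  specialize (N0 x x' y y').
  assert (Rabs e * Rabs (B1 e t x y - B1 e t x' y') <= z / 2 * (Rabs (x - x') + Rabs (y - y'))).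
  { eapply Rle_trans; [apply Rmult_le_compat_l; [lra | exact B]|].
    rewrite <- Rmult_assoc; now apply Rmult_le_compat_r. }
  pose proof (Rabs_pos (y - y')). assert (0 <= z / 2 * Rabs (y - y')) by nonneg. lra.
- intros t x y x' y' Bx By Bx' By'.
  destruct (BW t x y t x' y' ltac:(lra) ltac:(lra) ltac:(lra) ltac:(lra)) as [_ B].
  rewrite (Z0 t t eq_refl), Rplus_0_l in B.
  rewrite !level2_eq by exact Hw2; fold (W21p e t x y) (W21p e t x' y').
  replace (y + e * W21p e t x y - (y' + e * W21p e t x' y') - (y - y'))
    with (e * (W21p e t x y - W21p e t x' y')) by ring.
  rewrite Rabs_mult; eapply Rle_trans; [apply Rmult_le_compat_l; [lra | exact B]|].
  rewrite <- Rmult_assoc; apply Rmult_le_compat_r; [apply N0 | lra].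
- intros t x y y' Bx By By'.
  destruct (BB1 t x y t x y' ltac:(lra) ltac:(lra) ltac:(lra) ltac:(lra)) as [_ B].
  rewrite (Z0 t t eq_refl), (Z0 x x eq_refl), !Rplus_0_l in B.
  replace (level1 e t x y - level1 e t x y') with (e * (B1 e t x y - B1 e t x y'))
    by (rewrite !level1_eq; unfold B1; fold nu; field; lra).
  rewrite Rabs_mult, (Rmult_comm K), Rmult_assoc; apply Rmult_le_compat_l; [lra|].
  eapply Rle_trans; [exact B | apply Wk, Rabs_pos].
- intros x y t Dx Dy Bx By; apply (level_derive sg); auto; try lra.
  eapply Rlt_le_trans; [|apply HOm; lra]; lra.
- intros t x y x' y' Bx By Bx' By'.
  destruct (BF1 t x y t x' y' ltac:(lra) ltac:(lra) ltac:(lra) ltac:(lra)) as [_ B].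
  specialize (Q1 x x' ltac:(lra) ltac:(lra)).
  rewrite (Z0 t t eq_refl), Rplus_0_l in B.
  replace (speed1 e t x y - speed1 e t x' y' - e ^ 3 * rate1 * (level1 e t x y - level1 e t x' y'))
    with (e ^ 3 * (defect1 e x - defect1 e x') + e ^ 4 * (F1 e t x y - F1 e t x' y')).
  2: { rewrite !level1_eq; unfold speed1, defect1, F1; fold nu; field; split; lra. }
  eapply Rle_trans; [apply Rabs_triang|]; rewrite !Rabs_mult, P4, <- RPow_abs.
  specialize (N0 x x' y y').
  assert (Rabs e ^ 3 * Rabs (defect1 e x - defect1 e x') <= Rabs e ^ 3 * (z / 2 * Rabs (x - x'))).
  { apply Rmult_le_compat_l; lra. }
  assert (Rabs e ^ 3 * (Rabs e * Rabs (F1 e t x y - F1 e t x' y'))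
    <= Rabs e ^ 3 * (z / 2 * (Rabs (x - x') + Rabs (y - y')))).
  { apply Rmult_le_compat_l; [lra|].
    eapply Rle_trans; [apply Rmult_le_compat_l; [lra | exact B]|].
    rewrite <- Rmult_assoc; now apply Rmult_le_compat_r. }
  pose proof (Rabs_pos (y - y')).
  assert (0 <= Rabs e ^ 3 * (z / 2 * Rabs (y - y'))) by (apply Rmult_le_pos; [lra | apply Rmult_le_pos; lra]). lra.
- intros t x y x' y' Bx By Bx' By'.
  destruct (BF2 t x y t x' y' ltac:(lra) ltac:(lra) ltac:(lra) ltac:(lra)) as [_ B].
  rewrite (Z0 t t eq_refl), Rplus_0_l in B.
  rewrite !level2_eq by exact Hw2; fold (W21p e t x y) (W21p e t x' y').
  replace (speed2 e t x y - speed2 e t x' y' - e * rate2 e * (y + e * W21p e t x y - (y' + e * W21p e t x' y')))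
    with (e ^ 2 * (F2 e t x y - F2 e t x' y')) by (unfold speed2, F2, W21p; ring).
  rewrite Rabs_mult, <- RPow_abs, (Rmult_comm K), Rmult_assoc.
  apply Rmult_le_compat_l; [apply pow2_ge_0|].
  eapply Rle_trans; [exact B | apply Wk, N0].
- intros t; destruct (BE1 t 0 0 t 0 0) as [B _]; try (rewrite Rabs_R0; lra).
  replace (speed1 e t 0 0) with (e ^ 3 * (leading1 e 0 / wf e / (omega ^ 2 * radius)) + e ^ 4 * E1 e t 0 0).
  2: { unfold speed1, E1; fold nu; field; split; lra. }
  eapply Rle_trans; [apply Rabs_triang|]; rewrite !Rabs_mult, P4, <- RPow_abs.
  assert (Rabs e ^ 3 * Rabs (leading1 e 0 / wf e / (omega ^ 2 * radius)) <= Rabs e ^ 3 * (z * sg / 2)).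
  { apply Rmult_le_compat_l; lra. }
  assert (Rabs e ^ 3 * (Rabs e * Rabs (E1 e t 0 0)) <= Rabs e ^ 3 * (z * sg / 2)).
  { apply Rmult_le_compat_l; [lra|]; eapply Rle_trans; [|exact HeK0]; apply Rmult_le_compat_l; lra. }
  lra.
- intros t; destruct (BE2 t 0 0 t 0 0) as [B _]; try (rewrite Rabs_R0; lra).
  replace (speed2 e t 0 0) with (e ^ 2 * error2 e t 0 0) by (unfold speed2; ring).
  rewrite Rabs_mult, <- RPow_abs, Rmult_comm; apply Rmult_le_compat_r; [apply pow2_ge_0 | lra].
Qed.

End Verification.

(** * From the angle to time *)

Section PairDerivative.
Context {U V : NormedModule R_AbsRing}.

Lemma is_derive_pair (f : R -> U) (g : R -> V) (t : R) (a : U) (b : V) :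
  is_derive f t a -> is_derive g t b -> is_derive (fun t => (f t, g t)) t (a, b).
Proof.
intros Hf Hg.
apply (filterdiff_comp'_2 f g (fun u v => (u, v)) t (fun y => scal y a) (fun y => scal y b)
  (fun u v => (u, v)) Hf Hg).
apply (filterdiff_linear (fun t : prod_NormedModule R_AbsRing U V => (fst t, snd t))).
apply is_linear_prod; [apply is_linear_fst | apply is_linear_snd].
Qed.

Lemma is_derive_fst (f : R -> U * V) (t : R) (l : U * V) :
  is_derive f t l -> is_derive (fun t => fst (f t)) t (fst l).
Proof.
intros H; apply (filterdiff_comp' f (fun p : prod_NormedModule R_AbsRing U V => fst p) t
  (fun y => scal y l) (fun p => fst p) H).
apply filterdiff_linear, is_linear_fst.
Qed.

Lemma is_derive_snd (f : R -> U * V) (t : R) (l : U * V) :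
  is_derive f t l -> is_derive (fun t => snd (f t)) t (snd l).
Proof.
intros H; apply (filterdiff_comp' f (fun p : prod_NormedModule R_AbsRing U V => snd p) t
  (fun y => scal y l) (fun p => snd p) H).
apply filterdiff_linear, is_linear_snd.
Qed.

Lemma norm_pair_le (x : U) (y : V) : norm (x, y) <= norm x + norm y.
Proof.
change (sqrt (norm x ^ 2 + norm y ^ 2) <= norm x + norm y).
pose proof (norm_ge_0 x); pose proof (norm_ge_0 y).
rewrite <- (sqrt_pow2 (norm x + norm y)) by lra; apply sqrt_le_1_alt; nra.
Qed.

Lemma norm_pair_ge (x : U) (y : V) : norm x <= norm (x, y) /\ norm y <= norm (x, y).
Proof.
pose proof (norm_prod x y) as [H _].
split; (eapply Rle_trans; [|exact H]); [apply Rmax_l | apply Rmax_r].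
Qed.

End PairDerivative.

Lemma norm3_le (p1 p2 p3 q1 q2 q3 : R) :
  norm (minus ((p1, p2, p3) : R3) (q1, q2, q3)) <= Rabs (p1 - q1) + Rabs (p2 - q2) + Rabs (p3 - q3).
Proof.
eapply Rle_trans; [apply (@norm_pair_le (prod_NormedModule R_AbsRing R_NormedModule R_NormedModule) R_NormedModule)|].
apply Rplus_le_compat_r, (@norm_pair_le R_NormedModule R_NormedModule).
Qed.

Lemma norm3_ge (p1 p2 p3 q1 q2 q3 : R) :
  Rabs (p1 - q1) <= norm (minus ((p1, p2, p3) : R3) (q1, q2, q3)) /\
  Rabs (p2 - q2) <= norm (minus ((p1, p2, p3) : R3) (q1, q2, q3)) /\
  Rabs (p3 - q3) <= norm (minus ((p1, p2, p3) : R3) (q1, q2, q3)).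
Proof.
destruct (@norm_pair_ge (prod_NormedModule R_AbsRing R_NormedModule R_NormedModule) R_NormedModule
  (p1 - q1, p2 - q2) (p3 - q3)) as [A B].
destruct (@norm_pair_ge R_NormedModule R_NormedModule (p1 - q1) (p2 - q2)) as [C D].
split; [|split]; [| |exact B].
- eapply Rle_trans; [exact C | exact A].
- eapply Rle_trans; [exact D | exact A].
Qed.

Lemma norm3_le0 (p1 p2 p3 : R) : norm ((p1, p2, p3) : R3) <= Rabs p1 + Rabs p2 + Rabs p3.
Proof.
eapply Rle_trans; [apply (@norm_pair_le (prod_NormedModule R_AbsRing R_NormedModule R_NormedModule) R_NormedModule)|].
apply Rplus_le_compat_r, (@norm_pair_le R_NormedModule R_NormedModule).
Qed.

Lemma solves_components (a b c : R) (u : R -> R3) (t : R) :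
  is_derive u t (rossler a b c (u t)) ->
  is_derive (fun t => fst (fst (u t))) t (- snd (fst (u t)) - snd (u t)) /\
  is_derive (fun t => snd (fst (u t))) t (fst (fst (u t)) + a * snd (fst (u t))) /\
  is_derive (fun t => snd (u t)) t (b * fst (fst (u t)) - c * snd (u t) + fst (fst (u t)) * snd (u t)).
Proof.
intros H.
pose proof (is_derive_fst (U := prod_NormedModule R_AbsRing R_NormedModule R_NormedModule) u t _ H) as H12.
pose proof (is_derive_fst (U := R_NormedModule) _ t _ H12) as H1.
pose proof (is_derive_snd (V := R_NormedModule) _ t _ H12) as H2.
pose proof (is_derive_snd (U := prod_NormedModule R_AbsRing R_NormedModule R_NormedModule) u t _ H) as H3.
destruct (u t) as [[x y] z]; simpl in H1, H2, H3 |- *.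
split; [exact H1 | split; [exact H2 | exact H3]].
Qed.

(** The quadratic term is only locally Lipschitz, but [u1 * u3 - v1 * v3 = u1 * (u3 - v3) + v3 * (u1
    - v1)]: bounds for [u1] and [v3] on the compact interval are enough for Gronwall. *)
Lemma rossler_unique (a b c T : R) (u v : R -> R3) :
  0 <= T -> (forall t, 0 <= t <= T -> is_derive u t (rossler a b c (u t))) ->
  (forall t, 0 <= t <= T -> is_derive v t (rossler a b c (v t))) ->
  u 0 = v 0 -> u T = v T.
Proof.
intros HT Hu Hv E0.
set (u1 := fun t => fst (fst (u t))); set (u2 := fun t => snd (fst (u t))); set (u3 := fun t => snd (u t)).
set (v1 := fun t => fst (fst (v t))); set (v2 := fun t => snd (fst (v t))); set (v3 := fun t => snd (v t)).
assert (Su : forall t, 0 <= t <= T -> is_derive u1 t (- u2 t - u3 t) /\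
  is_derive u2 t (u1 t + a * u2 t) /\ is_derive u3 t (b * u1 t - c * u3 t + u1 t * u3 t)).
{ intros t Ht; apply (solves_components a b c u t), Hu, Ht. }
assert (Sv : forall t, 0 <= t <= T -> is_derive v1 t (- v2 t - v3 t) /\
  is_derive v2 t (v1 t + a * v2 t) /\ is_derive v3 t (b * v1 t - c * v3 t + v1 t * v3 t)).
{ intros t Ht; apply (solves_components a b c v t), Hv, Ht. }
assert (Bd : forall f df : R -> R, (forall t, 0 <= t <= T -> is_derive f t (df t)) ->
  exists B, forall t, 0 <= t <= T -> Rabs (f t) <= B).
{ intros f df Hf.
  destruct (continuity_ab_maj (fun t => Rabs (f t)) 0 T HT) as [tm [Hm _]].
  - intros t Ht; apply continuity_pt_filterlim.
    apply (continuous_comp f Rabs); [eapply derive_continuous; now apply Hf | apply continuous_Rabs].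
  - exists (Rabs (f tm)); exact Hm. }
destruct (Bd u1 _ (fun t Ht => proj1 (Su t Ht))) as [B1 HB1].
destruct (Bd v3 _ (fun t Ht => proj2 (proj2 (Sv t Ht)))) as [B3 HB3].
set (L := 2 + Rabs a + Rabs b + Rabs c + Rabs B1 + Rabs B3).
set (E := fun t => (u1 t - v1 t) ^ 2 + (u2 t - v2 t) ^ 2 + (u3 t - v3 t) ^ 2).
assert (G : E T <= E 0 * exp (2 * L * (T - 0))).
{ apply gronwall; [exact HT|]; intros t Ht.
  exists (2 * (u1 t - v1 t) * ((- u2 t - u3 t) - (- v2 t - v3 t))
    + 2 * (u2 t - v2 t) * ((u1 t + a * u2 t) - (v1 t + a * v2 t))
    + 2 * (u3 t - v3 t) * ((b * u1 t - c * u3 t + u1 t * u3 t) - (b * v1 t - c * v3 t + v1 t * v3 t))); split.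
  - destruct (Su t Ht) as [I1 [I2 I3]], (Sv t Ht) as [J1 [J2 J3]].
    unfold E; auto_derive.
    + repeat split; eexists; eassumption.
    + rewrite (Derive_eta _ _ _ I1), (Derive_eta _ _ _ I2), (Derive_eta _ _ _ I3),
        (Derive_eta _ _ _ J1), (Derive_eta _ _ _ J2), (Derive_eta _ _ _ J3); ring.
  - specialize (HB1 t Ht); specialize (HB3 t Ht); unfold E.
    set (p := u1 t - v1 t); set (q := u2 t - v2 t); set (r := u3 t - v3 t).
    replace (2 * p * (- u2 t - u3 t - (- v2 t - v3 t)) + 2 * q * (u1 t + a * u2 t - (v1 t + a * v2 t))
      + 2 * r * (b * u1 t - c * u3 t + u1 t * u3 t - (b * v1 t - c * v3 t + v1 t * v3 t)))
      with (2 * (p * r) * (- 1 + b + v3 t) + 2 * q ^ 2 * a + 2 * r ^ 2 * (- c + u1 t))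
      by (unfold p, q, r; ring).
    pose proof (Rabs_bounds a); pose proof (Rabs_bounds b); pose proof (Rabs_bounds c).
    pose proof (Rabs_bounds B1); pose proof (Rabs_bounds B3).
    assert (W1 : Rabs (- 1 + b + v3 t) <= 1 + Rabs b + Rabs B3) by abs_lra.
    assert (Y1 : 2 * (p * r) * (- 1 + b + v3 t) <= (p ^ 2 + r ^ 2) * (1 + Rabs b + Rabs B3)).
    { eapply Rle_trans; [apply Rle_abs|]; rewrite Rabs_mult.
      apply Rmult_le_compat; try apply Rabs_pos; [|exact W1].
      apply Rabs_le; pose proof (pow2_ge_0 (p - r)); pose proof (pow2_ge_0 (p + r)); nra. }
    assert (W3 : - c + u1 t <= Rabs c + Rabs B1) by (pose proof (Rle_abs (u1 t)); lra).
    assert (Y2 : 2 * q ^ 2 * a <= 2 * q ^ 2 * Rabs a).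
    { apply Rmult_le_compat_l; [pose proof (pow2_ge_0 q); lra | lra]. }
    assert (Y3 : 2 * r ^ 2 * (- c + u1 t) <= 2 * r ^ 2 * (Rabs c + Rabs B1)).
    { apply Rmult_le_compat_l; [pose proof (pow2_ge_0 r); lra | lra]. }
    assert (Z : 0 <= p ^ 2 * (2 * L - (1 + Rabs b + Rabs B3)) + q ^ 2 * (2 * L - 2 * Rabs a)
      + r ^ 2 * (2 * L - (1 + Rabs b + Rabs B3) - 2 * (Rabs c + Rabs B1))).
    { repeat apply Rplus_le_le_0_compat; apply Rmult_le_pos; try apply pow2_ge_0; unfold L; lra. }
    lra. }
assert (Z : E 0 = 0) by (unfold E, u1, u2, u3, v1, v2, v3; rewrite E0; ring).
rewrite Z, Rmult_0_l in G; unfold E in G.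
pose proof (pow2_ge_0 (u1 T - v1 T)); pose proof (pow2_ge_0 (u2 T - v2 T)); pose proof (pow2_ge_0 (u3 T - v3 T)).
assert (E1 : u1 T = v1 T) by (apply Rminus_diag_uniq; nra).
assert (E2 : u2 T = v2 T) by (apply Rminus_diag_uniq; nra).
assert (E3 : u3 T = v3 T) by (apply Rminus_diag_uniq; nra).
unfold u1, u2, u3, v1, v2, v3 in E1, E2, E3.
destruct (u T) as [[x y] w], (v T) as [[x' y'] w']; simpl in *; congruence.
Qed.

Lemma atan_abs_le (t : R) : Rabs (atan t) <= Rabs t.
Proof.
pose proof (lipschitz_of_derive atan (fun t => / (1 + t ^ 2)) 1) as H.
specialize (H ltac:(intros u; auto_derive; [easy | field; nra])).
assert (B : forall u, Rabs (/ (1 + u ^ 2)) <= 1).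
{ intros u; pose proof (pow2_ge_0 u); rewrite Rabs_right.
  - rewrite <- Rinv_1; apply Rinv_le_contravar; lra.
  - left; apply Rinv_0_lt_compat; lra. }
specialize (H B t 0); rewrite atan_0, !Rminus_0_r in H; lra.
Qed.

Lemma polar_coordinates (u v : R) : 0 < u ->
  u = sqrt (u ^ 2 + v ^ 2) * cos (atan (v / u)) /\ v = sqrt (u ^ 2 + v ^ 2) * sin (atan (v / u)).
Proof.
intros Hu; rewrite cos_atan, sin_atan.
assert (E : sqrt (u ^ 2 + v ^ 2) = u * sqrt (1 + Rsqr (v / u))).
{ rewrite <- (sqrt_pow2 u) at 2 by lra; rewrite <- sqrt_mult_alt by apply pow2_ge_0.
  f_equal; unfold Rsqr; field; lra. }
assert (P : 0 < sqrt (1 + Rsqr (v / u))) by (apply sqrt_lt_R0; pose proof (Rle_0_sqr (v / u)); lra).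
rewrite E; split; field; lra.
Qed.

Lemma same_angle (th th' : R) : cos th = cos th' -> sin th = sin th' ->
  exists k : Z, th = th' + IZR k * (2 * PI).
Proof.
intros Hc Hs.
assert (E : cos (th - th') = 1).
{ rewrite cos_minus, Hc, Hs; pose proof (sin2_cos2 th') as H; unfold Rsqr in H; lra. }
set (d := th - th') in *.
assert (S : sin (d / 2) = 0).
{ replace d with (2 * (d / 2)) in E by field; rewrite cos_2a_sin in E; nra. }
destruct (sin_eq_0_0 _ S) as [k Hk]; exists k; unfold d in Hk; lra.
Qed.

(** * The chart from polar coordinates to the phase space *)

Section Chart.
Variables (rs w C M e : R).
Hypotheses (Hrs : 0 < rs) (Hw : 0 < w) (Hw2 : w ^ 2 <> 2) (Hw1 : w ^ 2 <> 1) (He : e <> 0).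

Definition chart (th x y : R) : R3 :=
  (e * polar_X rs w th x, e * polar_Y rs th x,
   e * (w ^ 2 - 1) * (polar_Y rs th x + e * polar_p rs w C th x y)).

Definition chart_rossler : R3 -> R3 :=
  rossler (e * ((w ^ 2 - 1) * C + e ^ 2 * M)) (w ^ 2 - 1) (e * C).

(** The velocity of the angle cancels the denominator of the angle-parametrized field, so in time
    the curve follows the scaled field; what remains is the change of scale. *)
Lemma chart_solution (x y th : R -> R) (t : R) :
  rs + x (th t) <> 0 -> omega_of rs w C M e (th t) (x (th t)) (y (th t)) <> 0 ->
  is_derive x (th t) (e * radial rs w C M e (th t) (x (th t)) (y (th t))
     / omega_of rs w C M e (th t) (x (th t)) (y (th t))) ->
  is_derive y (th t) (e * vertical rs w C M e (th t) (x (th t)) (y (th t))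
     / omega_of rs w C M e (th t) (x (th t)) (y (th t))) ->
  is_derive th t (omega_of rs w C M e (th t) (x (th t)) (y (th t))) ->
  is_derive (fun t => chart (th t) (x (th t)) (y (th t))) t
    (chart_rossler (chart (th t) (x (th t)) (y (th t)))).
Proof.
intros Hr HO Dx Dy Dth.
destruct (polar_curve rs w C M e x y (th t) ltac:(lra) Hw2 Hr HO Dx Dy) as [DX [DY DP]].
set (O := omega_of rs w C M e (th t) (x (th t)) (y (th t))) in *.
pose proof (is_derive_comp _ th t _ _ DX Dth) as IX; pose proof (is_derive_comp _ th t _ _ DY Dth) as IY.
pose proof (is_derive_comp _ th t _ _ DP Dth) as IP; cbv beta in IX, IY, IP.
assert (Z : forall a, scal O (a / O) = a) by (intros a; change (O * (a / O) = a); field; exact HO).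
rewrite Z in IX, IY, IP.
set (X := fun t => polar_X rs w (th t) (x (th t))) in *.
set (Y := fun t => polar_Y rs (th t) (x (th t))) in *.
set (P := fun t => polar_P rs w (x (th t)) (y (th t))) in *.
change (polar_X rs w (th t) (x (th t))) with (X t) in *; change (polar_Y rs (th t) (x (th t))) with (Y t) in *.
change (polar_P rs w (x (th t)) (y (th t))) with (P t) in *.
change (is_derive (fun t => ((e * X t, e * Y t, e * (w ^ 2 - 1) * (Y t + e * scaled_p C (X t) (Y t) (P t))) : R3)) t
  (- (e * Y t) - e * (w ^ 2 - 1) * (Y t + e * scaled_p C (X t) (Y t) (P t)),
   e * X t + e * ((w ^ 2 - 1) * C + e ^ 2 * M) * (e * Y t),
   (w ^ 2 - 1) * (e * X t) - e * C * (e * (w ^ 2 - 1) * (Y t + e * scaled_p C (X t) (Y t) (P t)))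
   + e * X t * (e * (w ^ 2 - 1) * (Y t + e * scaled_p C (X t) (Y t) (P t))))).
assert (JX : is_derive X t (scaled_X (w ^ 2) C e (X t) (Y t) (P t))) by exact IX.
assert (JY : is_derive Y t (scaled_Y (w ^ 2) C M e (X t) (Y t))) by exact IY.
assert (JP : is_derive P t (scaled_P (w ^ 2) C M e (X t) (Y t) (P t))) by exact IP.
clear IX IY IP DX DY DP Dx Dy; clearbody X Y P.
apply (is_derive_pair (U := prod_NormedModule R_AbsRing R_NormedModule R_NormedModule)
  (V := R_NormedModule)); [apply (is_derive_pair (U := R_NormedModule) (V := R_NormedModule))|].
- auto_derive; [eexists; exact JX | rewrite (Derive_eta _ _ _ JX); unfold scaled_X; ring].
- auto_derive; [eexists; exact JY | rewrite (Derive_eta _ _ _ JY); unfold scaled_Y; ring].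
- unfold scaled_p; auto_derive.
  + repeat split; eexists; eassumption.
  + rewrite (Derive_eta _ _ _ JX), (Derive_eta _ _ _ JY), (Derive_eta _ _ _ JP).
    unfold scaled_X, scaled_Y, scaled_P, drift_P, scaled_p; field.
Qed.

Lemma chart_injective th x y th' x' y' :
  0 < rs + x -> 0 < rs + x' -> chart th x y = chart th' x' y' ->
  x = x' /\ y = y' /\ exists k : Z, th = th' + IZR k * (2 * PI).
Proof.
intros Hr Hr' E; unfold chart in E; injection E; intros E3 E2 E1.
apply Rmult_eq_reg_l in E1; [|exact He]; apply Rmult_eq_reg_l in E2; [|exact He].
assert (Hb : e * (w ^ 2 - 1) <> 0).
{ apply Rmult_integral_contrapositive_currified; [exact He | intros Z; apply Hw1; lra]. }
apply Rmult_eq_reg_l in E3; [|exact Hb].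
assert (Ep : polar_p rs w C th x y = polar_p rs w C th' x' y').
{ apply (Rmult_eq_reg_l e); [lra | exact He]. }
unfold polar_p, scaled_p in Ep; rewrite E1, E2 in Ep.
unfold polar_X in E1; unfold polar_Y in E2.
assert (E1' : (rs + x) * cos th = (rs + x') * cos th').
{ apply (Rmult_eq_reg_l w); lra. }
assert (Ex : x = x').
{ pose proof (sin2_cos2 th) as T; pose proof (sin2_cos2 th') as T'; unfold Rsqr in T, T'.
  assert (S : (rs + x) ^ 2 = (rs + x') ^ 2).
  { replace ((rs + x) ^ 2) with ((rs + x) ^ 2 * (sin th * sin th + cos th * cos th)) by (rewrite T; ring).
    replace ((rs + x') ^ 2) with ((rs + x') ^ 2 * (sin th' * sin th' + cos th' * cos th')) by (rewrite T'; ring).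
    transitivity (((rs + x) * sin th) ^ 2 + ((rs + x) * cos th) ^ 2); [ring|].
    rewrite E2, E1'; ring. }
  nra. }
subst x'; split; [reflexivity | split].
- unfold polar_P in Ep; lra.
- apply same_angle; apply (Rmult_eq_reg_l (rs + x)); lra.
Qed.

Lemma chart_period th x y : chart (th + 2 * PI) x y = chart th x y.
Proof.
destruct (trig_period rs th x y w C 0 e) as [PX [PY _]].
unfold chart, polar_p; now rewrite PX, PY.
Qed.

Variable bx : R.
Hypothesis Hbx : 0 < bx <= rs / 2.

(** [A] and [k0] may depend on [e] but not on the point. Rotating by [- th] brings the base point to
    the positive axis, where the angle of nearby points is an arctangent; the last coordinate is
    then solved for, which divides by [w ^ 2 - 1]. *)
Lemma chart_inverse : exists A k0, 0 < A /\ 0 < k0 /\ forall th x y p k,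
  Rabs x <= bx -> Rabs y <= bx -> k <= k0 -> norm (minus p (chart th x y)) < k ->
  exists th' x' y', p = chart th' x' y' /\
  Rabs (th' - th) <= A * k /\ Rabs (x' - x) <= A * k /\ Rabs (y' - y) <= A * k /\ 0 < rs + x'.
Proof.
assert (Hb : w ^ 2 - 1 <> 0) by (intros Z; apply Hw1; lra).
assert (Hb2 : w ^ 2 - 2 <> 0) by (intros Z; apply Hw2; lra).
assert (He' : 0 < Rabs e) by now apply Rabs_pos_lt.
set (A1 := (/ w + 1) / Rabs e).
assert (Iw : 0 < / w) by now apply Rinv_0_lt_compat.
assert (HA1 : 0 < A1) by (unfold A1; apply Rdiv_lt_0_compat; lra).
set (R0 := 2 * rs).
set (kk := w ^ 2 / (4 * (w ^ 2 - 2))).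
(* One summand for each term of the decomposition [Ey] of [y' - y] below. *)
set (A2 := Rabs (/ (e * (w ^ 2 - 1) * e)) + Rabs (/ e) * Rabs (/ e) + R0 * 2 * Rabs (/ e)
           + Rabs C * Rabs (/ e) + Rabs kk * (2 * R0 * (2 * A1))).
assert (HA2 : 0 <= A2).
{ unfold A2; pose proof (Rabs_pos (/ (e * (w ^ 2 - 1) * e))); pose proof (Rabs_pos (/ e));
  pose proof (Rabs_pos C); pose proof (Rabs_pos kk); unfold R0.
  repeat apply Rplus_le_le_0_compat; repeat first [lra | apply Rmult_le_pos]. }
set (A := 4 * A1 / rs + 2 * A1 + A2).
assert (HA0 : 0 < 4 * A1 / rs) by (apply Rdiv_lt_0_compat; lra).
assert (HA : 0 < A) by (unfold A; lra).
exists A, (rs / (8 * A1)); split; [exact HA | split; [apply Rdiv_lt_0_compat; lra|]].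
intros th x y [[p1 p2] p3] k Hx Hy Hk Hp.
assert (Hk' : A1 * k <= rs / 8).
{ apply Rle_trans with (A1 * (rs / (8 * A1))); [apply Rmult_le_compat_l; lra | right; field; lra]. }
unfold chart in Hp at 1.
set (X := polar_X rs w th x) in *; set (Y := polar_Y rs th x) in *.
destruct (norm3_ge p1 p2 p3 (e * X) (e * Y) (e * (w ^ 2 - 1) * (Y + e * polar_p rs w C th x y))) as [N1 [N2 N3]].
pose proof (Rle_lt_trans _ _ _ N1 Hp) as D1; pose proof (Rle_lt_trans _ _ _ N2 Hp) as D2.
pose proof (Rle_lt_trans _ _ _ N3 Hp) as D3; clear N1 N2 N3 Hp.
assert (Hk0 : 0 <= k) by (pose proof (Rabs_pos (p1 - e * X)); lra).
set (X' := p1 / e); set (Y' := p2 / e).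
assert (De : forall p q, Rabs (p - e * q) < k -> Rabs (p / e - q) <= Rabs (/ e) * k).
{ intros p q H; replace (p / e - q) with (/ e * (p - e * q)) by (field; exact He).
  rewrite Rabs_mult; apply Rmult_le_compat_l; [apply Rabs_pos | lra]. }
pose proof (De _ _ D1) as DX; pose proof (De _ _ D2) as DY; fold X' in DX; fold Y' in DY.
set (r := rs + x).
assert (Hr : rs / 2 <= r <= 3 / 2 * rs) by (apply Rabs_le_between in Hx; unfold r; lra).
(* Coordinates in the rotated frame: [u] is close to [r], hence positive, and [v] is close to 0. *)
set (u := X' / w * cos th + Y' * sin th); set (v := - (X' / w) * sin th + Y' * cos th).
pose proof (sin2_cos2 th) as T; unfold Rsqr in T.
assert (Bt : forall a b, Rabs a <= Rabs (/ e) * k -> Rabs b <= Rabs (/ e) * k ->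
   Rabs (a / w * cos th + b * sin th) <= A1 * k /\ Rabs (- (a / w) * sin th + b * cos th) <= A1 * k).
{ intros a b Ha Hb'.
  assert (Cb : Rabs (cos th) <= 1) by apply Rabs_le, COS_bound.
  assert (Sb : Rabs (sin th) <= 1) by apply Rabs_le, SIN_bound.
  assert (E : A1 * k = / w * (Rabs (/ e) * k) + Rabs (/ e) * k).
  { unfold A1; rewrite Rabs_inv; field; lra. }
  assert (Q : Rabs (a / w) <= / w * (Rabs (/ e) * k)).
  { unfold Rdiv; rewrite Rabs_mult, Rmult_comm, (Rabs_right (/ w)) by lra.
    apply Rmult_le_compat_l; lra. }
  pose proof (Rabs_pos (a / w)); pose proof (Rabs_pos b).
  assert (U : forall p q p', Rabs q <= 1 -> Rabs p <= p' -> Rabs p * Rabs q <= p').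
  { intros p q p' Hq Hp'; rewrite <- (Rmult_1_r p'); apply Rmult_le_compat; try apply Rabs_pos; lra. }
  rewrite E; split; (eapply Rle_trans; [apply Rabs_triang|]); rewrite !Rabs_mult, ?Rabs_Ropp;
  apply Rplus_le_compat; now apply U. }
destruct (Bt (X' - X) (Y' - Y) DX DY) as [Bu Bv].
assert (Eu : (X' - X) / w * cos th + (Y' - Y) * sin th = u - r).
{ transitivity (u - r * (sin th * sin th + cos th * cos th)); [|rewrite T; ring].
  unfold u, X, Y, polar_X, polar_Y; fold r; field; lra. }
assert (Ev : - ((X' - X) / w) * sin th + (Y' - Y) * cos th = v).
{ unfold v, X, Y, polar_X, polar_Y; fold r; field; lra. }
rewrite Eu in Bu; rewrite Ev in Bv.
assert (Hu : rs / 4 <= u) by (apply Rabs_le_between in Bu; lra).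
destruct (polar_coordinates u v ltac:(lra)) as [Pu Pv].
set (r' := sqrt (u ^ 2 + v ^ 2)) in *; set (ps := atan (v / u)) in *.
assert (Hr' : Rabs (r' - u) <= Rabs v).
{ assert (u <= r').
  { rewrite <- (sqrt_pow2 u) by lra; apply sqrt_le_1_alt; pose proof (pow2_ge_0 v); lra. }
  assert (r' <= u + Rabs v).
  { pose proof (Rabs_pos v); rewrite <- (sqrt_pow2 (u + Rabs v)) by lra; apply sqrt_le_1_alt.
    rewrite <- (pow2_abs v).
    replace ((u + Rabs v) ^ 2) with (u ^ 2 + Rabs v ^ 2 + 2 * (u * Rabs v)) by ring.
    assert (0 <= u * Rabs v) by nonneg; lra. }
  rewrite Rabs_right; lra. }
assert (Drr : Rabs (r' - r) <= 2 * A1 * k).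
{ pose proof (Rabs_diff_triang r' u r); lra. }
assert (Br' : 0 < r' <= R0).
{ unfold R0; apply Rabs_le_between in Drr; split; lra. }
assert (EX' : w * r' * cos (th + ps) = X').
{ rewrite cos_plus; transitivity (w * (cos th * (r' * cos ps) - sin th * (r' * sin ps))); [ring|].
  rewrite <- Pu, <- Pv; unfold u, v.
  transitivity (X' * (sin th * sin th + cos th * cos th)); [field; lra | rewrite T; ring]. }
assert (EY' : r' * sin (th + ps) = Y').
{ rewrite sin_plus; transitivity (sin th * (r' * cos ps) + cos th * (r' * sin ps)); [ring|].
  rewrite <- Pu, <- Pv; unfold u, v.
  transitivity (Y' * (sin th * sin th + cos th * cos th)); [field; lra | rewrite T; ring]. }
set (y' := p3 / (e * (w ^ 2 - 1) * e) - Y' / e - Y' ^ 2 / 2 - C * X' + kk * r' ^ 2).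
exists (th + ps), (r' - rs), y'.
assert (PX' : polar_X rs w (th + ps) (r' - rs) = X').
{ unfold polar_X; replace (rs + (r' - rs)) with r' by ring; exact EX'. }
assert (PY' : polar_Y rs (th + ps) (r' - rs) = Y').
{ unfold polar_Y; replace (rs + (r' - rs)) with r' by ring; exact EY'. }
split; [|split; [|split; [|split]]].
- assert (E1 : e * polar_X rs w (th + ps) (r' - rs) = p1) by (rewrite PX'; unfold X'; field; exact He).
  assert (E2 : e * polar_Y rs (th + ps) (r' - rs) = p2) by (rewrite PY'; unfold Y'; field; exact He).
  assert (E3 : e * (w ^ 2 - 1) * (polar_Y rs (th + ps) (r' - rs) + e * polar_p rs w C (th + ps) (r' - rs) y') = p3).
  { unfold polar_p; rewrite PX', PY'; unfold scaled_p, polar_P.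
    replace (rs + (r' - rs)) with r' by ring.
    replace (w ^ 2 * r' ^ 2 / (4 * (w ^ 2 - 2))) with (kk * r' ^ 2) by (unfold kk; field; exact Hb2).
    unfold y'; field; split; assumption. }
  unfold chart; now rewrite E1, E2, E3.
- replace (th + ps - th) with ps by ring; unfold ps; eapply Rle_trans; [apply atan_abs_le|].
  unfold Rdiv; rewrite Rabs_mult, Rabs_inv, (Rabs_right u) by lra.
  apply (Rmult_le_reg_r u); [lra|]; rewrite Rmult_assoc, Rinv_l, Rmult_1_r by lra.
  assert (Q : 4 * A1 / rs * k * (rs / 4) = A1 * k) by (field; lra).
  assert (4 * A1 / rs * k <= A * k).
  { apply Rmult_le_compat_r; [exact Hk0 | unfold A; lra]. }
  assert (0 <= 4 * A1 / rs * k) by nonneg.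
  eapply Rle_trans; [exact Bv|]; rewrite <- Q; apply Rmult_le_compat; lra.
- replace (r' - rs - x) with (r' - r) by (unfold r; ring).
  eapply Rle_trans; [exact Drr|]; apply Rmult_le_compat_r; [exact Hk0 | unfold A; lra].
- assert (Ey : y' - y = / (e * (w ^ 2 - 1) * e) * (p3 - e * (w ^ 2 - 1) * (Y + e * polar_p rs w C th x y))
     + (- (/ e * (Y' - Y)) + (- ((Y' + Y) / 2 * (Y' - Y)) + (- (C * (X' - X)) + kk * ((r' + r) * (r' - r)))))).
  { unfold y', polar_p, scaled_p, polar_P; fold X Y r; fold kk.
    replace (w ^ 2 * r ^ 2 / (4 * (w ^ 2 - 2))) with (kk * r ^ 2) by (unfold kk; field; assumption).
    field; split; assumption. }
  rewrite Ey; clear Ey.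
  assert (BYY : Rabs ((Y' + Y) / 2) <= R0 * 2).
  { assert (Sb : forall a, Rabs (sin a) <= 1) by (intros a; apply Rabs_le, SIN_bound).
    assert (Rabs Y' <= R0).
    { rewrite <- EY', Rabs_mult, (Rabs_right r') by lra.
      apply Rle_trans with (r' * 1); [apply Rmult_le_compat_l; [lra | apply Sb] | lra]. }
    assert (Rabs Y <= R0).
    { unfold Y, polar_Y; fold r; rewrite Rabs_mult, (Rabs_right r) by lra; unfold R0.
      apply Rle_trans with (r * 1); [apply Rmult_le_compat_l; [lra | apply Sb] | lra]. }
    replace ((Y' + Y) / 2) with (/ 2 * (Y' + Y)) by field.
    rewrite Rabs_mult, (Rabs_right (/ 2)) by lra; pose proof (Rabs_triang Y' Y); lra. }
  assert (BRR : Rabs (r' + r) <= 2 * R0) by (rewrite Rabs_right by lra; unfold R0 in *; lra).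
  assert (M2 : forall a b a' b', Rabs a <= a' -> Rabs b <= b' -> - (a' * b') <= a * b <= a' * b').
  { intros; apply Rabs_le_between; rewrite Rabs_mult; apply Rmult_le_compat; auto; apply Rabs_pos. }
  pose proof (M2 (/ (e * (w ^ 2 - 1) * e)) _ _ _ (Rle_refl _) (Rlt_le _ _ D3)).
  pose proof (M2 (/ e) _ _ _ (Rle_refl _) DY); pose proof (M2 _ _ _ _ BYY DY).
  pose proof (M2 C _ _ _ (Rle_refl _) DX).
  pose proof (M2 kk _ _ _ (Rle_refl _) (Rabs_le _ _ (M2 _ _ _ _ BRR Drr))).
  assert (A2 * k <= A * k) by (apply Rmult_le_compat_r; [exact Hk0 | unfold A; lra]).
  apply Rabs_le; unfold A2 in *; lra.
- replace (rs + (r' - rs)) with r' by ring; lra.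
Qed.

Lemma chart_lipschitz (A : R) th x y x' y' :
  tame_at bx A e (fun _ th x _ => polar_X rs w th x) -> tame_at bx A e (fun _ th x _ => polar_Y rs th x) ->
  tame_at bx A e (fun e th x y => (w ^ 2 - 1) * (polar_Y rs th x + e * polar_p rs w C th x y)) ->
  Rabs x <= bx -> Rabs y <= bx -> Rabs x' <= bx -> Rabs y' <= bx ->
  norm (minus (chart th x y) (chart th x' y')) <= 3 * Rabs e * A * (Rabs (x - x') + Rabs (y - y')).
Proof.
intros TX TY TZ Bx By Bx' By'; unfold chart; eapply Rle_trans; [apply norm3_le|].
rewrite !(Rmult_assoc e (w ^ 2 - 1)), <- !Rmult_minus_distr_l, !(Rabs_mult e).
destruct (TX th x y th x' y' Bx By Bx' By') as [_ DX], (TY th x y th x' y' Bx By Bx' By') as [_ DY],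
  (TZ th x y th x' y' Bx By Bx' By') as [_ DZ].
rewrite <- Rmult_minus_distr_l in DZ; rewrite Rminus_eq_0, Rabs_R0 in DX, DY, DZ; pose proof (Rabs_pos e).
apply (Rmult_le_compat_l (Rabs e)) in DX, DY, DZ; lra.
Qed.
End Chart.

(** * Periodic orbit, stability and instability in the phase space *)

Section Orbit.
Variables (rs w C M e bx sg c0 m K z mu La Kc : R) (W1 W2 D1 D2 : R -> R -> R -> R).
Hypotheses (Hrs : 0 < rs) (Hw : 0 < w) (Hw2 : w ^ 2 <> 2) (Hw1 : w ^ 2 <> 1) (He : e <> 0).
Hypotheses (Hbx : 0 < bx <= rs / 2) (Hsg : 0 < sg <= bx) (Hc0 : 0 < c0).
Hypotheses (Hm : 0 < m <= 1) (HK : 1 <= K) (Hz : z = m ^ 2 / (1000 * K ^ 2)).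
Let Om := omega_of rs w C M e.
Let g1 := fun th x y => e * radial rs w C M e th (clamp sg x) (clamp sg y) / Om th (clamp sg x) (clamp sg y).
Let g2 := fun th x y => e * vertical rs w C M e th (clamp sg x) (clamp sg y) / Om th (clamp sg x) (clamp sg y).
Hypothesis SF : slow_fast m K z sg e mu La g1 g2 W1 W2 D1 D2.
Hypothesis Om_lower : forall th x y, Rabs x <= bx -> Rabs y <= bx -> c0 <= Om th x y.
Hypothesis Om_tame : tame_at bx K e (fun _ th x y => Om th x y).
Hypotheses (HKc : 1 <= Kc) (X_tame : tame_at bx Kc e (fun _ th x _ => polar_X rs w th x))
  (Y_tame : tame_at bx Kc e (fun _ th x _ => polar_Y rs th x))
  (Z_tame : tame_at bx Kc e (fun e th x y => (w ^ 2 - 1) * (polar_Y rs th x + e * polar_p rs w C th x y))).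

Lemma clamp_box u : Rabs (clamp sg u) <= bx.
Proof. eapply Rle_trans; [apply clamp_bound | ]; lra. Qed.

Lemma solution_lipschitz x y : field_solution g1 g2 x y ->
  (forall t t', Rabs (x t - x t') <= K * Rabs e * Rabs (t - t')) /\
  (forall t t', Rabs (y t - y t') <= K * Rabs e * Rabs (t - t')).
Proof.
intros S; split.
- apply (lipschitz_of_derive x (fun t => g1 t (x t) (y t))); [apply S|].
  intros; apply (sf_bound1 _ _ _ _ _ _ _ _ _ _ _ _ _ SF).
- apply (lipschitz_of_derive y (fun t => g2 t (x t) (y t))); [apply S|].
  intros; apply (sf_bound2 _ _ _ _ _ _ _ _ _ _ _ _ _ SF).
Qed.

(** Recovers time: along a solution parametrized by the angle, the angle itself solves this
    autonomous scalar equation, clamped so that its solutions are global. *)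
Definition angle_of (x y th : R -> R) : Prop :=
  forall t, is_derive th t (Om (th t) (clamp sg (x (th t))) (clamp sg (y (th t)))).

Lemma speed_lipschitz x y : field_solution g1 g2 x y ->
  lipschitz3 (fun _ th _ => Om th (clamp sg (x th)) (clamp sg (y th))) (K * (1 + 2 * (K * Rabs e))).
Proof.
intros S t th u t' th' u'; destruct (solution_lipschitz x y S) as [Lx Ly].
destruct (Om_tame th (clamp sg (x th)) (clamp sg (y th)) th' (clamp sg (x th')) (clamp sg (y th'))
  (clamp_box _) (clamp_box _) (clamp_box _) (clamp_box _)) as [_ T].
eapply Rle_trans; [exact T|].
rewrite Rmult_assoc; apply Rmult_le_compat_l; [lra|].
specialize (Lx th th'); specialize (Ly th th').
pose proof (clamp_lipschitz sg (x th) (x th')); pose proof (clamp_lipschitz sg (y th) (y th')).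
assert (0 <= K * Rabs e) by nonneg.
assert ((1 + 2 * (K * Rabs e)) * Rabs (th - th')
  <= (1 + 2 * (K * Rabs e)) * (Rabs (t - t') + Rabs (th - th') + Rabs (u - u'))).
{ apply Rmult_le_compat_l; [lra|]; pose proof (Rabs_pos (t - t')); pose proof (Rabs_pos (u - u')); lra. }
lra.
Qed.

(** A dummy second equation lets the planar existence and uniqueness results serve the scalar
    equation of the angle. *)
Lemma zero_lipschitz : lipschitz3 (fun _ _ _ => 0) (K * (1 + 2 * (K * Rabs e))).
Proof.
intros t th u t' th' u'; rewrite Rminus_eq_0, Rabs_R0; pose proof (Rabs_pos e).
apply Rmult_le_pos; [nonneg | apply l1_pos].
Qed.

Lemma angle_exists x y th0 : field_solution g1 g2 x y -> exists th, th 0 = th0 /\ angle_of x y th.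
Proof.
intros S; pose proof (speed_lipschitz x y S) as L1.
pose proof zero_lipschitz as L2.
destruct (cauchy_lipschitz _ _ _ K L1 L2) with (t0 := 0) (x0 := th0) (y0 := 0)
  as [th [u [E [_ [D _]]]]].
- intros t th u; destruct (Om_tame th (clamp sg (x th)) (clamp sg (y th)) th (clamp sg (x th)) (clamp sg (y th))
    (clamp_box _) (clamp_box _) (clamp_box _) (clamp_box _)) as [B _]; exact B.
- intros; rewrite Rabs_R0; lra.
- exists th; split; [exact E | exact D].
Qed.

Lemma angle_grows x y th t t' : angle_of x y th -> t <= t' -> c0 * (t' - t) <= th t' - th t.
Proof.
intros A H.
destruct (MVT_is_derive th _ t t' H (fun u _ => A u)) as [c [_ E]]; rewrite E.
apply Rmult_le_compat_r; [lra | apply Om_lower; apply clamp_box].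
Qed.

Lemma angle_onto x y th a : angle_of x y th -> exists t, th t = a.
Proof.
intros A.
assert (Cth : continuity th).
{ intros t; apply continuity_pt_filterlim; eapply derive_continuous; apply A. }
set (T := (Rabs (a - th 0) + 1) / c0).
assert (HT : 0 < T) by (unfold T; apply Rdiv_lt_0_compat; [pose proof (Rabs_pos (a - th 0)); lra | exact Hc0]).
pose proof (angle_grows x y th 0 T A ltac:(lra)) as G1.
pose proof (angle_grows x y th (- T) 0 A ltac:(lra)) as G2.
assert (E : c0 * T = Rabs (a - th 0) + 1) by (unfold T; field; lra).
assert (Ba : - Rabs (a - th 0) <= a - th 0 <= Rabs (a - th 0)) by (apply Rabs_le_between; lra).
destruct (IVT_gen th (- T) T a Cth) as [t [_ Ht]]; [|now exists t].
rewrite Rmin_left, Rmax_right; lra.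
Qed.

Lemma lift_solution x y th t :
  field_solution g1 g2 x y -> angle_of x y th -> Rabs (x (th t)) <= sg -> Rabs (y (th t)) <= sg ->
  is_derive (fun t => chart rs w C e (th t) (x (th t)) (y (th t))) t
    (chart_rossler w C M e (chart rs w C e (th t) (x (th t)) (y (th t)))).
Proof.
intros S A Bx By; destruct (S (th t)) as [Dx Dy]; specialize (A t).
unfold g1 in Dx; unfold g2 in Dy; rewrite !clamp_id in Dx, Dy, A by assumption.
apply (chart_solution rs w C M e); try assumption.
- apply Rabs_le_between in Bx; lra.
- assert (c0 <= Om (th t) (x (th t)) (y (th t))) by (apply Om_lower; lra); fold Om; lra.
Qed.

Section Periodic.
Variables (xs ys ths : R -> R).
Hypotheses (S0 : field_solution g1 g2 xs ys).
Hypothesis Per0 : forall t, xs (t + 2 * PI) = xs t /\ ys (t + 2 * PI) = ys t.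
Hypothesis Bd0 : forall t, Rabs (xs t) <= sg / 2 /\ Rabs (ys t) <= sg / 2.
Hypotheses (A0 : angle_of xs ys ths) (E0 : ths 0 = 0).

Definition orbit (t : R) : R3 := chart rs w C e (ths t) (xs (ths t)) (ys (ths t)).

Lemma orbit_solves : solves_on (chart_rossler w C M e) (fun _ => True) orbit.
Proof. intros t _; apply lift_solution; auto; destruct (Bd0 (ths t)); lra. Qed.

Lemma orbit_periodic : periodic_solution (chart_rossler w C M e) orbit.
Proof.
pose proof PI_bounds as HPI.
split; [exact orbit_solves | split].
- destruct (angle_onto xs ys ths (2 * PI) A0) as [T HT].
  assert (HT0 : 0 < T).
  { apply Rnot_le_lt; intros H; pose proof (angle_grows xs ys ths T 0 A0 H).
    assert (0 <= c0 * (0 - T)) by nonneg; lra. }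
  (* The shifted angle solves the same equation as [ths] and agrees with it at 0. *)
  assert (P : forall t, ths (t + T) - 2 * PI = ths t).
  { assert (S : field_solution (fun _ th _ => Om th (clamp sg (xs th)) (clamp sg (ys th))) (fun _ _ _ => 0)
      (fun t => ths (t + T) - 2 * PI) (fun _ => 0)).
    { intros t; split; [|apply (@is_derive_const R_AbsRing R_NormedModule)].
      set (v := ths (t + T) - 2 * PI).
      assert (Ev : ths (t + T) = v + 2 * PI) by (unfold v; ring).
      pose proof (A0 (t + T)) as I; rewrite Ev in I.
      destruct (Per0 v) as [Px Py]; rewrite Px, Py in I.
      assert (Eo : forall a b, Om (v + 2 * PI) a b = Om v a b) by (intros a b; apply trig_period).
      rewrite Eo in I.
      auto_derive; [eexists; exact I | rewrite (Derive_eta _ _ _ I); ring]. }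
    assert (S' : field_solution (fun _ th _ => Om th (clamp sg (xs th)) (clamp sg (ys th))) (fun _ _ _ => 0)
      ths (fun _ => 0)).
    { intros t; split; [apply A0 | apply (@is_derive_const R_AbsRing R_NormedModule)]. }
    pose proof (speed_lipschitz xs ys S0) as L1.
    pose proof zero_lipschitz as L2.
    intros t; apply (field_solution_unique _ _ _ _ _ _ _ 0 L1 L2 S S'); [|reflexivity].
    rewrite Rplus_0_l, HT, E0; ring. }
  exists T; split; [exact HT0|]; intros t; unfold orbit.
  replace (ths (t + T)) with (ths t + 2 * PI) by (rewrite <- (P t); ring).
  destruct (Per0 (ths t)) as [-> ->]; apply chart_period.
(* [polar_X] has opposite signs at the angles 0 and [PI], so the orbit is not constant. *)
- destruct (angle_onto xs ys ths PI A0) as [T HT].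
  exists 0, T; unfold orbit; rewrite E0, HT; intros E.
  unfold chart in E; injection E; intros _ _ E1.
  apply Rmult_eq_reg_l in E1; [|exact He].
  unfold polar_X in E1; rewrite cos_0, cos_PI in E1.
  destruct (Bd0 0) as [B1 _], (Bd0 PI) as [B2 _].
  apply Rabs_le_between in B1, B2.
  assert (0 < w * (rs + xs 0)) by (apply Rmult_lt_0_compat; lra).
  assert (0 < w * (rs + xs PI)) by (apply Rmult_lt_0_compat; lra).
  lra.
Qed.

(** The orbit point close to [p] may have another angle than [p]; since [xs] and [ys] are Lipschitz
    in the angle, passing to the same angle only costs a factor. *)
Lemma near_orbit_coordinates eta : 0 < eta -> exists kappa, 0 < kappa /\ forall p,
  near_orbit orbit kappa p -> exists th x y, p = chart rs w C e th x y /\ 0 < rs + x /\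
    Rabs (x - xs th) + Rabs (y - ys th) < eta.
Proof.
intros Heta; destruct (solution_lipschitz xs ys S0) as [Lx Ly].
destruct (chart_inverse rs w C e Hrs Hw Hw2 Hw1 He bx Hbx) as [A [k0 [HA [Hk0 H]]]].
assert (HKe : 0 <= K * Rabs e) by nonneg.
set (A' := (2 + 2 * (K * Rabs e)) * A).
assert (HA' : 0 < A') by (unfold A'; apply Rmult_lt_0_compat; lra).
exists (Rmin k0 (eta / (2 * A'))).
assert (P : 0 < eta / (2 * A')) by (apply Rdiv_lt_0_compat; lra).
set (k := Rmin k0 (eta / (2 * A'))).
assert (Hk : 0 < k) by (unfold k; now apply Rmin_glb_lt).
assert (Hk2 : A' * k <= eta / 2).
{ apply Rle_trans with (A' * (eta / (2 * A'))); [apply Rmult_le_compat_l; [lra | apply Rmin_r] | right; field; lra]. }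
split; [exact Hk|]; intros p [t Ht].
destruct (Bd0 (ths t)) as [B1 B2].
destruct (H (ths t) (xs (ths t)) (ys (ths t)) p k ltac:(lra) ltac:(lra) (Rmin_l _ _) Ht)
  as [th [x [y [Ep [Q1 [Q2 [Q3 Q4]]]]]]].
exists th, x, y; split; [exact Ep | split; [exact Q4|]].
specialize (Lx (ths t) th); specialize (Ly (ths t) th).
rewrite Rabs_minus_sym in Q1.
assert (K * Rabs e * Rabs (ths t - th) <= K * Rabs e * (A * k)) by (apply Rmult_le_compat_l; lra).
pose proof (Rabs_diff_triang x (xs (ths t)) (xs th)); pose proof (Rabs_diff_triang y (ys (ths t)) (ys th)).
assert (E : A' * k = 2 * (A * k) + 2 * (K * Rabs e * (A * k))) by (unfold A'; ring).
lra.
Qed.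

Lemma coordinates_near_orbit eta : 0 < eta -> exists kappa, 0 < kappa /\ forall th x y,
  Rabs x <= bx -> Rabs y <= bx -> Rabs (x - xs th) + Rabs (y - ys th) < kappa ->
  near_orbit orbit eta (chart rs w C e th x y).
Proof.
intros Heta; pose proof (Rabs_pos_lt e He).
set (A := 3 * Rabs e * Kc).
assert (HA : 0 < A) by (apply Rmult_lt_0_compat; lra).
exists (eta / A); split; [now apply Rdiv_lt_0_compat|].
intros th x y Bx By Hn; destruct (angle_onto xs ys ths th A0) as [t Ht].
exists t; unfold orbit; rewrite Ht; destruct (Bd0 th).
eapply Rle_lt_trans; [apply (chart_lipschitz rs w C e) with (bx := bx) (A := Kc); auto; lra|]; fold A.
apply (Rmult_lt_compat_l A) in Hn; [|exact HA].
replace (A * (eta / A)) with eta in Hn by (field; lra); exact Hn.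
Qed.

Lemma near_orbit_same_angle eta : 0 < eta -> exists kappa, 0 < kappa /\ forall th x y,
  0 < rs + x -> near_orbit orbit kappa (chart rs w C e th x y) ->
  Rabs (x - xs th) + Rabs (y - ys th) < eta.
Proof.
intros Heta; destruct (near_orbit_coordinates eta Heta) as [k [Hk H]].
exists k; split; [exact Hk|]; intros th x y Hr Hp.
destruct (H _ Hp) as [th' [x' [y' [E [Hr' Hn]]]]].
destruct (chart_injective rs w C e Hw Hw2 Hw1 He th x y th' x' y' Hr Hr' E) as [-> [-> [n ->]]].
rewrite (periodic_IZR xs (2 * PI) (fun t => proj1 (Per0 t))), (periodic_IZR ys (2 * PI) (fun t => proj2 (Per0 t))).
exact Hn.
Qed.

Lemma solution_through th0 x0 y0 : exists x y th,
  field_solution g1 g2 x y /\ x th0 = x0 /\ y th0 = y0 /\ th 0 = th0 /\ angle_of x y th.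
Proof.
destruct (solution_exists m K z sg e mu La g1 g2 W1 W2 D1 D2 SF th0 x0 y0) as [x [y [Ex [Ey S]]]].
destruct (angle_exists x y th0 S) as [th [Eth A]].
exists x, y, th; repeat (split; [assumption|]); assumption.
Qed.

(* A point close to the orbit has a global forward solution, obtained from the
   angle-parametrized flow, and by uniqueness every solution follows it. *)
Lemma orbit_attracts_nearby : 0 < e -> mu < 0 -> La < 0 ->
  exists k, 0 < k /\ forall eta, 0 < eta -> exists kappa, 0 < kappa /\ forall p,
  near_orbit orbit kappa p -> exists v th x y,
    v 0 = p /\ (forall t, 0 <= t -> is_derive v t (chart_rossler w C M e (v t))) /\
    (forall t, 0 <= t -> v t = chart rs w C e (th t) (x t) (y t) /\ Rabs (x t) <= bx /\ Rabs (y t) <= bx /\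
       Rabs (x t - xs (th t)) + Rabs (y t - ys (th t)) <= eta * exp (- k * t)).
Proof.
intros Hpos Hmu HLa.
destruct (periodic_orbit_attracts m K z sg e mu La g1 g2 W1 W2 D1 D2 Hm HK Hz SF xs ys Hpos Hmu HLa S0 Bd0)
  as [A [k [HA [Hk H]]]].
exists (k * c0); split; [now apply Rmult_lt_0_compat|].
intros eta Heta.
set (eta' := Rmin eta (sg / 4) / A).
assert (P : 0 < Rmin eta (sg / 4)) by (apply Rmin_glb_lt; lra).
assert (Heta' : 0 < eta') by (unfold eta'; now apply Rdiv_lt_0_compat).
assert (EA : A * eta' = Rmin eta (sg / 4)) by (unfold eta'; field; lra).
pose proof (Rmin_l eta (sg / 4)) as M1; pose proof (Rmin_r eta (sg / 4)) as M2.
destruct (near_orbit_coordinates eta' Heta') as [kappa [Hkappa Hn]].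
exists kappa; split; [exact Hkappa|]; intros p Hp.
destruct (Hn p Hp) as [th0 [x0 [y0 [Ep [_ Hn0]]]]].
destruct (solution_through th0 x0 y0) as [x [y [th [S [Ex [Ey [Eth Ath]]]]]]].
rewrite <- Ex, <- Ey in Hn0.
assert (An : A * (Rabs (x th0 - xs th0) + Rabs (y th0 - ys th0)) < Rmin eta (sg / 4)).
{ rewrite <- EA; now apply Rmult_lt_compat_l. }
specialize (H x y th0 S ltac:(lra)).
assert (Hth : forall t, 0 <= t -> c0 * t <= th t - th0).
{ intros t Ht; pose proof (angle_grows x y th 0 t Ath Ht); rewrite Eth in *; lra. }
assert (Hth' : forall t, 0 <= t -> th0 <= th t).
{ intros t Ht; specialize (Hth t Ht); assert (0 <= c0 * t) by nonneg; lra. }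
assert (Nt : forall t, 0 <= t -> Rabs (x (th t) - xs (th t)) + Rabs (y (th t) - ys (th t))
    <= Rmin eta (sg / 4) * exp (- (k * c0) * t)).
{ intros t Ht; eapply Rle_trans; [apply H, Hth', Ht|].
  apply Rmult_le_compat; [apply Rmult_le_pos; [lra | apply Rplus_le_le_0_compat; apply Rabs_pos]
    | left; apply exp_pos | lra |].
  specialize (Hth t Ht).
  apply exp_le_exp; assert (k * (c0 * t) <= k * (th t - th0)) by (apply Rmult_le_compat_l; lra). lra. }
assert (E1 : forall t, 0 <= t -> exp (- (k * c0) * t) <= 1).
{ intros t Ht; rewrite <- exp_0; apply exp_le_exp; assert (0 <= k * c0 * t) by nonneg; lra. }
assert (Bt : forall t, 0 <= t -> Rabs (x (th t)) <= sg /\ Rabs (y (th t)) <= sg).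
{ intros t Ht; specialize (Nt t Ht); specialize (E1 t Ht); destruct (Bd0 (th t)).
  assert (Rmin eta (sg / 4) * exp (- (k * c0) * t) <= Rmin eta (sg / 4) * 1) by (apply Rmult_le_compat_l; lra).
  split; abs_lra. }
exists (fun t => chart rs w C e (th t) (x (th t)) (y (th t))), th, (fun t => x (th t)), (fun t => y (th t)).
split; [|split].
- rewrite Eth, Ex, Ey; now symmetry.
- intros t Ht; destruct (Bt t Ht); now apply lift_solution.
- intros t Ht; destruct (Bt t Ht); split; [reflexivity | split; [lra | split; [lra|]]].
  eapply Rle_trans; [now apply Nt|]; apply Rmult_le_compat_r; [left; apply exp_pos | exact M1].
Qed.

(** Uniqueness identifies a given solution, on whatever interval it is defined, with the lifted one;
    both properties are then read off the exponential bound. *)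
Lemma orbit_stable : 0 < e -> mu < 0 -> La < 0 ->
  asymptotically_stable (chart_rossler w C M e) orbit.
Proof.
intros Hpos Hmu HLa.
destruct (orbit_attracts_nearby Hpos Hmu HLa) as [k [Hk H]].
assert (E1 : forall t, 0 <= t -> exp (- k * t) <= 1).
{ intros t Ht; rewrite <- exp_0; apply exp_le_exp; assert (0 <= k * t) by nonneg; lra. }
assert (Uniq : forall u v t, 0 <= t ->
  (forall s', 0 <= s' <= t -> is_derive u s' (chart_rossler w C M e (u s'))) ->
  (forall s', 0 <= s' -> is_derive v s' (chart_rossler w C M e (v s'))) -> u 0 = v 0 -> u t = v t).
{ intros u v t Ht Su Sv; apply (rossler_unique (e * ((w ^ 2 - 1) * C + e ^ 2 * M)) (w ^ 2 - 1) (e * C)); auto.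
  intros s' Hs'; apply Sv; lra. }
split.
- intros eta Heta; destruct (coordinates_near_orbit eta Heta) as [k2 [Hk2 H2]].
  destruct (H (k2 / 2) ltac:(lra)) as [kappa [Hkappa H3]].
  exists kappa; split; [exact Hkappa|]; intros T u Su Hu t Ht.
  destruct (H3 _ Hu) as [v [th [x [y [Ev [Sv Hv]]]]]].
  assert (E : u t = v t) by (apply Uniq; auto; [lra | intros s' Hs'; apply Su; lra]).
  destruct (Hv t (proj1 Ht)) as [Ec [Bx [By Hn]]]; rewrite E, Ec; apply H2; auto.
  specialize (E1 t (proj1 Ht)); assert (k2 / 2 * exp (- k * t) <= k2 / 2 * 1) by (apply Rmult_le_compat_l; lra).
  lra.
- destruct (H 1 Rlt_0_1) as [kappa [Hkappa H3]].
  exists kappa; split; [exact Hkappa|]; intros p Hp.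
  destruct (H3 _ Hp) as [v [th [x [y [Ev [Sv Hv]]]]]].
  split; [exists v; split; [exact Ev | exact Sv]|].
  intros u Eu Su eta Heta; destruct (coordinates_near_orbit eta Heta) as [k2 [Hk2 H2]].
  (* From this time on [exp (k * t) >= k * t > / k2], so that [exp (- k * t) < k2]. *)
  exists (Rmax 0 (/ (k2 * k))); intros t Ht.
  assert (Ht0 : 0 <= t) by (left; eapply Rle_lt_trans; [apply Rmax_l | exact Ht]).
  assert (Ht1 : / (k2 * k) < t) by (eapply Rle_lt_trans; [apply Rmax_r | exact Ht]).
  assert (E : u t = v t) by (apply Uniq; auto; [intros s' Hs'; apply Su; lra | congruence]).
  destruct (Hv t Ht0) as [Ec [Bx [By Hn]]]; rewrite E, Ec; apply H2; auto.
  eapply Rle_lt_trans; [exact Hn|]; rewrite Rmult_1_l.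
  replace (- k * t) with (- (k * t)) by ring; rewrite exp_Ropp.
  assert (Pk : 0 < k2 * k) by now apply Rmult_lt_0_compat.
  assert (Q : 1 < k2 * (k * t)).
  { apply (Rmult_lt_compat_l (k2 * k)) in Ht1; [|exact Pk].
    rewrite Rinv_r in Ht1 by lra; lra. }
  assert (k * t <= exp (k * t)) by (pose proof (exp_ineq1_le (k * t)); lra).
  pose proof (exp_pos (k * t)).
  apply (Rmult_lt_reg_r (exp (k * t))); [assumption|]; rewrite Rinv_l by lra.
  apply Rlt_le_trans with (k2 * (k * t)); [exact Q | apply Rmult_le_compat_l; lra].
Qed.

(** Stability speaks of solutions of the true system, while the escaping solution solves the clamped
    one. As long as it stays in the box it lifts to a true solution, and stability keeps it within
    [sg / 4] of the orbit; by continuous induction it would never leave. *)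
Lemma orbit_unstable : 0 < e -> 0 < mu \/ 0 < La -> unstable (chart_rossler w C M e) orbit.
Proof.
intros Hpos Hsign Hst.
destruct (near_orbit_same_angle (sg / 4) ltac:(lra)) as [eta [Heta N3]].
destruct (Hst eta Heta) as [kappa [Hkappa H]].
destruct (coordinates_near_orbit kappa Hkappa) as [k2 [Hk2 N2]].
destruct (periodic_orbit_repels m K z sg e mu La g1 g2 W1 W2 D1 D2 Hm HK Hz SF xs ys Hpos Hsign S0 Bd0
  (Rmin k2 (sg / 4))) as [x [y [S [Hn0 Hout]]]]; [apply Rmin_glb_lt; lra|].
pose proof (Rmin_l k2 (sg / 4)); pose proof (Rmin_r k2 (sg / 4)).
destruct (angle_exists x y 0 S) as [th [Eth Ath]].
set (n := fun t => Rabs (x t - xs t) + Rabs (y t - ys t)); fold (n 0) in Hn0.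
assert (Bn : forall t, n t <= sg / 2 -> Rabs (x t) <= sg /\ Rabs (y t) <= sg).
{ intros t Ht; unfold n in Ht; destruct (Bd0 t).
  split; abs_lra. }
assert (Cn : forall t, continuous n t).
{ intros t; destruct (S t), (S0 t); apply continuous_l1_dist; eapply derive_continuous; eassumption. }
apply Hout; intros t Ht; apply Bn; left; revert t Ht.
apply self_improving_bound; [exact Cn | lra|].
intros t Ht Hb; destruct (angle_onto x y th t Ath) as [T HT].
assert (Mono : forall u v, u <= v -> th u <= th v).
{ intros u v Huv; pose proof (angle_grows x y th u v Ath Huv).
  assert (0 <= c0 * (v - u)) by nonneg; lra. }
assert (near : forall u, 0 <= u < T -> n (th u) < sg / 4).
{ intros u Hu.
  assert (Bu : forall v, 0 <= v < T -> Rabs (x (th v)) <= sg /\ Rabs (y (th v)) <= sg).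
  { intros v Hv; apply Bn, Hb; rewrite <- Eth at 1; rewrite <- HT; split; apply Mono; lra. }
  apply N3; [destruct (Bu u Hu) as [B _]; apply Rabs_le_between in B; lra|].
  apply (H T (fun v => chart rs w C e (th v) (x (th v)) (y (th v)))); [| |exact Hu].
  - intros v Hv; destruct (Bu v Hv); now apply lift_solution.
  - rewrite Eth; destruct (Bn 0) as [B1 B2]; [lra|]; apply N2; try lra.
    change (n 0 < k2); lra. }
apply Rnot_le_lt; intros Hbad; rewrite <- HT in Hbad.
assert (HT0 : 0 < T).
{ apply Rnot_le_lt; intros HT0; pose proof (Mono T 0 HT0) as M0; rewrite Eth, HT in M0.
  rewrite HT in Hbad; replace t with 0 in Hbad by lra; lra. }
(* Stability covers the times before [T] only; continuity at [T] adds less than [sg / 4], which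
   still meets the bound [sg / 2]. *)
assert (CT : continuous (fun u => n (th u)) T).
{ apply (continuous_comp th n); [eapply derive_continuous; apply Ath | apply Cn]. }
destruct (proj1 (filterlim_locally _ _) CT (mkposreal (sg / 4) ltac:(lra))) as [d Hd].
pose proof (cond_pos d) as Pd.
set (u := Rmax 0 (T - d / 2)).
assert (Hu : 0 <= u < T) by (unfold u; split; [apply Rmax_l | apply Rmax_lub_lt; lra]).
assert (Hu' : T - d / 2 <= u) by apply Rmax_r.
assert (Bu : ball T d u) by (change (Rabs (u - T) < d); rewrite Rabs_left; lra).
specialize (Hd u Bu); change (Rabs (n (th u) - n (th T)) < sg / 4) in Hd.
apply Rabs_def2 in Hd; specialize (near u Hu); lra.
Qed.

End Periodic.

Lemma orbit_exists : exists phi : R -> R3,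
  periodic_solution (chart_rossler w C M e) phi /\
  (forall t, exists th x y, phi t = chart rs w C e th x y /\ Rabs x <= bx /\ Rabs y <= bx) /\
  (0 < e -> mu < 0 -> La < 0 -> asymptotically_stable (chart_rossler w C M e) phi) /\
  (0 < e -> 0 < mu \/ 0 < La -> unstable (chart_rossler w C M e) phi).
Proof.
destruct (periodic_orbit_exists m K z sg e mu La g1 g2 W1 W2 D1 D2 Hm HK Hz SF) as [xs [ys [S0 [Per0 Bd0]]]].
destruct (angle_exists xs ys 0 S0) as [ths [E0 A0]].
exists (orbit xs ys ths); split; [|split; [|split]].
- now apply orbit_periodic.
- intros t; exists (ths t), (xs (ths t)), (ys (ths t)); split; [reflexivity|].
  destruct (Bd0 (ths t)); lra.
- intros; now apply orbit_stable.
- intros; now apply orbit_unstable.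
Qed.

End Orbit.

(** * From the parameter expansions to the theorem *)

Lemma lim0_ext_near (f g : R -> R) (l : R) :
  locally' 0 (fun e => f e = g e) -> lim0 f l -> lim0 g l.
Proof. apply filterlim_ext_loc. Qed.

(** The orders above three are absorbed into a vanishing remainder, placed so that a limit survives
    division by [e ^ 3]. *)
Lemma expansion5_third_order (f : R -> R) (c : nat -> R) : expansion5 f c ->
  exists r, lim0 r 0 /\
    locally' 0 (fun e => f e = e * c 1%nat + e ^ 2 * c 2%nat + e ^ 3 * (c 3%nat + r e)).
Proof.
intros [B [d Hd]].
set (S := fun e => e ^ 1 * c 1%nat + e ^ 2 * c 2%nat + e ^ 3 * c 3%nat + e ^ 4 * c 4%nat + e ^ 5 * c 5%nat).
exists (fun e => e * c 4%nat + e ^ 2 * c 5%nat + (f e - S e) / e ^ 3); split.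
- replace 0 with (0 * c 4%nat + 0 ^ 2 * c 5%nat + 0) at 1 by ring.
  repeat first [exact lim0_id | apply lim0_const | apply lim0_pow | apply lim0_mult | apply lim0_plus].
  apply (filterlim_locally (fun e => (f e - S e) / e ^ 3)); intros eps.
  assert (L : lim0 (fun e => B * e ^ 3) 0).
  { replace 0 with (B * 0 ^ 3) at 1 by ring; apply lim0_mult, lim0_pow, lim0_id; apply lim0_const. }
  generalize (filter_and _ _ (lim0_near _ _ eps L (cond_pos eps)) (near0 d (cond_pos d))).
  apply filter_imp; intros e [Le He]; change (Rabs ((f e - S e) / e ^ 3 - 0) < eps).
  assert (Ball : ball 0 d e) by (change (Rabs (e - 0) < d); rewrite Rminus_0_r; lra).
  specialize (Hd e Ball); cbv beta in Hd; do 4 rewrite sum_n_Sm in Hd by lia; rewrite sum_n_n in Hd.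
  change (Rabs (f e - S e) <= B * Rabs e ^ 6) in Hd.
  assert (P3 : 0 < Rabs e ^ 3) by (apply pow_lt; lra).
  rewrite Rminus_0_r in *; unfold Rdiv; rewrite Rabs_mult, Rabs_inv in *; rewrite <- RPow_abs in *.
  apply Rle_lt_trans with (B * Rabs e ^ 3).
  + apply (Rmult_le_reg_r (Rabs e ^ 3)); [exact P3|].
    rewrite Rmult_assoc, Rinv_l by lra; eapply Rle_trans; [rewrite Rmult_1_r; exact Hd | right; ring].
  + eapply Rle_lt_trans; [|exact Le]; apply Rmult_le_compat_r; [lra | apply Rle_abs].
- generalize (near0 1 Rlt_0_1); apply filter_imp; intros e He; unfold S; field.
  intros ->; rewrite Rabs_R0 in He; lra.
Qed.

Theorem theorem2 :
  forall (omega : R) (alpha beta gamma : R -> R) (al be ga : nat -> R),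
    0 < omega -> omega <> 1 -> omega <> sqrt 2 ->
    smooth_near_0 6 alpha -> smooth_near_0 6 beta -> smooth_near_0 6 gamma ->
    expansion5 alpha al -> expansion5 beta be -> expansion5 gamma ga ->
    ga 1%nat <> 0 ->
    al 1%nat = ga 1%nat * (omega ^ 2 - 1) ->
    al 2%nat = be 1%nat * ga 1%nat + ga 2%nat * (omega ^ 2 - 1) ->
    0 < delta omega al be ga ->
    let F := fun e : R =>
      rossler (alpha e) (omega ^ 2 - 1 + beta e) (gamma e) in
    exists phi : R -> R -> R3,
      locally' 0 (fun e => periodic_solution (F e) (fun t => phi t e)) /\
      (forall eta : R, 0 < eta ->
         locally' 0 (fun e => forall t : R, norm (phi t e) < eta)) /\
      (lambda1 omega ga < 0 /\ lambda2 omega ga < 0 ->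
         at_right 0 (fun e =>
           asymptotically_stable (F e) (fun t => phi t e))) /\
      (lambda1 omega ga > 0 \/ lambda2 omega ga > 0 ->
         at_right 0 (fun e => unstable (F e) (fun t => phi t e))).
Proof.
intros omega alpha beta gamma al be ga Hom Hom1 Hom2 _ _ _ Xa Xb Xg Hg Ha1 Ha2 Hdel F.
assert (Hom2' : omega ^ 2 <> 2).
{ intros E; apply Hom2; rewrite <- E, sqrt_pow2; lra. }
assert (Hom1' : omega ^ 2 - 1 <> 0).
{ intros H; apply Hom1; apply Rminus_diag_uniq, (Rmult_eq_reg_r (omega + 1)); lra. }
destruct (expansion5_third_order _ _ Xa) as [ra [La Ea]].
destruct (expansion5_third_order _ _ Xb) as [rb [Lb Eb]].
destruct (expansion5_third_order _ _ Xg) as [rg [Lg Eg]].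
(* Scaled parameters: [1 + b = wf ^ 2], [c = e * Cf] and [a - b * c = e ^ 3 * Mf]. The conditions on
   [al 1] and [al 2] cancel the lower orders of [a - b * c], so that [Mf] has the limit [M0]. *)
set (wf := fun e => sqrt (omega ^ 2 + beta e)).
set (Cf := fun e => gamma e / e).
set (Mf := fun e => (alpha e - (omega ^ 2 - 1 + beta e) * gamma e) / e ^ 3).
set (M0 := al 3%nat - (omega ^ 2 - 1) * ga 3%nat - be 1%nat * ga 2%nat - be 2%nat * ga 1%nat).
set (del := delta omega al be ga) in *.
assert (Nz : locally' 0 (fun e => e <> 0)).
{ generalize (near0 1 Rlt_0_1); apply filter_imp; intros e He ->; rewrite Rabs_R0 in He; lra. }
assert (Lbeta : lim0 beta 0).
{ apply (lim0_ext_near (fun e => e * be 1%nat + e ^ 2 * be 2%nat + e ^ 3 * (be 3%nat + rb e))).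
  { revert Eb; apply filter_imp; now intros e ->. }
  eapply lim0_eq; [repeat first [exact Lb | exact lim0_id | apply lim0_const | apply lim0_plus
    | apply lim0_pow | apply lim0_mult]|]; ring. }
assert (Lw : lim0 wf omega).
{ rewrite <- (sqrt_pow2 omega) by lra.
  apply (lim0_comp sqrt (fun e => omega ^ 2 + beta e)).
  - eapply lim0_eq; [apply lim0_plus; [apply lim0_const | exact Lbeta] | ring].
  - auto_derive; now apply pow_lt. }
assert (LC : lim0 Cf (ga 1%nat)).
{ apply (lim0_ext_near (fun e => ga 1%nat + e * ga 2%nat + e ^ 2 * (ga 3%nat + rg e))).
  - generalize (filter_and _ _ Nz Eg); apply filter_imp; intros e [Ne E]; unfold Cf; rewrite E; field; exact Ne.
  - eapply lim0_eq; [repeat first [exact Lg | exact lim0_id | apply lim0_const | apply lim0_plus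
      | apply lim0_pow | apply lim0_mult]|]; ring. }
assert (LM : lim0 Mf M0).
{ apply (lim0_ext_near (fun e => al 3%nat + ra e - (omega ^ 2 - 1) * (ga 3%nat + rg e)
     - (be 1%nat * (ga 2%nat + e * (ga 3%nat + rg e))
        + be 2%nat * (ga 1%nat + e * ga 2%nat + e ^ 2 * (ga 3%nat + rg e))
        + (be 3%nat + rb e) * (e * ga 1%nat + e ^ 2 * ga 2%nat + e ^ 3 * (ga 3%nat + rg e))))).
  - generalize (filter_and _ _ (filter_and _ _ Nz Ea) (filter_and _ _ Eb Eg)).
    apply filter_imp; intros e [[Ne E1] [E2 E3]]; unfold Mf; rewrite E1, E2, E3, Ha1, Ha2; field; exact Ne.
  - eapply lim0_eq; [repeat first [exact La | exact Lb | exact Lg | exact lim0_id | apply lim0_const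
      | apply lim0_minus | apply lim0_plus | apply lim0_pow | apply lim0_mult]|]; unfold M0; ring. }
(* The left side is the numerator of [delta] with the opposite sign. *)
assert (HM0 : M0 - ga 1%nat ^ 3 * (omega ^ 2 - 1) * (omega ^ 2 - 2) = - (del * (ga 1%nat * (1 - omega ^ 2)))).
{ unfold M0, del, delta; field; split; [intros Z; apply Hom1'; simpl; lra | exact Hg]. }
destruct (rossler_slow_fast omega (ga 1%nat) M0 del wf Cf Mf Hom Hom1 Hom2' Hg Hdel HM0 Lw LC LM)
  as [m [K [z [sg [Hm [HK [Hz [Hsg SF]]]]]]]].
destruct (coordinates_tame omega (ga 1%nat) del wf Cf Hom Hom1 Hom2' Hdel Lw LC) as [B [HB1 HB]].
pose proof (radius_pos del Hdel) as Hrad; pose proof (box_bounds del Hdel) as Hbox.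
assert (Hbox2 : box del <= radius del / 2) by apply Rmin_l.
(* All claims about one [e] in one predicate, so that a single choice of the periodic solution
   serves existence, smallness, stability and instability. *)
set (good := fun e phi =>
  periodic_solution (F e) phi /\
  (forall t, exists th x y, phi t = chart (radius del) (wf e) (Cf e) e th x y /\
     Rabs x <= box del /\ Rabs y <= box del) /\
  (0 < e -> lambda1 omega ga < 0 -> lambda2 omega ga < 0 -> asymptotically_stable (F e) phi) /\
  (0 < e -> lambda1 omega ga > 0 \/ lambda2 omega ga > 0 -> unstable (F e) phi)).
assert (HX : locally' 0 (fun e => exists phi, good e phi)).
{ generalize (filter_and _ _ (filter_and _ _ Nz HB) SF); apply filter_imp.
  intros e [[Ne [TX [TY TZ]]] [S [Hw [Hw2 [Hw1 [Hr2 [HO HOt]]]]]]].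
  assert (HF : F e = chart_rossler (wf e) (Cf e) (Mf e) e).
  { assert (Es : wf e ^ 2 = omega ^ 2 + beta e).
    (* [sqrt] is 0 on negative arguments, so [0 < wf e] excludes them. *)
    { unfold wf in *; apply pow2_sqrt; apply Rnot_lt_le; intros Hneg.
      rewrite sqrt_neg_0 in Hw; lra. }
    unfold F, chart_rossler; rewrite Es; f_equal; unfold Cf, Mf; [field | ring | field]; exact Ne. }
  destruct (orbit_exists (radius del) (wf e) (Cf e) (Mf e) e (box del) sg (omega / 2) m K z
    (rate1 omega (ga 1%nat) del) (rate2 wf Cf e) B (level1 omega del wf Cf Mf e) (level2 del wf Cf Mf e)
    (speed1 omega del wf Cf Mf e) (speed2 del wf Cf Mf e) Hrad Hw Hw2 Hw1 Ne
    ltac:(lra) Hsg ltac:(lra) Hm HK Hz S HO HOt HB1 TX TY TZ) as [phi [Q1 [Q2 [Q3 Q4]]]].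
  exists phi; unfold good; rewrite HF.
  assert (Hl2 : rate1 omega (ga 1%nat) del = lambda2 omega ga * (del / omega ^ 3)).
  { unfold rate1, lambda2, Rdiv; ring. }
  assert (Hl1 : rate2_limit omega (ga 1%nat) = lambda1 omega ga * / omega).
  { unfold rate2_limit, lambda1, Rdiv; ring. }
  assert (Pd : 0 < del / omega ^ 3) by (apply Rdiv_lt_0_compat; [exact Hdel | now apply pow_lt]).
  assert (Po : 0 < / omega) by now apply Rinv_0_lt_compat.
  split; [exact Q1 | split; [exact Q2 | split]].
  - intros He0' H1 H2; apply Q3; [exact He0' | rewrite Hl2; nra |].
    assert (rate2_limit omega (ga 1%nat) < 0) by (rewrite Hl1; nra); nra.
  - intros He0' [H1 | H2]; apply Q4; try exact He0'.
    + right; assert (0 < rate2_limit omega (ga 1%nat)) by (rewrite Hl1; now apply Rmult_lt_0_compat); nra.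
    + left; rewrite Hl2; now apply Rmult_lt_0_compat. }
(* For [e] without a good solution the value is arbitrary; by [HX] this does not happen for small
   [e] other than 0. *)
set (phi := fun e => epsilon (inhabits (fun _ : R => zero)) (good e)).
assert (Hphi : locally' 0 (fun e => good e (phi e))).
{ revert HX; apply filter_imp; intros e; apply epsilon_spec. }
assert (Right : forall P, locally' 0 P -> at_right 0 (fun e => 0 < e /\ P e)).
{ intros P [d Hd]; exists d; intros e He Hpos; split; [exact Hpos | apply Hd; [exact He | lra]]. }
exists (fun t e => phi e t); split; [|split; [|split]].
- revert Hphi; apply filter_imp; now intros e [Q _].
- intros eta Heta.
  assert (P : 0 < eta / (3 * B)) by (apply Rdiv_lt_0_compat; lra).
  generalize (filter_and _ _ (filter_and _ _ Hphi HB) (near0 _ P)); apply filter_imp.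
  intros e [[[_ [Q _]] [TX [TY TZ]]] He] t; destruct (Q t) as [th [x [y [-> [Bx By]]]]].
  destruct (TX th x y th x y), (TY th x y th x y), (TZ th x y th x y); auto.
  unfold chart; eapply Rle_lt_trans; [apply norm3_le0|].
  rewrite (Rmult_assoc e (wf e ^ 2 - 1)), !(Rabs_mult e).
  apply Rle_lt_trans with (Rabs e * (3 * B)).
  + rewrite <- !Rmult_plus_distr_l; apply Rmult_le_compat_l; lra.
  + apply Rlt_le_trans with (eta / (3 * B) * (3 * B)); [apply Rmult_lt_compat_r; lra | right; field; lra].
- intros [H1 H2]; generalize (Right _ Hphi); apply filter_imp; intros e [He [_ [_ [Q _]]]]; now apply Q.
- intros H; generalize (Right _ Hphi); apply filter_imp; intros e [He [_ [_ [_ Q]]]]; now apply Q.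
Qed.
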